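(* Assume that there exist constants $0<c_1<c_2<\infty$ and a function $\gamma:\mathbb{R}^d\to\mathbb{R}$ such that $(\gamma,\ldots,\gamma)^\top\in\mathcal{W}_{[-b,b]^d}$ for some fixed $0<b<\infty$ and, on $\mathbb{R}^d$, $$c_1\gamma^2 I_p\le \mathbf{F}^{(0)}\le c_2\gamma^2 I_p,\qquad c_1\gamma^2 I_p\le \mathbf{F}^{(1)}\le c_2\gamma^2 I_p ,$$ and that $$\int_{\mathbb{R}^d}\frac{1}{\gamma(\lambda)^4}\left\|\mathbf{F}^{(0)}(\lambda)-\mathbf{F}^{(1)}(\lambda)\right\|^2d\lambda<\infty .$$ Then $P(\mathbf{R}^{(0)})\equiv P(\mathbf{R}^{(1)})$ on the paths of $\mathbf{Z}$.
   Context: Let $d,p$ be positive integers and $D\subset\mathbb{R}^d$ a fixed bounded set with non-empty interior. For $a=0,1$, $\mathbf{R}^{(a)}=[R^{(a)}_{ij}]_{i,j=1}^p:\mathbb{R}^d\to\mathbb{R}^{p\times p}$ is a stationary matrix covariance function (positive definite: $\sum_{\ell,k=1}^n a_\ell^\top\mathbf{R}^{(a)}(s_\ell-s_k)a_k\ge0$ for all $n$, points $s_1,\dots,s_n$ and vectors $a_1,\dots,a_n\in\mathbb{R}^p$) whose entries are continuous and summable on $\mathbb{R}^d$. It has matrix spectral density $\mathbf{F}^{(a)}=[F^{(a)}_{ij}]_{i,j=1}^p$, i.e. $R^{(a)}_{ij}(h)=\int_{\mathbb{R}^d}F^{(a)}_{ij}(\lambda)e^{\mathrm{i}h^\top\lambda}d\lambda$;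 the $F^{(a)}_{jj}$ are real-valued, strictly positive and summable on $\mathbb{R}^d$, and for $i\ne j$ the complex-valued $F^{(a)}_{ij}$ has $|F^{(a)}_{ij}|$ summable. The matrices $\mathbf{F}^{(a)}(\lambda)$ are Hermitian non-negative definite. Notation: $\mathrm{i}^2=-1$; $\|\mathbf{N}\|$ is the largest singular value of a square complex matrix; for Hermitian matrices, $\mathbf{M}\ge\mathbf{N}$ means $\bar v^\top\mathbf{M}v\ge\bar v^\top\mathbf{N}v$ for all $v\in\mathbb{C}^p$; $I_p$ is the identity matrix. For a function $g$, the Fourier transform is $\mathcal{F}(g)(\lambda)=(2\pi)^{-d}\int_{\mathbb{R}^d}g(t)e^{-\mathrm{i}\lambda^\top t}dt$. For a bounded set $S\subset\mathbb{R}^d$ with non-empty interior, $\mathcal{W}_S$ is the set of functions $(f_1,\ldots,f_p)^\top:\mathbb{R}^d\to\mathbb{C}^p$ with $f_i=\mathcal{F}(g_i)$ for some $g_i\in L^2(\mathbb{R}^d)$ that is zero outside $S$. $\mathbf{Z}=\{\mathbf{Z}(s)=(Z_1(s),\ldots,Z_p(s))^\top,\ s\in D\}$ is a $p$-variate random field on a measurable space $(\Omega,\mathcal{A})$. $P(\mathbf{R}^{(a)})$ denotes a probability measure on it under which $\mathbf{Z}$ is Gaussian with zero mean and $\mathrm{Cov}(Z_i(t),Z_j(s))=R^{(a)}_{ij}(t-s)$ for $t,s\in D$. Two measures $P^{(0)},P^{(1)}$ are equivalent on the paths of $\mathbf{Z}$, written $P^{(0)}\equiv P^{(1)}$, if for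 every $A$ in the $\sigma$-algebra generated by $\mathbf{Z}$, $P^{(1)}(A)=1$ if and only if $P^{(0)}(A)=1$. *)

(* Defs.v *)
From HB Require Import structures.
From mathcomp Require Import all_boot all_order all_algebra.
From mathcomp Require Import all_classical all_reals all_analysis.
From mathcomp Require Import complex.

Set Implicit Arguments.
Unset Strict Implicit.
Unset Printing Implicit Defensive.

Import Order.TTheory GRing.Theory Num.Theory numFieldNormedType.Exports.

Local Open Scope classical_set_scope.
Local Open Scope ring_scope.
Local Open Scope complex_scope.
Local Open Scope sesquilinear_scope.

(* The product sigma-algebra on 'rV[R]_n (it is the Borel one). *)
Definition measure_rV_display : measure_display -> measure_display.
Proof. exact. Qed.

Section measurable_rV.
Context {R : realType} (n : nat).

Let coors : 'I_n -> 'rV[R]_n -> R := fun i v => v ord0 i.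

Let rV_set0 : g_sigma_preimage coors set0.
Proof. exact: sigma_algebra0. Qed.

Let rV_setC A : g_sigma_preimage coors A -> g_sigma_preimage coors (~` A).
Proof. exact: sigma_algebraC. Qed.

Let rV_bigcup (F : (set 'rV[R]_n)^nat) :
  (forall i, g_sigma_preimage coors (F i)) ->
  g_sigma_preimage coors (\bigcup_i (F i)).
Proof. exact: sigma_algebra_bigcup. Qed.

HB.instance Definition _ :=
  @isMeasurable.Build (measure_rV_display default_measure_display)
  'rV[R]_n (g_sigma_preimage coors) rV_set0 rV_setC rV_bigcup.

End measurable_rV.

Section measurable_rV_lemmas.
Context {R : realType}.

Lemma measurable_coord n (i : 'I_n) :
  measurable_fun [set: 'rV[R]_n] (fun v : 'rV[R]_n => v ord0 i).
Proof.
move=> _ Y mY; rewrite setTI; apply: sub_sigma_algebra => /=.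
rewrite -bigcup_seq/=; exists i => /=; first by rewrite mem_index_enum.
by exists Y => //; rewrite setTI.
Qed.

Lemma measurable_fun_rV d (T : measurableType d) n (f : T -> 'rV[R]_n) :
  (forall i, measurable_fun [set: T] (fun x => f x ord0 i)) ->
  measurable_fun [set: T] f.
Proof.
move=> mf _ A mA; rewrite setTI.
pose S := [set B | measurable (f @^-1` B)].
suff : (@measurable _ 'rV[R]_n) `<=` S by apply.
apply: smallest_sub.
  split; first by rewrite /S/= preimage_set0.
  - move=> B SB; rewrite setTD /S/= -preimage_setC; exact: measurableC.
  - by move=> F SF; rewrite /S/= preimage_bigcup; apply: bigcup_measurable => k _; exact: SF.
move=> B; rewrite -bigcup_seq/= => -[i _ [C mC <-]].
rewrite /S/= setTI; have := mf i measurableT C mC.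
by rewrite setTI.
Qed.

End measurable_rV_lemmas.

Section lebesgue_rV.
Context {R : realType}.

Definition consr n (z : R * 'rV[R]_n) : 'rV[R]_n.+1 :=
  \row_i (if unlift ord0 i is Some j then z.2 ord0 j else z.1).

Definition unconsr n (v : 'rV[R]_n.+1) : R * 'rV[R]_n :=
  (v ord0 ord0, \row_j v ord0 (lift ord0 j)).

Lemma consrK n : cancel (@consr n) (@unconsr n).
Proof.
move=> [x v]; rewrite /unconsr /consr mxE unlift_none/=; congr pair.
by apply/rowP => j; rewrite !mxE liftK.
Qed.

Lemma unconsrK n : cancel (@unconsr n) (@consr n).
Proof.
move=> v; apply/rowP => i; rewrite mxE.
by case: unliftP => [j|] ->; rewrite ?mxE.
 Qed.

Lemma measurable_consr n : measurable_fun [set: R * 'rV[R]_n] (@consr n).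
Proof.
apply: measurable_fun_rV => i; rewrite /consr.
under eq_fun do rewrite mxE.
case: (unlift ord0 i) => [j|]; last exact: measurable_fst.
apply: (measurableT_comp (measurable_coord j)); exact: measurable_snd.
Qed.

Lemma measurable_unconsr n : measurable_fun [set: 'rV[R]_n.+1] (@unconsr n).
Proof.
apply/measurable_fun_pairP; split; first exact: measurable_coord.
apply: measurable_fun_rV => i.
rewrite (_ : (fun _ => _) = fun v : 'rV[R]_n.+1 => v ord0 (lift ord0 i)).
  exact: measurable_coord.
by apply/funext => v; rewrite /= mxE.
Qed.

Section step.
Context n (mu : {sigma_finite_measure set 'rV[R]_n -> \bar R}).

Definition lebesgue_consr : set 'rV[R]_n.+1 -> \bar R :=
  pushforward (lebesgue_measure \x mu)%E (@consr n).

Let mcons := @measurable_consr n.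

Let lebesgue_consr0 : lebesgue_consr set0 = 0%E.
Proof. by rewrite /lebesgue_consr /pushforward preimage_set0 measure0. Qed.

Let lebesgue_consr_ge0 A : (0 <= lebesgue_consr A)%E.
Proof. exact: measure_ge0. Qed.

Let lebesgue_consr_sigma_additive : semi_sigma_additive lebesgue_consr.
Proof. by apply: (@measure_semi_sigma_additive _ _ _
  (measure_function_pushforward__canonical__measure_function_Measure
     (product_measure1 lebesgue_measure mu) mcons)). Qed.

HB.instance Definition _ := isMeasure.Build _ _ _ lebesgue_consr
  lebesgue_consr0 lebesgue_consr_ge0 lebesgue_consr_sigma_additive.

Let lebesgue_consr_sigma_finite : sigma_finite setT lebesgue_consr.
Proof.
have /sigma_finiteP[F [TF ndF Foo]] := sigma_finiteT (@lebesgue_measure R).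
have /sigma_finiteP[G [TG ndG Goo]] := sigma_finiteT mu.
exists (fun k => @unconsr n @^-1` (F k `*` G k)).
  rewrite -preimage_bigcup [X in _ @^-1` X](_ : _ = setT) ?preimage_setT//.
  rewrite -subTset => -[x v] _.
  have [k _ Fx] : (\bigcup_k F k) x by rewrite -TF.
  have [l _ Gv] : (\bigcup_k G k) v by rewrite -TG.
  exists (maxn k l) => //; split => /=.
  - by move: x Fx; exact/subsetPset/ndF/leq_maxl.
  - by move: v Gv; exact/subsetPset/ndG/leq_maxr.
move=> k; have [mF Fk] := Foo k; have [mG Gk] := Goo k; split.
  rewrite -[X in measurable X]setTI; apply: measurable_unconsr => //.
  exact: measurableX.
rewrite /lebesgue_consr /pushforward -comp_preimage.
rewrite (_ : _ \o _ = id) ?preimage_id; last first.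
  by apply/funext => z /=; rewrite consrK.
by rewrite product_measure1E// lte_mul_pinfty// ge0_fin_numE.
Qed.

HB.instance Definition _ := Measure_isSigmaFinite.Build _ _ _ lebesgue_consr
  lebesgue_consr_sigma_finite.

Lemma lebesgue_consrE (A : set R) (B : set 'rV[R]_n) :
  measurable A -> measurable B ->
  lebesgue_consr [set v | A (v ord0 ord0) /\ B (\row_j v ord0 (lift ord0 j))] =
  (lebesgue_measure A * mu B)%E.
Proof.
move=> mA mB; rewrite -product_measure1E// /lebesgue_consr /pushforward.
congr (_ _); apply/seteqP; split => -[x v] /=.
  by have := consrK (x, v); rewrite /unconsr => -[-> ->].
by have := consrK (x, v); rewrite /unconsr => -[-> ->].
Qed.

End step.

Fixpoint lebesgue_rV (n : nat) :
    {sigma_finite_measure set 'rV[R]_n -> \bar R} :=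
  if n is n'.+1 then lebesgue_consr (lebesgue_rV n') else \d_(0 : 'rV[R]_0).

Lemma lebesgue_rV_box n (a b : 'rV[R]_n) : (forall i, a ord0 i <= b ord0 i) ->
  lebesgue_rV n [set v | forall i, a ord0 i <= v ord0 i <= b ord0 i] =
  (\prod_(i < n) (b ord0 i - a ord0 i))%:E.
Proof.
elim: n a b => [a b _|n IHn a b ab].
  by rewrite big_ord0 /= diracE mem_set//= => -[].
rewrite big_ord_recl EFinM.
pose A : set R := `[a ord0 ord0, b ord0 ord0]%classic.
pose B : set 'rV[R]_n :=
  [set w | forall i, a ord0 (lift ord0 i) <= w ord0 i <= b ord0 (lift ord0 i)].
have mB : measurable B.
  rewrite (_ : B = \bigcap_(i in [set: 'I_n])
      ((fun w : 'rV[R]_n => w ord0 i) @^-1`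
         `[a ord0 (lift ord0 i), b ord0 (lift ord0 i)]%classic)).
    apply: fin_bigcap_measurable => // i _.
    by rewrite -[X in measurable X]setTI; exact: measurable_coord.
  apply/seteqP; split => w /= H i.
    by move=> _; rewrite /preimage/= in_itv/=; exact: H.
  by have := H i I; rewrite /preimage/= in_itv.
transitivity (lebesgue_measure A * lebesgue_rV n B)%E.
  rewrite -lebesgue_consrE//; last exact: measurable_itv.
  apply: (congr1 (lebesgue_consr (lebesgue_rV n))).
  apply/seteqP; split => v /=.
    move=> H; split; first by rewrite /A/= in_itv/=.
    by move=> i; rewrite mxE.
  rewrite /A/= in_itv/= => -[H0 H] i.
  by case: (unliftP ord0 i) => [j|] ->//; have := H j; rewrite mxE.
rewrite lebesgue_measure_itv/= lte_fin; congr (_ * _)%E.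
  case: ltP => // ba; apply/eqP; rewrite eqe eq_sym subr_eq0.
  by rewrite eq_le ba ab.
pose a' : 'rV[R]_n := \row_j a ord0 (lift ord0 j).
pose b' : 'rV[R]_n := \row_j b ord0 (lift ord0 j).
transitivity (\prod_(i < n) (b' ord0 i - a' ord0 i))%:E; last first.
  by congr EFin; apply: eq_bigr => i _; rewrite !mxE.
rewrite -IHn; last by move=> i; rewrite !mxE.
apply: (congr1 (lebesgue_rV n)).
by apply/seteqP; split => w /= H i; have := H i; rewrite !mxE.
Qed.

End lebesgue_rV.

Definition dotv (R : realType) d (h l : 'rV[R]_d) : R := (h *m l^T) ord0 ord0.

Section complex_functions.
Context {R : realType}.

Definition cmod (z : R[i]) : R := complex.Re `|z|.

Definition cexpi (t : R) : R[i] := cos t +i* sin t.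

Context {d : nat}.
Notation mu := (lebesgue_rV d : {measure set 'rV[R]_d -> \bar R}).
Implicit Types f g : 'rV[R]_d -> R[i].

Definition cmeasurable f :=
  measurable_fun setT (fun x => complex.Re (f x)) /\
  measurable_fun setT (fun x => complex.Im (f x)).

Definition csummable f :=
  cmeasurable f /\ mu.-integrable setT (fun x => (cmod (f x))%:E).

Definition csquare_summable f :=
  cmeasurable f /\ mu.-integrable setT (fun x => (cmod (f x) ^+ 2)%:E).

(* Meaningful for summable f. *)
Definition cintegral f : R[i] :=
  (\int[mu]_x complex.Re (f x)) +i* (\int[mu]_x complex.Im (f x)).

Definition fourier g : 'rV[R]_d -> R[i] := fun l =>
  ((2 * pi) ^- d)%:C * cintegral (fun t => g t * cexpi (- dotv l t)).

(* For bounded S, square summable functions vanishing outside S are summable,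
   so the integral defining [fourier] converges absolutely. *)
Definition Wspace p (S : set 'rV[R]_d) : set ('rV[R]_d -> 'cV[R[i]]_p) :=
  [set f | exists g : 'I_p -> 'rV[R]_d -> R[i],
    forall i, [/\ csquare_summable (g i),
                  forall x, ~ S x -> g i x = 0 &
                  forall l, f l i ord0 = fourier (g i) l]].

Definition cube (b : R) : set 'rV[R]_d :=
  [set x | forall i, - b <= x ord0 i <= b].

End complex_functions.

Section matrices.
Context {R : realType} {p : nat}.
Implicit Types M N : 'M[R[i]]_p.

(* [<=] on R[i] compares real parts and requires equal imaginary parts. *)
Definition loewner_le M N :=
  forall v : 'cV[R[i]]_p,
    (v ^t* *m M *m v) ord0 ord0 <= (v ^t* *m N *m v) ord0 ord0.

Definition singular_values N : set R :=
  [set s | 0 <= s /\ eigenvalue (N ^t* *m N) (s ^+ 2)%:C].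

(* The set is finite, and nonempty when 0 < p: the supremum is a maximum. *)
Definition opnorm N : R := sup (singular_values N).

End matrices.

Section covariance_spectral.
Context {R : realType} {d p : nat}.
Notation mu := (lebesgue_rV d : {measure set 'rV[R]_d -> \bar R}).

Definition positive_definite_fun (C : 'rV[R]_d -> 'M[R]_p) :=
  forall n (s : 'I_n -> 'rV[R]_d) (a : 'I_n -> 'cV[R]_p),
    0 <= (\sum_l \sum_k (a l)^T *m C (s l - s k) *m a k) ord0 ord0.

Definition matrix_covariance (C : 'rV[R]_d -> 'M[R]_p) :=
  [/\ positive_definite_fun C,
      forall i j, continuous (fun h => C h i j) &
      forall i j, mu.-integrable setT (fun h => (C h i j)%:E)].

(* [0 < F l j j] in R[i] means that F l j j is real and strictly positive. *)
Definition matrix_spectral_density (C : 'rV[R]_d -> 'M[R]_p)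
    (F : 'rV[R]_d -> 'M[R[i]]_p) :=
  [/\ forall l j, 0 < F l j j,
      forall i j, csummable (fun l => F l i j),
      forall l, F l \is hermsymmx,
      forall l, loewner_le 0 (F l) &
      forall h i j,
        (C h i j)%:C = cintegral (fun l => F l i j * cexpi (dotv h l))].

End covariance_spectral.

Section random_field.
Context {R : realType} {d p : nat} {dO : measure_display}
  {Omega : measurableType dO}.

(* [normal_prob m 0] is not a Dirac mass, hence the case distinction. *)
Definition gaussian_law (m s : R) : set R -> \bar R :=
  if s == 0 then \d_m else normal_prob m s.

Definition gaussian_rv (P : probability Omega R) (Y : Omega -> R) :=
  exists m s : R, forall A : set R, measurable A ->
    P (Y @^-1` A) = gaussian_law m s A.

Context {D : set 'rV[R]_d} (Z : D -> 'I_p -> {mfun Omega >-> R}).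

(* Joint Gaussianity: every finite linear combination is (possibly degenerate)
   univariate Gaussian. *)
Definition gaussian_field (P : probability Omega R) :=
  forall n (s : 'I_n -> D) (i : 'I_n -> 'I_p) (c : 'I_n -> R),
    gaussian_rv P (fun w => \sum_k c k * Z (s k) (i k) w).

Definition centered_gaussian (P : probability Omega R)
    (C : 'rV[R]_d -> 'M[R]_p) :=
  [/\ gaussian_field P,
      forall s i, ('E_P[Z s i] = 0)%E &
      forall t s i j,
        covariance P (Z t i) (Z s j) = (C (set_val t - set_val s) i j)%:E].

Definition field_sigma_algebra : set (set Omega) :=
  <<s [set A | exists (s : D) (i : 'I_p) (B : set R),
                 measurable B /\ A = Z s i @^-1` B] >>.

Definition equivalent_on_paths (P0 P1 : probability Omega R) :=
  forall A, field_sigma_algebra A -> P1 A = 1%E <-> P0 A = 1%E.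

End random_field.

(* Main.v *)
(** By symmetry it suffices to show that P0 A = 0 implies P1 A = 0.
    For every trigonometric polynomial T in finitely many coordinates of Z with
    values in [0, 1],
        (E_1 T)^(q+1) <= M E_0 T,   with q and M independent of T;
    such T are dense, in L^1(P0 + P1), among the indicators of events of the
    sigma-algebra of Z, so the bound passes to A.

    To get the bound, diagonalize simultaneously the two (slightly regularized)
    covariance matrices of the coordinates occurring in T: in the resulting basis
    the laws are products of the N(0, 1) and of the N(0, s_k), and one-dimensional
    Hoelder inequalities, based on the explicit Gaussian densities, give
    M = exp (const * sum_k (s_k - 1)^2).

    The sum is bounded uniformly by a Paley-Wiener argument. Write the variance of
    a linear form as an integral of u^* F u, where u is the vector of the
    exponential sums of the form. As gamma is the Fourier transform of a function
    supported in a cube and D is bounded, gamma u is band-limited, so its pointwise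
    values are controlled by its L^2 norm, that is by the variance. By duality, for
    an orthonormal family of linear forms, gamma^2 sum_k |u_k|^2 is bounded by a
    constant, and the Cauchy-Schwarz inequality bounds sum_k (s_k - 1)^2 by a
    multiple of the integral of gamma^-4 ||F0 - F1||^2. *)

Require Import Defs.
From HB Require Import structures.
From mathcomp Require Import all_boot all_order all_algebra.
From mathcomp Require Import all_classical all_reals all_analysis.
From mathcomp Require Import complex.
From mathcomp Require Import measurable_realfun ring lra.

Set Implicit Arguments.
Unset Strict Implicit.
Unset Printing Implicit Defensive.

Import Order.TTheory GRing.Theory Num.Theory numFieldNormedType.Exports.

Local Open Scope classical_set_scope.
Local Open Scope ring_scope.
Local Open Scope complex_scope.

(** * Linear algebra *)

(** The exponent in the bound is forced: the density of N(0, s_k) with respect to N(0, 1) is not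
    square integrable once s_k >= 2. The spectral bounds confine every s_k to the interval from c1 /
    c2 to c2 / c1, so a moment of order (n + 1) / n exists as soon as c2 / c1 <= (n + 1) / 2, and q
    is such an n. In the logarithm of that moment the terms of first order in s_k - 1 cancel, which
    is why a sum of squares controls M. Trigonometric polynomials serve as test functions for two
    reasons: their Gaussian means are explicit in the covariance kernel, and integrating out one
    Gaussian direction gives another trigonometric polynomial. The product laws are therefore
    handled one direction at a time, as iterated integrals on the line. A multiple e of the identity
    is added to both covariance matrices so that the first one is certainly invertible. It cancels
    in the difference of the variances and spoils no bound, so M does not depend on e, which tends
    to 0 at the end. *)

Section linear_algebra.
Local Open Scope sesquilinear_scope.
Context {R : realType}.

(** The complexification of [S] is hermitian, so the complex spectral theorem provides a real
    eigenvalue; being a root of the characteristic polynomial descends along the embedding of [R]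
    into [R[i]]. *)
Lemma real_symmetric_eigenvalue n (S : 'M[R]_n.+1) : S^T = S ->
  exists a, eigenvalue S a.
Proof.
move=> Ssym; pose A := map_mx (real_complex R) S.
have Aherm : A \is hermsymmx.
  apply/is_hermitianmxP; rewrite expr0 scale1r.
  apply/matrixP => i j; rewrite !mxE.
  have -> : S i j = S j i by rewrite -{1}Ssym mxE.
  exact/esym/conjc_real.
have Areal := hermitian_spectral_diag_real Aherm.
have /orthomx_spectralP AE := hermitian_normalmx Aherm.
set P := spectralmx A in AE; set sp := spectral_diag A in AE Areal.
have Pu : P \in unitmx by exact: spectral_unit.
have spr : sp 0 0 = real_complex R (complex.Re (sp 0 0)).
  by apply/esym/RRe_real; exact: (mxOverP Areal).
exists (complex.Re (sp 0 0)).
suff : eigenvalue A (real_complex R (complex.Re (sp 0 0))).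
  by rewrite !eigenvalue_root_char -map_char_poly fmorph_root.
rewrite -spr; apply/eigenvalueP; exists (row 0 P).
  rewrite -/A AE -!row_mul !mulmxA mulmxV// mul1mx.
  by apply/rowP => j; rewrite mul_diag_mx !mxE.
apply/eqP => P0; have : row 0 (P *m invmx P) = 0 by rewrite row_mul P0 mul0mx.
rewrite mulmxV// => /rowP/(_ 0); rewrite !mxE eqxx => /eqP.
by rewrite oner_eq0.
Qed.


Lemma mulmx_trE n (w : 'rV[R]_n) : (w *m w^T) 0 0 = \sum_j w 0 j ^+ 2.
Proof. by rewrite mxE; apply: eq_bigr => j _; rewrite mxE expr2. Qed.

Lemma mulmx_tr_ge0 n (w : 'rV[R]_n) : 0 <= (w *m w^T) 0 0.
Proof. by rewrite mulmx_trE sumr_ge0// => j _; rewrite sqr_ge0. Qed.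

Lemma mulmx_tr_eq0 n (w : 'rV[R]_n) : ((w *m w^T) 0 0 == 0) = (w == 0).
Proof.
apply/eqP/eqP => [|->]; last by rewrite mul0mx mxE.
rewrite mulmx_trE => /eqP; rewrite psumr_eq0 => [/allP w0|j _]; last exact: sqr_ge0.
apply/rowP => j; have := w0 j (mem_index_enum _).
by rewrite sqrf_eq0 mxE => /eqP.
Qed.

(* Householder: reflection exchanging the first basis vector and v. *)
Lemma orthogonal_completion n (v : 'rV[R]_n.+1) : v *m v^T = 1%:M ->
  exists H : 'M[R]_n.+1, H^T *m H = 1%:M /\ row 0 H = v /\ H^T = H.
Proof.
move=> vv1; pose e : 'rV[R]_n.+1 := delta_mx 0 0.
have [w wE] : exists w, w = e - v by exists (e - v).
have e0 : e *m e^T = 1%:M.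
  by rewrite trmx_delta mul_delta_mx; apply/matrixP => i j; rewrite !mxE !ord1.
have ev : e *m v^T = v *m e^T.
  have tr1 (M : 'M[R]_1) : M^T = M by apply/matrixP => i j; rewrite !ord1 mxE.
  by rewrite -[RHS]tr1 trmx_mul trmxK.
have [w0|w0] := eqVneq (w *m w^T) 0.
  have wz : w = 0 by apply/eqP; rewrite -mulmx_tr_eq0 w0 mxE.
  exists 1%:M; rewrite trmx1 mulmx1; split => //; split => //.
  by rewrite row1 -/e; apply/eqP; rewrite -subr_eq0 -wE wz.
pose c := 2 / (w *m w^T) 0 0.
have wwE : w *m w^T = ((w *m w^T) 0 0)%:M.
  by apply/matrixP => i j; rewrite !ord1 [RHS]mxE.
have ww0 : (w *m w^T) 0 0 != 0.
  by apply: contraNneq w0 => w0; rewrite wwE w0 raddf0.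
have sym : (1%:M - c *: (w^T *m w))^T = 1%:M - c *: (w^T *m w).
  by rewrite linearB/= linearZ/= trmx1 trmx_mul trmxK.
exists (1%:M - c *: (w^T *m w)); rewrite sym; split; last split => //.
  have WW : (w^T *m w) *m (w^T *m w) = (w *m w^T) 0 0 *: (w^T *m w).
    by rewrite mulmxA -(mulmxA w^T w) wwE mul_mx_scalar -scalemxAl !mxE eqxx.
  rewrite mulmxBl mul1mx mulmxBr mulmx1 -!scalemxAl -!scalemxAr WW !scalerA.
  rewrite -addrA -opprD -scalerBl -scalerDl.
  rewrite [X in X *: _](_ : _ = 0) ?scale0r ?oppr0 ?addr0//.
  by rewrite /c; field.
rewrite linearB/= row1 -/e linearZ/= row_mul.
have -> : row 0 w^T = (e *m w^T).
  by rewrite /e -rowE.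
have M1 (M : 'M[R]_1) : M = (M 0 0)%:M.
  by apply/matrixP => i j; rewrite !ord1 [RHS]mxE eqxx mulr1n.
set a := (e *m v^T) 0 0; have evE : e *m v^T = a%:M by exact: M1.
have -> : e *m w^T = (1 - a)%:M by rewrite wE linearB/= mulmxBr e0 evE raddfB.
have wwa : (w *m w^T) 0 0 = 2 * (1 - a).
  rewrite wE linearB/= mulmxBr !mulmxBl e0 vv1 -ev evE -!raddfB/= !mxE eqxx mulr1n.
  by ring.
have a1 : 1 - a != 0 by apply: contraNneq ww0 => a1; rewrite wwa a1 mulr0.
rewrite /c wwa mul_scalar_mx scalerA [X in X *: _](_ : _ = 1).
  by rewrite scale1r wE opprB addrC subrK.
by field.
Qed.

(** The diagonalizing matrix must be real, since it will act on real linear forms. Hence an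
    induction: a unit eigenvector is completed to a Householder matrix [H], and conjugation by [H]
    splits off a block of size 1. *)
Lemma real_spectral n (S : 'M[R]_n) : S^T = S ->
  exists (O : 'M[R]_n) (s : 'rV[R]_n),
    O *m O^T = 1%:M /\ O *m S *m O^T = diag_mx s.
Proof.
elim: n S => [|n IH] S Ssym.
  by exists 1%:M, 0; split; apply/matrixP => -[].
have [a /eigenvalueP[v0 v0S v00]] := real_symmetric_eigenvalue Ssym.
have nv0 : 0 < (v0 *m v0^T) 0 0.
  by rewrite lt0r mulmx_tr_ge0 mulmx_tr_eq0 v00.
pose v := (Num.sqrt ((v0 *m v0^T) 0 0))^-1 *: v0.
have vS : v *m S = a *: v by rewrite /v -scalemxAl v0S !scalerA mulrC.
have vv : v *m v^T = 1%:M.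
  rewrite /v linearZ/= -scalemxAl -scalemxAr scalerA -expr2 exprVn sqr_sqrtr ?ltW//.
  apply/matrixP => i j; rewrite !ord1 mxE mulVf ?gt_eqF//.
  by rewrite mxE.
have [H [HH [Hv Hs]]] := orthogonal_completion vv.
have [M MH] : exists M : 'M[R]_(1 + n), M = H *m S *m H by eexists.
have Msym : M^T = M by rewrite MH !trmx_mul Hs Ssym mulmxA.
have M0 : row 0 M = a *: delta_mx 0 0.
  rewrite MH !row_mul Hv vS -scalemxAl -Hv -row_mul; congr (_ *: _).
  by rewrite -{1}Hs HH row1.
have ME : M = block_mx (a%:M : 'M[R]_1) 0 0 (drsubmx M).
  rewrite -[LHS](submxK M); congr block_mx.
  - apply/matrixP => i j; rewrite !ord1.
    move/rowP/(_ 0): M0; rewrite !mxE !eqxx mulr1 => <-.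
    by congr (M _ _); apply/val_inj.
  - apply/matrixP => i j; rewrite !ord1.
    move/rowP/(_ (rshift 1 j)): M0; rewrite !mxE/= mulr0 => <-.
    by congr (M _ _); apply/val_inj.
  - apply/matrixP => i j; rewrite !ord1.
    move/rowP/(_ (rshift 1 i)): M0; rewrite -{1}Msym !mxE/= mulr0 => <-.
    by congr (M _ _); apply/val_inj.
have [|U [s' [U1 U2]]] := IH (drsubmx M).
  by rewrite -{2}Msym trmx_drsub.
pose B : 'M[R]_(1 + n) := block_mx 1%:M 0 0 U.
have BT : B^T = block_mx 1%:M 0 0 U^T by rewrite /B tr_block_mx !trmx0 trmx1.
have BB : @mulmx _ (1 + n) (1 + n) (1 + n) B B^T = 1%:M.
  rewrite BT /B mulmx_block !mulmx0 !mul0mx mulmx1 !addr0 add0r U1.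
  by rewrite -scalar_mx_block.
have BMB : @mulmx _ (1 + n) (1 + n) (1 + n) (@mulmx _ (1 + n) (1 + n) (1 + n) B M) B^T =
    diag_mx (row_mx (a%:M : 'M[R]_1) s').
  rewrite ME BT /B !mulmx_block !(mulmx0, mul0mx, mulmx1, mul1mx, addr0, add0r).
  rewrite U2 diag_mx_row; congr block_mx.
  by apply/matrixP => i j; rewrite !ord1 !mxE !eqxx.
exists (B *m H : 'M[R]_(1 + n)), (row_mx (a%:M : 'M[R]_1) s'); split.
  by rewrite trmx_mul mulmxA -(mulmxA B) Hs -{1}Hs HH mulmx1; exact: BB.
by rewrite trmx_mul Hs !mulmxA -(mulmxA B) -(mulmxA B) -MH; exact: BMB.
Qed.

Definition posdefmx n (S : 'M[R]_n) :=
  S^T = S /\ forall v : 'rV[R]_n, v != 0 -> 0 < (v *m S *m v^T) 0 0.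

(** Diagonalizing [S0] and rescaling by inverse square roots turns it into the identity. An
    orthogonal [U] that diagonalizes the transformed [S1] leaves this identity unchanged. *)
Lemma simultaneous_diagonalization n (S0 S1 : 'M[R]_n) :
  posdefmx S0 -> S1^T = S1 ->
  exists (E : 'M[R]_n) (s : 'rV[R]_n),
    [/\ E \in unitmx, E *m S0 *m E^T = 1%:M & E *m S1 *m E^T = diag_mx s].
Proof.
move=> [S0sym S0pos] S1sym.
have [V [d [VV VS]]] := real_spectral S0sym.
have VtV : V^T *m V = 1%:M by exact: mulmx1C.
have d0 j : 0 < d 0 j.
  have : row j V != 0.
    apply/eqP => rj0; have := congr1 (row j) VV.
    rewrite row_mul rj0 mul0mx row1 => /rowP/(_ j).
    by rewrite !mxE !eqxx => /eqP; rewrite eq_sym oner_eq0.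
  move/S0pos; have -> : (row j V *m S0 *m (row j V)^T) 0 0 = (V *m S0 *m V^T) j j.
    by rewrite -row_mul !mxE; apply: eq_bigr => k _; rewrite !mxE.
  by rewrite VS !mxE eqxx.
pose r : 'rV[R]_n := \row_j (Num.sqrt (d 0 j))^-1.
have [B BE] : exists B, B = diag_mx r *m V by eexists.
have BS0 : B *m S0 *m B^T = 1%:M.
  rewrite BE trmx_mul tr_diag_mx !mulmxA -(mulmxA (diag_mx r)) -(mulmxA (diag_mx r)) VS.
  rewrite !mulmx_diag; apply/matrixP => i j; rewrite !mxE.
  case: eqVneq => [->|]//=; rewrite !mulr1n mulrAC -expr2 exprVn sqr_sqrtr ?ltW//.
  by rewrite mulVf// gt_eqF.
have [U [s [UU US]]] : exists (U : 'M[R]_n) (s : 'rV[R]_n),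
    U *m U^T = 1%:M /\ U *m (B *m S1 *m B^T) *m U^T = diag_mx s.
  by apply: real_spectral; rewrite !trmx_mul trmxK S1sym mulmxA.
have ES0 : (U *m B) *m S0 *m (U *m B)^T = 1%:M.
  by rewrite trmx_mul !mulmxA -(mulmxA U) -(mulmxA U) BS0 mulmx1.
exists (U *m B), s; split=> //.
  by move: ES0; rewrite -mulmxA => /mulmx1_unit[].
by rewrite trmx_mul !mulmxA -(mulmxA U) -(mulmxA U) US.
Qed.

Lemma cmodC (z : R[i]) : (cmod z)%:C = `|z|.
Proof. by rewrite /cmod normc_def. Qed.

Lemma cmodE (z : R[i]) : cmod z = Num.sqrt (complex.Re z ^+ 2 + complex.Im z ^+ 2).
Proof. by rewrite /cmod normc_def. Qed.

(** A [sup] bounds its elements only when the set is bounded. The squares of the singular values are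
    roots of one polynomial, and [s <= 1 + s ^+ 2]. *)
Lemma singular_values_has_ub p (N : 'M[R[i]]_p) : has_ubound (singular_values N).
Proof.
have [r rE] := closed_field_poly_normal (char_poly (N ^t* *m N)).
exists (1 + \sum_(z <- r) `|complex.Re z|) => s [s0].
rewrite eigenvalue_root_char rE rootZ ?root_prod_XsubC; last first.
  by rewrite lead_coef_eq0 monic_neq0// char_poly_monic.
move=> sr; have : s ^+ 2 <= \sum_(z <- r) `|complex.Re z|.
  rewrite (big_rem _ sr)/= (le_trans (ler_norm _))// lerDl sumr_ge0//.
have : 0 <= (s - 1) ^+ 2 by exact: sqr_ge0.
nra.
Qed.

Lemma unitary_entry_le1 p (P : 'M[R[i]]_p) i j : P \is unitarymx -> `|P i j| <= 1.
Proof.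
move/unitarymxP/matrixP/(_ i i); rewrite !mxE eqxx => PP.
rewrite -(@expr_le1 _ 2)// -[leRHS]PP (bigD1 j)//= !mxE -normCK lerDl.
by apply: sumr_ge0 => k _; rewrite !mxE -normCK exprn_ge0.
Qed.

(** In the unitary diagonalization each entry of [N] is a sum of [p] terms, each an eigenvalue times
    two numbers of modulus at most 1. The moduli of the eigenvalues are singular values because [N]
    equals its adjoint. *)
Lemma hermitian_entry_le_opnorm p (N : 'M[R[i]]_p) i j :
  N \is hermsymmx -> cmod (N i j) <= p%:R * opnorm N.
Proof.
move=> Nherm.
have Areal := hermitian_spectral_diag_real Nherm.
have /orthomx_spectralP NE := hermitian_normalmx Nherm.
have Pu := spectral_unitarymx N.
set P := spectralmx N in NE Pu; set sp := spectral_diag N in NE Areal.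
have Punit := unitarymx_unit Pu.
have NN : N ^t* = N.
  by have := is_hermitianmxP _ _ _ Nherm; rewrite expr0 scale1r.
have spr k : exists a : R, sp 0 k = a%:C.
  by apply/complex_realP; exact: (mxOverP Areal).
have sv k : cmod (sp 0 k) <= opnorm N.
  apply: ub_le_sup; first exact: singular_values_has_ub.
  have [a spa] := spr k.
  split; first by rewrite cmodE sqrtr_ge0.
  rewrite NN; apply/eigenvalueP; exists (row k P).
    have rP : row k P *m N = sp 0 k *: row k P.
      rewrite {1}NE -!row_mul !mulmxA mulmxV// mul1mx.
      by apply/rowP => l; rewrite mul_diag_mx !mxE.
    rewrite mulmxA rP -scalemxAl rP scalerA; congr (_ *: _).
    by rewrite rmorphXn/= cmodC spa -expr2 real_normK// complex_real.
  apply/eqP => P0; have : row k (P *m invmx P) = 0 by rewrite row_mul P0 mul0mx.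
  rewrite mulmxV// => /rowP/(_ k); rewrite !mxE eqxx => /eqP.
  by rewrite oner_eq0.
have -> : p%:R * opnorm N = \sum_(k < p) opnorm N.
  by rewrite sumr_const card_ord mulr_natl.
rewrite -lecR cmodC {1}NE invmx_unitary// -mulmxA mul_diag_mx mxE.
apply: le_trans (ler_norm_sum _ _ _) _.
rewrite rmorph_sum/=; apply: ler_sum => k _.
rewrite !mxE !normrM mulrCA -[leRHS]mulr1.
rewrite ler_pM ?mulr_ge0//; first by rewrite -cmodC lecR sv.
by rewrite norm_conjC mulr_ile1// unitary_entry_le1.
Qed.

Lemma opnormN p (N : 'M[R[i]]_p) : opnorm (- N) = opnorm N.
Proof.
have E : (- N) ^t* = - N ^t* by apply/matrixP => i j; rewrite !mxE rmorphN.
by rewrite /opnorm /singular_values E mulNmx mulmxN opprK.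
Qed.

End linear_algebra.

(** * Gaussian integrals on the line *)

Section real_integrals.
Context {R : realType} {d : measure_display} {T : measurableType d}
  (m : {measure set T -> \bar R}).
Implicit Types f g : T -> R.

Lemma integrableZ_EFin (k : R) f : m.-integrable setT (EFin \o f) ->
  m.-integrable setT (EFin \o (fun x => k * f x)).
Proof.
move=> fi; rewrite (_ : EFin \o _ = (fun x => k%:E * (EFin \o f) x)%E)//.
exact: integrableZl.
Qed.

Lemma integrableD_EFin f g :
  m.-integrable setT (EFin \o f) -> m.-integrable setT (EFin \o g) ->
  m.-integrable setT (EFin \o (fun x => f x + g x)).
Proof.
move=> fi gi; rewrite (_ : EFin \o _ = ((EFin \o f) \+ (EFin \o g))%E)//.
exact: integrableD.
Qed.

Lemma integrableB_EFin f g :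
  m.-integrable setT (EFin \o f) -> m.-integrable setT (EFin \o g) ->
  m.-integrable setT (EFin \o (fun x => f x - g x)).
Proof.
move=> fi gi; rewrite (_ : EFin \o _ = ((EFin \o f) \- (EFin \o g))%E)//.
exact: integrableB.
Qed.

Lemma integrable_sum_EFin (I : Type) (s : seq I) (F : I -> T -> R) :
  (forall i, m.-integrable setT (EFin \o F i)) ->
  m.-integrable setT (EFin \o (fun x => \sum_(i <- s) F i x)).
Proof.
move=> Fi; elim: s => [|i s IH].
  rewrite (_ : EFin \o _ = cst 0%E); first exact: integrable0.
  by apply/funext => x /=; rewrite big_nil.
rewrite (_ : EFin \o _ = EFin \o (fun x => F i x + \sum_(j <- s) F j x)).
  exact: integrableD_EFin.
by apply/funext => x /=; rewrite big_cons.
Qed.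

Lemma Rintegral_sum (I : Type) (s : seq I) (F : I -> T -> R) :
  (forall i, m.-integrable setT (EFin \o F i)) ->
  \int[m]_x (\sum_(i <- s) F i x) = \sum_(i <- s) \int[m]_x F i x.
Proof.
move=> Fi; elim: s => [|i s IH].
  rewrite big_nil -[RHS](mul0r (fine (m setT))) -Rintegral_cst//.
  by apply: eq_Rintegral => x _; rewrite big_nil.
rewrite big_cons -IH -RintegralD//; last exact: integrable_sum_EFin.
by apply: eq_Rintegral => x _; rewrite big_cons.
Qed.

Lemma le_integrable_EFin f g : measurable_fun setT f ->
  (forall x, `|f x| <= g x) -> m.-integrable setT (EFin \o g) ->
  m.-integrable setT (EFin \o f).
Proof.
move=> mf fg; apply: le_integrable => //; first exact/measurable_EFinP.
by move=> x _ /=; rewrite !lee_fin (le_trans (fg x))// ler_norm.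
Qed.

Lemma integrable_measurable f : m.-integrable setT (EFin \o f) -> measurable_fun setT f.
Proof. by case/integrableP => /measurable_EFinP. Qed.

End real_integrals.

Section gaussian.
Context {R : realType}.
Notation mu := (@lebesgue_measure R).

(** By the fundamental theorem of calculus on [[-(n + 1), n + 1]], the truncated integral is a
    boundary term of size at most [2 * K / (n + 1)]; dominated convergence gives the limit. *)
Lemma Rintegral_derivative_eq0 (g h : R -> R) (K : R) :
  (forall x : R, is_derive x (1 : R) g (h x)) -> continuous h ->
  mu.-integrable setT (EFin \o h) ->
  (forall x, `|g x| * (1 + `|x|) <= K) ->
  \int[mu]_x h x = 0.
Proof.
move=> dg ch ih gK.
have cg x : {for x, continuous g}.
  by apply/differentiable_continuous/derivable1_diffP; have [] := dg x.
pose I n : set R := `[- n.+1%:R, n.+1%:R]%classic.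
have FTC n : (\int[mu]_(x in I n) (h x)%:E = (g n.+1%:R - g (- n.+1%:R))%:E)%E.
  rewrite (@continuous_FTC2 _ h g) ?EFinB//.
  - by rewrite (@lt_le_trans _ _ 0)// oppr_lt0.
  - exact: continuous_subspaceT.
  - split; first by move=> x _; have [] := dg x.
    + exact/cvg_at_right_filter/cg.
    + exact/cvg_at_left_filter/cg.
  - by move=> x _; rewrite derive1E; have [_ ->] := dg x.
have cvgI : (\int[mu]_(x in I n) (h x)%:E @[n --> \oo] --> \int[mu]_x (h x)%:E)%E.
  rewrite (_ : (fun n => _) =
      (fun n => \int[mu]_x ((EFin \o h) \_ (I n)) x)%E); last first.
    by apply/funext => n; rewrite integral_mkcond.
  apply: (@dominated_cvg _ _ _ mu setT measurableT _ _ (fun x => `|h x|%:E)) => //.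
  - move=> n; have mI : measurable (I n) by exact: measurable_itv.
    apply/(measurable_restrictT _ _).1 => //.
    by apply: measurable_funTS; case/integrableP: ih.
  - move=> x _; apply: cvg_near_cst; near=> n.
    rewrite patchE mem_set// /I/= in_itv/= -ler_norml.
    near: n; exists (Num.truncn `|x|) => // n/= xn.
    apply/ltW/(lt_le_trans (truncnS_gt _)).
    by rewrite ler_nat.
  - exact: integrable_norm.
  - move=> n x _; rewrite patchE; case: ifPn => _ //.
    by rewrite abse0 lee_fin.
have cvg0 : (g n.+1%:R - g (- n.+1%:R))%:E @[n --> \oo] --> (0%:E : \bar R).
  apply: cvg_EFin; first exact: nearW.
  rewrite /comp/=; apply: norm_cvg0.
  have K0 : 0 <= K by rewrite (le_trans _ (gK 0))// mulr_ge0.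
  apply: (@squeeze_cvgr _ _ _ _ (cst 0) (fun n => (2 * K) * harmonic n)).
  - near=> n => /=; rewrite normr_ge0/=.
    rewrite (le_trans (ler_normB _ _))// -mulrA mulr_natl mulr2n.
    have bnd (y : R) : `|y| = n.+1%:R -> `|g y| <= K * n.+1%:R^-1.
      move=> yn; rewrite ler_pdivlMr// (le_trans _ (gK y))// ler_wpM2l//.
      by rewrite yn lerDr.
    by rewrite lerD// bnd ?normrN ?normr_nat.
  - exact: cvg_cst.
  - by rewrite -[X in _ --> X](mulr0 (2 * K)); apply: cvgMr; exact: cvg_harmonic.
have : (\int[mu]_x (h x)%:E = 0%:E)%E.
  by move: cvgI; rewrite (funext FTC) => /cvg_unique; exact.
by rewrite /Rintegral => ->.
Unshelve. all: end_near. Qed.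

Lemma is_derive_normal_pdf (m s x : R) : s != 0 ->
  is_derive x (1 : R) (normal_pdf m s) (- ((x - m) / s ^+ 2) * normal_pdf m s x).
Proof.
move=> s0; rewrite normal_pdfE//.
pose u (y : R) := - (y - m) ^+ 2 / (s ^+ 2 *+ 2).
have du : is_derive x (1 : R) u (- ((x - m) / s ^+ 2)).
  rewrite /u; apply: is_derive_eq.
  by rewrite /GRing.scale/= ; field.
have -> : (fun y => normal_peak s * normal_fun m s y) =
    (fun y => normal_peak s * (expR \o u) y) by [].
apply: is_derive_eq.
by rewrite /GRing.scale/= /normal_fun /u; ring.
Qed.

(** Doubling the standard deviation absorbs quadratic growth, so integrability against one Gaussian
    density reduces to that of another density. *)
Lemma normal_pdf_poly_bound (m s : R) : s != 0 ->
  exists K, 0 <= K /\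
    forall x, (1 + `|x|) ^+ 2 * normal_pdf m s x <= K * normal_pdf m (2 * s) x.
Proof.
move=> s0; have s20 : 2 * s != 0 by rewrite mulf_neq0.
have ss : 0 < s ^+ 2 by rewrite exprn_even_gt0.
(* From [(1 + |x|)^2 <= 2 + 2 x^2 <= 2 + 4 m^2 + 4 (x - m)^2]. The last term is [32 s^2 / 3] times
   the gain [v] in the exponent, and [1 + v <= expR v]. *)
pose C := 2 + 4 * m ^+ 2 + 32 * s ^+ 2 / 3.
have C0 : 0 <= C by rewrite /C !addr_ge0// ?divr_ge0// mulr_ge0// ?sqr_ge0.
exists (C * (normal_peak s / normal_peak (2 * s))).
split; first by rewrite mulr_ge0// divr_ge0// normal_peak_ge0.
move=> x; rewrite !normal_pdfE//.
have p0 : normal_peak (2 * s) != 0 by rewrite gt_eqF// normal_peak_gt0.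
rewrite mulrCA (_ : C * _ * _ = normal_peak s * (C * normal_fun m (2 * s) x)).
  rewrite ler_wpM2l ?normal_peak_ge0//.
  pose v := 3 * (x - m) ^+ 2 / (8 * s ^+ 2).
  have nE : normal_fun m (2 * s) x = expR v * normal_fun m s x.
    by rewrite /normal_fun -expRD; congr expR; rewrite /v; field.
  rewrite nE mulrA ler_wpM2r ?normal_fun_ge0//.
  apply: (@le_trans _ _ (C * (1 + v))); last by rewrite ler_wpM2l// expR_ge1Dx.
  have x2 : x ^+ 2 <= 2 * (x - m) ^+ 2 + 2 * m ^+ 2.
    by rewrite -subr_ge0 (_ : _ - _ = (x - 2 * m) ^+ 2) ?sqr_ge0//; ring.
  have vE : 32 * s ^+ 2 / 3 * v = 4 * (x - m) ^+ 2 by rewrite /v; field.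
  have v0 : 0 <= v by apply: divr_ge0; apply: mulr_ge0 => //; exact: sqr_ge0.
  apply: (@le_trans _ _ (2 + 2 * x ^+ 2)).
    rewrite -subr_ge0 -(real_normK (num_real x)).
    by rewrite (_ : _ - _ = (`|x| - 1) ^+ 2) ?sqr_ge0//; ring.
  have -> : C * (1 + v) = C + (2 + 4 * m ^+ 2) * v + 4 * (x - m) ^+ 2.
    by rewrite -vE /C; ring.
  have : 0 <= 4 * m ^+ 2 * v.
    by apply: mulr_ge0 => //; apply: mulr_ge0 => //; exact: sqr_ge0.
  have : 0 <= 32 * s ^+ 2 / 3.
    by apply: divr_ge0 => //; apply: mulr_ge0 => //; exact: sqr_ge0.
  rewrite /C; lra.
by field.
Qed.

Lemma integrable_normal_poly (m s C : R) (f : R -> R) : s != 0 ->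
  measurable_fun setT f -> (forall x, `|f x| <= C * (1 + `|x|) ^+ 2) ->
  mu.-integrable setT (EFin \o (fun x => f x * normal_pdf m s x)).
Proof.
move=> s0 mf fC; have [K [K0 KP]] := normal_pdf_poly_bound m s0.
have C0 : 0 <= C by have := le_trans (normr_ge0 _) (fC 0); rewrite normr0 addr0 expr1n mulr1.
apply: (@le_integrable _ _ _ mu _ measurableT _
    (fun x => (C * K)%:E * (normal_pdf m (2 * s) x)%:E)%E) => //.
- apply/measurable_EFinP/measurable_funM => //; exact: measurable_normal_pdf.
- move=> x _; rewrite -EFinM !abse_EFin lee_fin !normrM !(ger0_norm (normal_pdf_ge0 _ _ _)).
  rewrite (ger0_norm C0) (ger0_norm K0) -mulrA.
  apply: (@le_trans _ _ (C * ((1 + `|x|) ^+ 2 * normal_pdf m s x))).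
    by rewrite mulrA ler_wpM2r// normal_pdf_ge0.
  by rewrite ler_wpM2l.
- by apply: integrableZl => //; exact: integrable_normal_pdf.
Qed.

(** The integrand is the derivative of [s ^+ 2 * F x * normal_pdf m s x]. This Gaussian integration
    by parts yields the mean ([F = 1]), the second moment ([F = id]) and the characteristic function
    ([F] a sine). *)
Lemma normal_stein (m s C : R) (F f : R -> R) : s != 0 ->
  (forall x : R, is_derive x (1 : R) F (f x)) -> continuous f ->
  (forall x, `|F x| <= C * (1 + `|x|)) -> (forall x, `|f x| <= C * (1 + `|x|)) ->
  \int[mu]_x ((s ^+ 2 * f x - (x - m) * F x) * normal_pdf m s x) = 0.
Proof.
move=> s0 dF cf FC fC.
have C0 : 0 <= C by have := le_trans (normr_ge0 _) (fC 0); rewrite normr0 addr0 mulr1.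
have cF : continuous F.
  by move=> x; apply/differentiable_continuous/derivable1_diffP; have [] := dF x.
have [K [K0 KP]] := normal_pdf_poly_bound m s0.
have ch : continuous (fun x => s ^+ 2 * f x - (x - m) * F x).
  move=> x; apply: cvgB; first by apply: cvgMr; exact: cf.
  by apply: cvgM; [apply: cvgB; [exact: cvg_id|exact: cvg_cst]|exact: cF].
apply: (@Rintegral_derivative_eq0 (fun x => s ^+ 2 * F x * normal_pdf m s x) _
  (s ^+ 2 * C * (K * normal_peak (2 * s)))).
- move=> x; have dn := is_derive_normal_pdf m x s0.
  apply: is_derive_eq.
  by rewrite /GRing.scale/=; field.
- move=> x; apply: cvgM; [exact: ch|exact: continuous_normal_pdf].
- apply: (@integrable_normal_poly _ _ (s ^+ 2 * C + (1 + `|m|) * C)) => //.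
    exact: continuous_measurable_fun.
  move=> x; apply: (le_trans (ler_normB _ _)).
  rewrite [leRHS]mulrDl lerD// normrM.
    rewrite ger0_norm ?sqr_ge0// -mulrA ler_wpM2l ?sqr_ge0// (le_trans (fC x))//.
    by rewrite ler_wpM2l// ler_eXnr// lerDl.
  apply: (@le_trans _ _ (((1 + `|m|) * (1 + `|x|)) * (C * (1 + `|x|)))); last first.
    by rewrite le_eqVlt; apply/orP; left; apply/eqP; ring.
  rewrite ler_pM// (le_trans (ler_normB _ _))//.
  by have := normr_ge0 x; have := normr_ge0 m; nra.
- move=> x; rewrite 2!normrM (ger0_norm (sqr_ge0 _)) (ger0_norm (normal_pdf_ge0 _ _ _)).
  rewrite [leLHS](_ : _ = s ^+ 2 * (`|F x| * (normal_pdf m s x * (1 + `|x|)))).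
    rewrite -(mulrA (s ^+ 2) C) ler_wpM2l ?sqr_ge0//.
    apply: (@le_trans _ _ (C * ((1 + `|x|) ^+ 2 * normal_pdf m s x))).
      rewrite [leRHS](_ : _ = (C * (1 + `|x|)) * (normal_pdf m s x * (1 + `|x|))).
        by rewrite ler_wpM2r// mulr_ge0// normal_pdf_ge0.
      by ring.
    rewrite ler_wpM2l// (le_trans (KP x))// ler_wpM2l// normal_pdf_ub//.
    by rewrite mulf_neq0.
  by ring.
Qed.

Lemma measurable_cos : measurable_fun [set: R] (@cos R).
Proof. exact: continuous_measurable_fun (@continuous_cos R). Qed.

Lemma measurable_sin : measurable_fun [set: R] (@sin R).
Proof. exact: continuous_measurable_fun (@continuous_sin R). Qed.

Lemma continuous_sin_affine (t phi : R) : continuous (fun x => sin (t * x + phi)).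
Proof.
move=> x; apply: (@continuous_comp _ _ _ (fun x => t * x + phi) sin); last exact: continuous_sin.
by apply: cvgD; [apply: cvgMr; exact: cvg_id|exact: cvg_cst].
Qed.

Lemma continuous_cos_affine (t phi : R) : continuous (fun x => cos (t * x + phi)).
Proof.
move=> x; apply: (@continuous_comp _ _ _ (fun x => t * x + phi) cos); last exact: continuous_cos.
by apply: cvgD; [apply: cvgMr; exact: cvg_id|exact: cvg_cst].
Qed.

Lemma Rintegral_normal_pdf (m s : R) : \int[mu]_x normal_pdf m s x = 1.
Proof. by rewrite /Rintegral integral_normal_pdf. Qed.

Lemma Rintegral_normal_mean (m s : R) : s != 0 ->
  \int[mu]_x (x * normal_pdf m s x) = m.
Proof.
move=> s0; have := @normal_stein m s 1 (cst 1) (cst 0) s0.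
have ix : mu.-integrable setT (EFin \o (fun x => x * normal_pdf m s x)).
  apply: (@integrable_normal_poly _ _ 1) => // x; rewrite mul1r.
  by have := normr_ge0 x; nra.
have ip : mu.-integrable setT (EFin \o (fun x => m * normal_pdf m s x)).
  apply: (@integrable_normal_poly _ _ `|m|) => // x; rewrite ler_peMr//.
  by have := normr_ge0 x; nra.
under eq_Rintegral do rewrite mulr0 mulr1 sub0r opprB mulrBl.
rewrite RintegralB// RintegralZl//; last exact: integrable_normal_pdf.
rewrite Rintegral_normal_pdf mulr1 => E; apply/esym/eqP; rewrite -subr_eq0; apply/eqP; apply: E.
- by move=> x; exact: cvg_cst.
- by move=> x; rewrite normr1 mul1r lerDl.
- by move=> x; rewrite normr0 mul1r addr_ge0.
Qed.

Lemma Rintegral_normal_second_moment (s : R) : s != 0 ->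
  \int[mu]_x (x ^+ 2 * normal_pdf 0 s x) = s ^+ 2.
Proof.
move=> s0; have := @normal_stein 0 s 1 id (cst 1) s0.
have ix : mu.-integrable setT (EFin \o (fun x => x ^+ 2 * normal_pdf 0 s x)).
  apply: (@integrable_normal_poly _ _ 1) => // x.
  rewrite mul1r normrX lerXn2r// ?nnegrE ?addr_ge0//.
  by rewrite lerDr.
have ip : mu.-integrable setT (EFin \o (fun x => s ^+ 2 * normal_pdf 0 s x)).
  apply: (@integrable_normal_poly _ _ `|s ^+ 2|) => // x; rewrite ler_peMr//.
  by have := normr_ge0 x; nra.
under eq_Rintegral do rewrite subr0 mulr1 mulrBl -expr2.
rewrite RintegralB// RintegralZl//; last exact: integrable_normal_pdf.
rewrite Rintegral_normal_pdf mulr1 => E; apply/esym/eqP; rewrite -subr_eq0; apply/eqP; apply: E.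
- by move=> x; exact: cvg_cst.
- by move=> x; rewrite mul1r lerDr.
- by move=> x; rewrite normr1 mul1r lerDl.
Qed.

(** Differentiation under the integral sign and [normal_stein] give the equation [H' = - s^2 t H] in
    the variable [t], so [H t * expR (s^2 t^2 / 2)] is constant. The phase [phi] replaces the
    imaginary part of the usual complex formula. *)
Lemma normal_characteristic (s t phi : R) : s != 0 ->
  \int[mu]_x (cos (t * x + phi) * normal_pdf 0 s x) =
  cos phi * expR (- ((t * s) ^+ 2 / 2)).
Proof.
move=> s0; pose H t := \int[mu]_x (cos (t * x + phi) * normal_pdf 0 s x).
have icos u : mu.-integrable setT (EFin \o (fun x => cos (u * x + phi) * normal_pdf 0 s x)).
  apply: (@integrable_normal_poly _ _ 1) => //.
    by apply: continuous_measurable_fun; exact: continuous_cos_affine.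
  move=> x; rewrite mul1r (le_trans (cos_max _))//.
  by have := normr_ge0 x; nra.
have dcos (u x : R) : is_derive u (1 : R) (fun u : R => cos (u * x + phi) * normal_pdf 0 s x)
    (- (x * sin (u * x + phi)) * normal_pdf 0 s x).
  by apply: is_derive_eq; rewrite /GRing.scale/=; ring.
have dH (u : R) : is_derive u (1 : R) H (- (s ^+ 2 * u * H u)).
  pose G x := `|x| * normal_pdf 0 s x.
  have G0 x : 0 <= G x by rewrite mulr_ge0// normal_pdf_ge0.
  have iG : mu.-integrable setT (EFin \o G).
    apply: (@integrable_normal_poly _ _ 1) => // x.
    by rewrite mul1r normr_id; have := normr_ge0 x; nra.
  have Iu : (`]u - 1, u + 1[%classic : set R) u by rewrite /= in_itv/=; lra.
  have dE x y : partial1of2 (fun u x => cos (u * x + phi) * normal_pdf 0 s x) x y =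
      - (y * sin (x * y + phi)) * normal_pdf 0 s y.
    by rewrite /partial1of2 derive1E; have [_ ->] := dcos x y.
  have GB x y : (`]u - 1, u + 1[%classic : set R) x -> [set: R] y ->
      `|partial1of2 (fun u x => cos (u * x + phi) * normal_pdf 0 s x) x y| <= G y.
    move=> _ _; rewrite dE normrM normrN normrM (ger0_norm (normal_pdf_ge0 _ _ _)).
    by rewrite ler_wpM2r ?normal_pdf_ge0// ler_piMr// sin_max.
  have der x y : (`]u - 1, u + 1[%classic : set R) x -> [set: R] y ->
      derivable (fun u : R => cos (u * y + phi) * normal_pdf 0 s y) x (1 : R).
    by move=> _ _; have [] := dcos x y.
  apply: DeriveDef.
    exact: (derivable_under_integral measurableT Iu (fun x _ => icos x) der G0 iG GB).
  rewrite -derive1E.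
  rewrite (differentiation_under_integral measurableT Iu (fun x _ => icos x) der G0 iG GB).
  under eq_Rintegral do rewrite dE.
  have := @normal_stein 0 s (1 + `|u|) (fun x => sin (u * x + phi))
    (fun x => u * cos (u * x + phi)) s0.
  have isin : mu.-integrable setT
      (EFin \o (fun x => - (x * sin (u * x + phi)) * normal_pdf 0 s x)).
    apply: (@integrable_normal_poly _ _ 1) => //.
      apply: measurableT_comp => //; apply: measurable_funM => //.
      by apply: continuous_measurable_fun; exact: continuous_sin_affine.
    move=> x; rewrite mul1r normrN normrM.
    apply: (@le_trans _ _ `|x|); first by rewrite ler_piMr// sin_max.
    by have := normr_ge0 x; nra.
  under eq_Rintegral do rewrite subr0 mulrDl !mulrA -mulrA.
  rewrite RintegralD//; last first.
    by apply: integrableZ_EFin; exact: icos.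
  rewrite RintegralZl// -/(H u) => E; apply/eqP; rewrite eq_sym -subr_eq0 -opprD oppr_eq0.
  apply/eqP/E.
  - by move=> x; apply: is_derive_eq; rewrite /GRing.scale/=; ring.
  - by move=> x; apply: cvgMr; exact: continuous_cos_affine.
  - move=> x; rewrite (le_trans (sin_max _))//.
    by have := normr_ge0 x; have := normr_ge0 u; nra.
  - move=> x; rewrite normrM; apply: (@le_trans _ _ `|u|).
      by rewrite ler_piMr// cos_max.
    by have := normr_ge0 x; have := normr_ge0 u; nra.
pose K u := H u * expR (s ^+ 2 * u ^+ 2 / 2).
have K0 : K t = K 0.
  apply: is_derive_0_is_cst => u; have := dH u => dHu.
  have de : is_derive u (1 : R) (fun u : R => expR (s ^+ 2 * u ^+ 2 / 2))
      (s ^+ 2 * u * expR (s ^+ 2 * u ^+ 2 / 2)).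
    rewrite (_ : (fun u => _) = expR \o (fun u => s ^+ 2 * u ^+ 2 / 2))//.
    by apply: is_derive_eq; rewrite /GRing.scale/=; field.
  by apply: is_derive_eq; rewrite /GRing.scale/=; ring.
have : K 0 = cos phi.
  rewrite /K expr0n/= mulr0 mul0r expR0 mulr1 /H.
  under eq_Rintegral do rewrite mul0r add0r.
  rewrite RintegralZl ?Rintegral_normal_pdf ?mulr1//.
  exact: integrable_normal_pdf.
rewrite -K0 /K -/(H t) => <-; rewrite -[RHS]mulrA -expRD (_ : _ + _ = 0) ?expR0 ?mulr1//.
by field.
Qed.

(** The convex function [u ^+ n.+1] lies above its tangent at [v]; the induction step adds a
    multiple of [(u - v) ^+ 2]. *)
Lemma tangent_line_power (n : nat) (u v : R) : 0 <= u -> 0 <= v ->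
  n.+1%:R * v ^+ n * u - n%:R * v ^+ n.+1 <= u ^+ n.+1.
Proof.
move=> u0 v0; elim: n => [|n IH]; first by rewrite expr0 expr1 mulr1 mul1r mul0r subr0.
rewrite -subr_ge0 (_ : _ - _ = u * (u ^+ n.+1 - (n.+1%:R * v ^+ n * u - n%:R * v ^+ n.+1))
  + n.+1%:R * v ^+ n * (u - v) ^+ 2).
  by rewrite addr_ge0// mulr_ge0 ?subr_ge0 ?sqr_ge0// mulr_ge0// exprn_ge0.
by rewrite !exprS -!natr1; ring.
Qed.

Lemma integrable_normal_bounded (m s B : R) (f : R -> R) : s != 0 ->
  measurable_fun setT f -> (forall x, `|f x| <= B) ->
  mu.-integrable setT (EFin \o (fun x => f x * normal_pdf m s x)).
Proof.
move=> s0 mf fB; apply: (@integrable_normal_poly _ _ B) => // x.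
rewrite (le_trans (fB x))// ler_peMr ?(le_trans (normr_ge0 _) (fB x))//.
by have := normr_ge0 x; nra.
Qed.

Lemma normal_peakE (s : R) : 0 < s -> normal_peak s = normal_peak 1 / s.
Proof.
move=> s0; rewrite /normal_peak expr1n mul1r -mulrnAr.
by rewrite sqrtrM ?sqr_ge0// sqrtr_sqr gtr0_norm// invfM mulrC.
Qed.

(* Hoelder's inequality for the density of N(0, s^2) with respect to N(0, 1), with
   the exponents n + 1 and (n + 1) / n; it is obtained by integrating the tangent
   line inequality at v = t h, where h^n is proportional to that density. *)
Lemma normal_hoelder (n : nat) (s B : R) (f : R -> R) : (0 < n)%N -> 0 < s ->
  s ^+ 2 <= n.+1%:R / 2 ->
  measurable_fun setT f -> (forall x, 0 <= f x <= B) ->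
  (\int[mu]_x (f x * normal_pdf 0 s x)) ^+ n.+1 <=
  expR (n.+1%:R ^+ 2 * ((s ^+ 2)^-1 - 1) ^+ 2 / 2) *
  \int[mu]_x (f x ^+ n.+1 * normal_pdf 0 1 x).
Proof.
move=> n0 s0 sn mf fB.
have n0' : 0 < n%:R :> R by rewrite ltr0n.
have f0 x : 0 <= f x by have /andP[] := fB x.
have fBn x : `|f x| <= B by rewrite ger0_norm//; have /andP[] := fB x.
have B0 : 0 <= B by rewrite (le_trans (normr_ge0 _) (fBn 0)).
(* Up to a constant the density ratio is [exp (- w x^2 / 2)], which is [h ^+ n] below. Its power
   [(n + 1) / n] times the standard density is Gaussian with inverse variance [1 + y]; the
   hypothesis on [s] ensures [1 + y >= 1 / n], and [tau] is the resulting standard deviation. *)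
pose w := (s ^+ 2)^-1 - 1.
pose y := w * (n.+1%:R / n%:R).
have s20 : 0 < s ^+ 2 by rewrite exprn_gt0.
have y1 : n%:R^-1 <= 1 + y.
  have n1 : 2 <= n.+1%:R / s ^+ 2 by rewrite ler_pdivlMr// mulrC -ler_pdivlMr.
  rewrite -[leLHS]mul1r ler_pdivrMr// mulrDl mul1r /y -mulrA divfK ?gt_eqF// /w mulrBl mul1r.
  by rewrite [_^-1 * _]mulrC; move: n1; rewrite -natr1; lra.
have y10 : 0 < 1 + y by rewrite (lt_le_trans _ y1)// invr_gt0.
have nw : n%:R + w * (1 + n%:R) != 0.
  have -> : n%:R + w * (1 + n%:R) = n%:R * (1 + y).
    by rewrite /y -natr1; field; rewrite gt_eqF.
  by rewrite mulf_neq0 ?gt_eqF.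
pose tau := (Num.sqrt (1 + y))^-1.
have tau0 : 0 < tau by rewrite invr_gt0 sqrtr_gt0.
have tau2 : tau ^+ 2 = (1 + y)^-1 by rewrite exprVn sqr_sqrtr// ltW.
pose h x := expR (- (x ^+ 2 * w / (2 * n%:R))).
have h0 x : 0 <= h x by exact: expR_ge0.
have hn x : h x ^+ n * normal_pdf 0 1 x = s * normal_pdf 0 s x.
  have hE : h x ^+ n * normal_fun 0 1 x = normal_fun 0 s x.
    rewrite /h -expRM_natl /normal_fun -expRD; congr expR.
    by rewrite /w; field; rewrite !gt_eqF.
  rewrite !normal_pdfE ?oner_neq0 ?gt_eqF// (normal_peakE s0) -hE.
  by field; rewrite gt_eqF.
have hn1 x : h x ^+ n.+1 * normal_pdf 0 1 x = tau * normal_pdf 0 tau x.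
  have hE : h x ^+ n.+1 * normal_fun 0 1 x = normal_fun 0 tau x.
    rewrite /h -expRM_natl /normal_fun -expRD; congr expR.
    rewrite (_ : tau ^+ 2 *+ 2 = 2 / (1 + y)); last by rewrite tau2 -mulr_natl.
    by rewrite /y; field; rewrite nw gt_eqF.
  rewrite !normal_pdfE ?oner_neq0 ?gt_eqF// (normal_peakE tau0) -hE.
  by field; rewrite gt_eqF.
pose I := \int[mu]_x (f x * normal_pdf 0 s x).
pose Q := \int[mu]_x (f x ^+ n.+1 * normal_pdf 0 1 x).
have I0 : 0 <= I by apply: Rintegral_ge0 => x _; rewrite mulr_ge0// normal_pdf_ge0.
have key t : 0 <= t -> n.+1%:R * t ^+ n * (s * I) - n%:R * t ^+ n.+1 * tau <= Q.
  move=> t0.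
  have i1 : mu.-integrable setT (EFin \o (fun x => n.+1%:R * t ^+ n * s *
      (f x * normal_pdf 0 s x))).
    apply: integrableZ_EFin.
    by apply: (@integrable_normal_bounded _ _ B) => //; rewrite gt_eqF.
  have i2 : mu.-integrable setT (EFin \o (fun x => n%:R * t ^+ n.+1 * tau *
      normal_pdf 0 tau x)).
    by apply: integrableZ_EFin; exact: integrable_normal_pdf.
  have i3 : mu.-integrable setT (EFin \o (fun x => f x ^+ n.+1 * normal_pdf 0 1 x)).
    apply: (@integrable_normal_bounded _ _ (B ^+ n.+1)).
    - exact: oner_neq0.
    - exact: measurable_funX.
    - by move=> x; rewrite normrX lerXn2r// nnegrE.
  have -> : n.+1%:R * t ^+ n * (s * I) - n%:R * t ^+ n.+1 * tau =
      \int[mu]_x (n.+1%:R * t ^+ n * s * (f x * normal_pdf 0 s x) -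
                  n%:R * t ^+ n.+1 * tau * normal_pdf 0 tau x).
    rewrite RintegralB// !RintegralZl//.
    - by rewrite Rintegral_normal_pdf mulr1 !mulrA.
    - exact: integrable_normal_pdf.
    - by apply: (@integrable_normal_bounded _ _ B) => //; rewrite gt_eqF.
  apply: le_Rintegral => //; first exact: integrableB_EFin.
  move=> x _; have th0 : 0 <= t * h x by rewrite mulr_ge0.
  have := tangent_line_power n (f0 x) th0.
  move/(ler_wpM2r (normal_pdf_ge0 0 1 x)); apply: le_trans.
  rewrite le_eqVlt; apply/orP; left; apply/eqP.
  rewrite mulrBl !exprMn -[in LHS](mulrA _ s) (mulrCA s) -hn.
  rewrite -[in LHS](mulrA _ tau) -hn1; ring.
(* This value of [t] maximizes the left-hand side of [key]. *)
have /key {key} : 0 <= s * I / tau.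
  by apply: divr_ge0; [apply: mulr_ge0 => //|]; exact: ltW.
have -> : n.+1%:R * (s * I / tau) ^+ n * (s * I) - n%:R * (s * I / tau) ^+ n.+1 * tau =
    (s * I) ^+ n.+1 / tau ^+ n.
  have Xt : s * I = s * I / tau * tau by rewrite divfK// gt_eqF.
  transitivity ((s * I / tau) ^+ n * (s * I)).
    by rewrite {2 5}Xt exprSr -natr1; ring.
  by rewrite expr_div_n exprSr mulrAC.
rewrite ler_pdivrMr ?exprn_gt0// exprMn => IQ.
have Q0 : 0 <= Q.
  by apply: Rintegral_ge0 => x _; rewrite mulr_ge0 ?exprn_ge0// normal_pdf_ge0.
rewrite -/I -/Q.
apply: (@le_trans _ _ ((tau ^+ n / s ^+ n.+1) * Q)).
  by rewrite mulrAC ler_pdivlMr ?exprn_gt0// mulrC [tau ^+ n * _]mulrC.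
rewrite ler_wpM2r//.
have M0 : 0 <= tau ^+ n / s ^+ n.+1 by rewrite divr_ge0// exprn_ge0// ltW.
(* Squaring removes the square root in [tau]. Then [1 + w <= exp w] and
   [1 / (1 + y) <= exp (- y + y^2 / (1 + y))] are used. The linear terms cancel since
   [(n + 1) w = n y], and what is left is at most [n^2 y^2] because [1 + y >= 1 / n]. *)
rewrite -(@ler_pXn2r _ 2)// ?nnegrE ?expR_ge0//.
rewrite -expRM_natl expr_div_n -!exprM !(mulnC _ 2) !exprM tau2.
have -> : 2%:R * (n.+1%:R ^+ 2 * ((s ^+ 2)^-1 - 1) ^+ 2 / 2) = n%:R ^+ 2 * y ^+ 2.
  by rewrite /y -/w; field; rewrite gt_eqF.
have s2w : (s ^+ 2)^-1 ^+ n.+1 <= expR (n%:R * y).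
  have -> : n%:R * y = n.+1%:R * w by rewrite /y; field; rewrite gt_eqF.
  rewrite expRM_natl lerXn2r ?nnegrE ?expR_ge0 ?invr_ge0 ?(ltW s20)//.
  by rewrite (le_trans _ (expR_ge1Dx _))// /w addrC subrK.
have y2 : (1 + y)^-1 ^+ n <= expR (n%:R * (- y + y ^+ 2 / (1 + y))).
  rewrite expRM_natl lerXn2r ?nnegrE ?expR_ge0 ?invr_ge0 ?(ltW y10)//.
  rewrite (le_trans _ (expR_ge1Dx _))// le_eqVlt; apply/orP; left; apply/eqP.
  by field; rewrite gt_eqF.
rewrite -[X in _ * X]exprVn.
apply: (le_trans (ler_pM _ _ y2 s2w)); rewrite ?exprn_ge0 ?invr_ge0 ?(ltW y10) ?(ltW s20)//.
rewrite -expRD ler_expR -mulrDr.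
have -> : - y + y ^+ 2 / (1 + y) + y = y ^+ 2 / (1 + y) by ring.
rewrite [leRHS](_ : _ = n%:R * (n%:R * y ^+ 2)); last by ring.
rewrite ler_pM2l// mulrC ler_wpM2r ?sqr_ge0//.
by rewrite -[leRHS]invrK lef_pV2// posrE invr_gt0.
Qed.

Lemma integral_normal_prob (m s : R) (f : R -> \bar R) :
  (normal_prob m s).-integrable setT f ->
  (\int[normal_prob m s]_x f x = \int[mu]_x (f x * (normal_pdf m s x)%:E))%E.
Proof.
move=> fi; have mf := measurable_int _ fi.
rewrite -(Radon_Nikodym_change_of_variables (normal_prob_dominates m s))//=.
apply: ae_eq_integral => //.
- apply: emeasurable_funM => //; apply: (measurable_int mu).
  by apply: Radon_Nikodym_integrable; exact: normal_prob_dominates.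
- by apply: emeasurable_funM => //; apply/measurable_EFinP; exact: measurable_normal_pdf.
- apply: ae_eqe_mul2l => /=.
  rewrite Radon_NikodymE//=; first exact: normal_prob_dominates.
  move=> dom; case: cid => /= h [h1 h2 h3].
  apply: integral_ae_eq => //=.
  + by apply/measurable_EFinP; exact: measurable_normal_pdf.
  + by move=> E _ mE; rewrite -h3.
Qed.

Section gaussian_variable.
Context {dO : measure_display} {Omega : measurableType dO} (P : probability Omega R).
Variables (Y : {mfun Omega >-> measurableTypeR R}) (m s : R).
Hypothesis Ylaw : forall A : set R, measurable A -> P (Y @^-1` A) = gaussian_law m s A.
Hypothesis Y2 : P.-integrable setT (EFin \o (fun w => Y w ^+ 2)).

Lemma integrable_poly_comp (f : R -> R) (C : R) : measurable_fun setT f ->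
  (forall x, `|f x| <= C * (1 + `|x|) ^+ 2) ->
  P.-integrable setT (EFin \o (fun w => f (Y w))).
Proof.
move=> mf fC; apply: (@le_integrable_EFin _ _ _ P _ (fun w => (2 * C) * (1 + Y w ^+ 2))).
- exact: measurableT_comp.
- move=> w; rewrite (le_trans (fC _))// [leRHS]mulrAC mulrC.
  rewrite ler_wpM2r//.
    by have := le_trans (normr_ge0 _) (fC 0); rewrite normr0 addr0 expr1n mulr1.
  rewrite -(real_normK (num_real (Y w))) -subr_ge0.
  by rewrite (_ : _ - _ = (`|Y w| - 1) ^+ 2) ?sqr_ge0//; ring.
- apply: integrableZ_EFin; apply: integrableD_EFin => //.
  exact: finite_measure_integrable_cst.
Qed.

(** Quadratic growth covers the three functions to be integrated: the identity, the square and the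
    cosine. *)
Lemma gaussian_law_transfer (f : R -> R) (C : R) : measurable_fun setT f ->
  (forall x, `|f x| <= C * (1 + `|x|) ^+ 2) ->
  \int[P]_w f (Y w) = if s == 0 then f m else \int[mu]_x (f x * normal_pdf m s x).
Proof.
move=> mf fC; have fi := integrable_poly_comp mf fC.
have mEf : measurable_fun setT (EFin \o f) by exact/measurable_EFinP.
have LE : (\int[P]_w (f (Y w))%:E = \int[distribution P Y]_x (f x)%:E)%E.
  by rewrite integral_distribution.
rewrite /Rintegral LE; move: Ylaw; rewrite /gaussian_law.
case: eqVneq => [s0|s0] Ylaw'.
  rewrite (@eq_measure_integral _ (measurableTypeR R) _ _ (\d_ (m : measurableTypeR R))).
    by rewrite integral_dirac// diracT mul1e.
  by move=> A mA _; exact: Ylaw'.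
have lawE (g : R -> \bar R) :
    (\int[distribution P Y]_x g x = \int[normal_prob m s]_x g x)%E.
  apply: eq_measure_integral.
  by move=> A mA _; exact: Ylaw'.
rewrite lawE integral_normal_prob//.
have : (distribution P Y).-integrable setT (EFin \o f) by exact: integrable_pushforward.
by case/integrableP => _ foo; apply/integrableP; split => //; rewrite -lawE.
Qed.

(** Being Gaussian only provides some parameters [m] and [s]; the two moments identify them as
    [m = 0] and [s ^+ 2 = v], the degenerate case included. *)
Lemma gaussian_centered_characteristic (v phi : R) :
  \int[P]_w Y w = 0 -> \int[P]_w (Y w ^+ 2) = v ->
  \int[P]_w cos (Y w + phi) = cos phi * expR (- (v / 2)).
Proof.
rewrite (@gaussian_law_transfer id 1)//; last first.
  by move=> x; rewrite mul1r; have := normr_ge0 x; nra.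
rewrite (@gaussian_law_transfer (fun x => x ^+ 2) 1)//; last first.
  by move=> x; rewrite mul1r normrX; have := normr_ge0 x; nra.
rewrite (@gaussian_law_transfer (fun x => cos (x + phi)) 1); last 2 first.
- apply: continuous_measurable_fun => x.
  by have := @continuous_cos_affine 1 phi x; under eq_fun do rewrite mul1r.
- move=> x; rewrite mul1r (le_trans (cos_max _))//.
  by have := normr_ge0 x; nra.
case: eqVneq => [_ ->|s0]; first by rewrite expr0n/= add0r => <-; rewrite mul0r oppr0 expR0 mulr1.
rewrite Rintegral_normal_mean// => ->; rewrite Rintegral_normal_second_moment// => <-.
by have := normal_characteristic 1 phi s0; under eq_Rintegral do rewrite mul1r; rewrite mul1r.
Qed.

End gaussian_variable.

End gaussian.

(** * A Fourier kernel *)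

Section sinc_kernel.
Context {R : realType}.
Notation mu := (@lebesgue_measure R).

Section affine.
Variables (a c : R).
Hypothesis a0 : a != 0.
Let phi : measurableTypeR R -> measurableTypeR R := fun x => a * x + c.
Let mphi : measurable_fun setT phi.
Proof. by apply: measurable_funD => //; exact: measurable_funM. Qed.
Let push : {measure set (measurableTypeR R) -> \bar R} :=
  (measure_function_pushforward__canonical__measure_function_Measure mu mphi).
Let na : {nonneg R} := NngNum (normr_ge0 a).

(** By uniqueness of Lebesgue measure, half-open intervals suffice; a negative [a] exchanges their
    open and closed ends. *)
Lemma lebesgue_measure_affine (A : set (measurableTypeR R)) : measurable A ->
  mscale na push A = mu A.
Proof.
move=> mA; apply/esym; apply: (@lebesgue_measure_unique _ (mscale na push)) => //.
move=> _ [[u v]] _ <-.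
transitivity (`|a|%:E * mu (phi @^-1` `]u, v]%classic))%E => //.
have [alt|agt] := ltrP a 0.
  rewrite (_ : phi @^-1` _ = `[(v - c) / a, (u - c) / a[%classic).
    rewrite !lebesgue_measure_itv/= !lte_fin ltr_nM2r ?invr_lt0// ltrD2r.
    case: ifPn => _; last by rewrite mule0.
    by rewrite -!EFinD -EFinM ltr0_norm//; congr EFin; field.
  apply/seteqP; split => x; rewrite /phi/= !in_itv/=.
    by rewrite ler_ndivrMr// ltr_ndivlMr// (mulrC x) lerBrDr ltrBlDr andbC.
  by rewrite ler_ndivrMr// ltr_ndivlMr// (mulrC x) lerBrDr ltrBlDr andbC.
have {}agt : 0 < a by rewrite lt_neqAle eq_sym a0.
rewrite (_ : phi @^-1` _ = `](u - c) / a, (v - c) / a]%classic).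
  rewrite !lebesgue_measure_itv/= !lte_fin ltr_pM2r ?invr_gt0// ltrD2r.
  case: ifPn => _; last by rewrite mule0.
  by rewrite -!EFinD -EFinM gtr0_norm//; congr EFin; field.
apply/seteqP; split => x; rewrite /phi/= !in_itv/=.
  by rewrite ltr_pdivrMr// ler_pdivlMr// (mulrC x) ltrBlDr lerBrDr.
by rewrite ltr_pdivrMr// ler_pdivlMr// (mulrC x) ltrBlDr lerBrDr.
Qed.

Lemma ge0_integral_affine (f : R -> \bar R) :
  measurable_fun setT f -> (forall x, 0 <= f x)%E ->
  (`|a|%:E * \int[mu]_x f (a * x + c)%R = \int[mu]_x f x)%E.
Proof.
move=> mf f0; transitivity (\int[mscale na push]_x f x)%E; last first.
  by apply: eq_measure_integral => A mA _; exact: lebesgue_measure_affine.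
by rewrite ge0_integral_mscale//= ge0_integral_pushforward.
Qed.

End affine.

Lemma Rintegral_odd (h : R -> R) : mu.-integrable setT (EFin \o h) ->
  (forall x, h (- x) = - h x) -> \int[mu]_x h x = 0.
Proof.
move=> ih hodd; have mh := measurable_int _ ih.
have N1 : -1 != 0 :> R by rewrite oppr_eq0 oner_neq0.
have mp := measurable_funepos mh.
have := @ge0_integral_affine (-1) 0 N1 _ mp (funepos_ge0 _).
rewrite normrN1 mul1e => E.
rewrite /Rintegral integralE.
have -> : (\int[mu]_x (EFin \o h)^\- x = \int[mu]_x (EFin \o h)^\+ x)%E.
  rewrite -E; apply: eq_integral => x _.
  by rewrite funenegE funeposE/= addr0 mulN1r hodd EFinN.
by rewrite subee// integrable_pos_fin_num.
Qed.

Lemma sin_le_norm (x : R) : `|sin x| <= `|x|.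
Proof.
wlog x0 : x / 0 <= x.
  move=> H; have [|/ltW x0] := leP 0 x; first exact: H.
  by rewrite -normrN -sinN -(normrN x); apply: H; rewrite oppr_ge0.
move: x0; rewrite le_eqVlt => /predU1P[<-|x0]; first by rewrite sin0.
have [c _] := @MVT R sin cos 0 x x0 (fun y _ => is_derive_sin y)
  (continuous_subspaceT (@continuous_sin R)).
rewrite sin0 !subr0 => ->; rewrite normrM ler_piMl// cos_max//.
Qed.

Lemma one_minus_cos_le (x : R) : 0 <= 1 - cos x <= Num.min 2 (x ^+ 2 / 2).
Proof.
have E : 1 - cos x = 2 * sin (x / 2) ^+ 2.
  have {1}-> : x = (x / 2) *+ 2 by rewrite -mulr_natr; field.
  by rewrite cos_mulr2n cos2sin2 -mulr_natr; ring.
have s0 : 0 <= sin (x / 2) ^+ 2 := sqr_ge0 _.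
apply/andP; split; first by rewrite E mulr_ge0.
rewrite le_min; apply/andP; split; first by have := cos_geN1 x; lra.
have : sin (x / 2) ^+ 2 <= (x / 2) ^+ 2.
  by rewrite -(real_normK (num_real (sin _))) -(real_normK (num_real (x / 2))) lerXn2r// ?nnegrE// sin_le_norm.
by rewrite E; nra.
Qed.

(** Pointwise limit of the continuous functions [x / (x^2 + 1 / (n + 1))], also at 0 thanks to the
    convention [0^-1 = 0]. *)
Lemma measurable_inv : measurable_fun setT (fun x : R => x^-1).
Proof.
apply: (@measurable_fun_cvg _ _ _ _ (fun n (x : R) => x / (x ^+ 2 + n.+1%:R^-1))).
  move=> n; apply: continuous_measurable_fun => x.
  have x0 : x ^+ 2 + n.+1%:R^-1 != 0 by rewrite gt_eqF// ltr_wpDl ?sqr_ge0// invr_gt0.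
  apply: cvgM => //; apply: cvgV => //.
  by apply: cvgD; [exact: exprn_continuous|exact: cvg_cst].
move=> x _; have [->|x0] := eqVneq x 0.
  by rewrite invr0; under eq_fun do rewrite mul0r; exact: cvg_cst.
have -> : x^-1 = x / (x ^+ 2 + 0) by rewrite addr0; field.
apply: cvgM; first exact: cvg_cst.
apply: cvgV; first by rewrite addr0 expf_neq0.
by apply: cvgD; [exact: cvg_cst|exact: cvg_harmonic].
Qed.

(** A Fejer kernel up to normalization, whose Fourier transform is a triangle. Division by zero
    gives the value 0 at the origin, a null set. *)
Definition vers (a x : R) : R := (1 - cos (a * x)) / x ^+ 2.

Lemma measurable_vers a : measurable_fun setT (vers a).
Proof.
apply: measurable_funM.
  apply: measurable_funB => //.
  apply: continuous_measurable_fun => x.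
  by have := @continuous_cos_affine R a 0 x; under eq_fun do rewrite addr0.
by apply: (measurableT_comp measurable_inv); exact: measurable_funX.
Qed.

Lemma integrable_oneDsqrV : mu.-integrable setT (EFin \o (fun x : R => (oneDsqr x)^-1)).
Proof.
have cV : continuous (fun x : R => (oneDsqr x)^-1) := @continuous_oneDsqrV R.
apply/integrableP; split.
  by apply/measurable_EFinP; exact: continuous_measurable_fun.
under eq_integral do rewrite /= ger0_norm ?invr_ge0 ?(le_trans ler01 (oneDsqr_ge1 _))//.
rewrite ge0_symfun_integralT//; last by move=> x /=; rewrite /oneDsqr sqrrN.
by rewrite -set_itvcy integral0y_oneDsqr -EFinM ltry.
Qed.

Lemma vers_ge0 a x : 0 <= vers a x.
Proof. by apply: divr_ge0; [have /andP[] := one_minus_cos_le (a * x)|exact: sqr_ge0]. Qed.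

Lemma vers_le a x : vers a x <= (2 + a ^+ 2 / 2) * (oneDsqr x)^-1.
Proof.
have o0 : 0 < oneDsqr x := lt_le_trans ltr01 (oneDsqr_ge1 x).
rewrite ler_pdivlMr// /oneDsqr mulrDr mulr1 addrC.
have /andP[v0] := one_minus_cos_le (a * x); rewrite le_min => /andP[v2 vx].
have [->|x0] := eqVneq x 0.
  rewrite expr0n/= mulr0 add0r /vers expr0n/= invr0 mulr0.
  by rewrite addr_ge0// divr_ge0// sqr_ge0.
have x20 : 0 < x ^+ 2 by rewrite exprn_even_gt0.
rewrite lerD//; first by rewrite /vers divfK// gt_eqF.
by rewrite /vers ler_pdivrMr// (le_trans vx)// exprMn mulrAC.
Qed.

Lemma integrable_vers a : mu.-integrable setT (EFin \o vers a).
Proof.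
apply: (@le_integrable_EFin _ _ _ mu _ (fun x => (2 + a ^+ 2 / 2) * (oneDsqr x)^-1)).
- exact: measurable_vers.
- by move=> x; rewrite ger0_norm ?vers_ge0// vers_le.
- by apply: integrableZ_EFin; exact: integrable_oneDsqrV.
Qed.

(** Scaling by [a]. The integral at [a = 1] stays an unevaluated positive constant throughout. *)
Lemma Rintegral_vers a : 0 <= a -> \int[mu]_x vers a x = a * \int[mu]_x vers 1 x.
Proof.
rewrite le_eqVlt => /predU1P[<-|a0].
  rewrite mul0r -[RHS](mul0r (fine (mu setT))) -Rintegral_cst//.
  by apply: eq_Rintegral => x _; rewrite /vers mul0r cos0 subrr mul0r.
have vE x : vers a x = a ^+ 2 * vers 1 (a * x + 0).
  rewrite /vers addr0 mul1r exprMn.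
  have [->|x0] := eqVneq x 0; first by rewrite mulr0 cos0 subrr !mul0r mulr0.
  by field; rewrite x0 gt_eqF.
have m1 : measurable_fun setT (fun x => (vers 1 x)%:E).
  by apply/measurable_EFinP; exact: measurable_vers.
have := @ge0_integral_affine a 0 _ (fun x => (vers 1 x)%:E) m1.
rewrite gt_eqF// => /(_ isT); rewrite gtr0_norm// => E.
have {}E := E (fun x => vers_ge0 1 x).
rewrite /Rintegral -E.
have -> : (\int[mu]_x (vers a x)%:E = (a ^+ 2)%:E * \int[mu]_x (vers 1 (a * x + 0))%:E)%E.
  rewrite -ge0_integralZl//.
  - by apply: eq_integral => x _; rewrite vE EFinM.
  - apply/measurable_EFinP; apply: (measurableT_comp (measurable_vers 1)).
    by apply: measurable_funD => //; exact: measurable_funM.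
  - by move=> x _; rewrite lee_fin vers_ge0.
  - by rewrite lee_fin sqr_ge0.
have f1 : (\int[mu]_x (vers 1 (a * x + 0))%:E)%E \is a fin_num.
  have : (a%:E * \int[mu]_x (vers 1 (a * x + 0))%:E)%E \is a fin_num.
    by rewrite E; apply: integrable_fin_num => //; exact: integrable_vers.
  by case: (integral _ _ _) => [r||]//; rewrite ?gt0_muley ?gt0_muleNy ?lte_fin.
rewrite !fineM//= mulrA expr2//.
Qed.

Lemma Rintegral_vers_gt0 : 0 < \int[mu]_x vers 1 x.
Proof.
have pi2 : (2 : R) <= pi by exact: pi_ge2.
have cos1 : cos 1 < 1 :> R.
  by rewrite -[ltRHS]cos0 ltr_cos ?in_itv/=; lra.
pose c : R := (1 - cos 1) / 4.
have c0 : 0 < c by rewrite divr_gt0// subr_gt0.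
pose A : set R := `[1, 2]%classic.
have mA : measurable A by exact: measurable_itv.
have i1 : mu.-integrable setT (EFin \o (\1_A : R -> R)).
  exact: integrable_indic_itv.
have lb : \int[mu]_x (c * \1_A x) <= \int[mu]_x vers 1 x.
  apply: le_Rintegral => //; [exact: integrableZ_EFin|exact: integrable_vers|].
  move=> x _; rewrite indicE; case: (boolP (x \in A)) => [|_]; last first.
    by rewrite mulr0 vers_ge0.
  rewrite inE /A/= in_itv/= => /andP[x1 x2].
  have x20 : 0 < x ^+ 2 by rewrite exprn_gt0// (lt_le_trans ltr01).
  rewrite mulr1 /vers mul1r ler_pdivlMr// /c.
  have cx : cos x <= cos 1.
    have [->//|x1'] := eqVneq x 1.
    by rewrite ltW// ltr_cos ?in_itv/=; lra.
  have : x ^+ 2 <= 4 by rewrite expr2; nra.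
  have : 0 <= 1 - cos 1 :> R by lra.
  nra.
apply: lt_le_trans lb; rewrite RintegralZl// mulr_gt0//.
rewrite /Rintegral integral_indic// setIT /A/= lebesgue_measure_itv/= lte_fin ltr1n -EFinB/=.
lra.
Qed.

Section kernel.
Variable L : R.
Hypothesis L0 : 0 < L.

(* Up to a constant factor, the Fourier transform of a trapezoid equal to 1 on [-L, L]. *)
Definition trapezoid_kernel (x : R) : R := vers (2 * L) x - vers L x.

Local Notation k := trapezoid_kernel.
Local Notation kappa := (L * \int[mu]_x vers 1 x).

Lemma measurable_trapezoid_kernel : measurable_fun setT k.
Proof. by apply: measurable_funB; exact: measurable_vers. Qed.

Lemma integrable_trapezoid_kernel : mu.-integrable setT (EFin \o k).
Proof. by apply: integrableB_EFin; exact: integrable_vers. Qed.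

Lemma trapezoid_kernel_le : exists2 B, 0 <= B & forall x, `|k x| <= B.
Proof.
pose C a : R := 2 + a ^+ 2 / 2.
have C0 a : 0 <= C a by rewrite addr_ge0// divr_ge0// sqr_ge0.
have vC a x : `|vers a x| <= C a.
  rewrite ger0_norm ?vers_ge0// (le_trans (vers_le _ _))// ler_piMr// ?C0//.
  by rewrite invf_le1 ?oneDsqr_ge1// (lt_le_trans ltr01)// oneDsqr_ge1.
exists (C (2 * L) + C L); first by rewrite addr_ge0.
by move=> x; rewrite (le_trans (ler_normB _ _))// lerD.
Qed.

Lemma integrable_sqr_trapezoid_kernel : mu.-integrable setT (EFin \o (fun x => k x ^+ 2)).
Proof.
have [B B0 kB] := trapezoid_kernel_le.
apply: (@le_integrable_EFin _ _ _ mu _ (fun x => B * `|k x|)).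
- by apply: measurable_funX; exact: measurable_trapezoid_kernel.
- by move=> x; rewrite normrX expr2 ler_wpM2r.
- apply: integrableZ_EFin; apply: integrable_norm; exact: integrable_trapezoid_kernel.
Qed.

Lemma integrable_bounded_trapezoid_kernel (f : R -> R) (B : R) :
  measurable_fun setT f -> (forall x, `|f x| <= B) ->
  mu.-integrable setT (EFin \o (fun x => f x * k x)).
Proof.
move=> mf fB; apply: (@le_integrable_EFin _ _ _ mu _ (fun x => B * `|k x|)).
- by apply: measurable_funM => //; exact: measurable_trapezoid_kernel.
- by move=> x; rewrite normrM ler_wpM2r.
- apply: integrableZ_EFin; apply: integrable_norm; exact: integrable_trapezoid_kernel.
Qed.

(** Product-to-sum formulas express the integrand through [vers] at [2L + t], [2L - t], [L + t] and
    [L - t]. All four are nonnegative when [|t| <= L], where the integral of [vers] is linear in its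
    parameter, so [t] drops out. *)
Lemma Rintegral_cos_trapezoid_kernel (t : R) : `|t| <= L ->
  \int[mu]_x (cos (t * x) * k x) = kappa.
Proof.
rewrite ler_norml => /andP[tL1 tL2].
have E x : cos (t * x) * k x =
    2^-1 * ((vers (2 * L + t) x + vers (2 * L - t) x) - (vers (L + t) x + vers (L - t) x)).
  rewrite /k /vers !(mulrDl _ _ x) !mulNr !cosD !sinN !cosN.
  set y := (x ^+ 2)^-1. by field.
under eq_Rintegral do rewrite E.
have iv a := integrable_vers a.
rewrite RintegralZl//; last by apply: integrableB_EFin; exact: integrableD_EFin.
rewrite RintegralB//; [|exact: integrableD_EFin..].
rewrite !RintegralD// !(Rintegral_vers (a := _ + _)); [|lra..].
by field.
Qed.

Lemma Rintegral_cos_affine_trapezoid_kernel (t phi : R) : `|t| <= L ->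
  \int[mu]_x (cos (t * x + phi) * k x) = kappa * cos phi.
Proof.
move=> tL; under eq_Rintegral do rewrite cosD mulrBl (mulrAC (cos _)) (mulrAC (sin _)).
have mc := @measurable_cos R; have ms := @measurable_sin R.
have mt : measurable_fun setT (fun x : R => t * x) by exact: measurable_funM.
have ic : mu.-integrable setT (EFin \o (fun x => cos (t * x) * k x)).
  apply: (@integrable_bounded_trapezoid_kernel _ 1); first exact: (measurableT_comp mc).
  by move=> x; exact: cos_max.
have isn : mu.-integrable setT (EFin \o (fun x => sin (t * x) * k x)).
  apply: (@integrable_bounded_trapezoid_kernel _ 1); first exact: (measurableT_comp ms).
  by move=> x; exact: sin_max.
rewrite RintegralB//; first last.
- by under eq_fun do rewrite mulrC; exact: integrableZ_EFin.
- by under eq_fun do rewrite mulrC; exact: integrableZ_EFin.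
rewrite !RintegralZr// Rintegral_cos_trapezoid_kernel//.
rewrite [X in _ - X * _]Rintegral_odd ?mul0r ?subr0// => x.
by rewrite mulrN sinN /k /vers !mulrN !cosN sqrrN mulNr.
Qed.

End kernel.

End sinc_kernel.

(** * The Paley-Wiener inequality *)

Section cauchy_schwarz.
Context {R : realType} {d : measure_display} {T : measurableType d}
  (m : {measure set T -> \bar R}).

Lemma quadratic_discriminant_le (U V W : R) : 0 <= V ->
  (forall t, 0 <= U + 2 * t * W + t ^+ 2 * V) -> W ^+ 2 <= U * V.
Proof.
rewrite le_eqVlt => /predU1P[<-|V0] H.
  have [->|W0] := eqVneq W 0; first by rewrite expr0n/= mulr0.
  have := H (- (U + 1) / (2 * W)); rewrite mulr0 addr0.
  by have -> : 2 * (- (U + 1) / (2 * W)) * W = - (U + 1) by [field]; lra.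
have := H (- W / V).
have -> : U + 2 * (- W / V) * W + (- W / V) ^+ 2 * V = (U * V - W ^+ 2) / V.
  by field; rewrite gt_eqF.
by rewrite pmulr_lge0 ?invr_gt0// subr_ge0.
Qed.

Lemma integrable_mul_sqr (u v : T -> R) :
  measurable_fun setT u -> measurable_fun setT v ->
  m.-integrable setT (EFin \o (fun x => u x ^+ 2)) ->
  m.-integrable setT (EFin \o (fun x => v x ^+ 2)) ->
  m.-integrable setT (EFin \o (fun x => u x * v x)).
Proof.
move=> mu mv iu iv.
apply: (@le_integrable_EFin _ _ _ m _ (fun x => u x ^+ 2 + v x ^+ 2)).
- exact: measurable_funM.
- move=> x; rewrite normrM -(real_normK (num_real (u x))) -(real_normK (num_real (v x))).
  by have := sqr_ge0 (`|u x| - `|v x|); have := sqr_ge0 (`|u x| + `|v x|); nra.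
- exact: integrableD_EFin.
Qed.

Lemma cauchy_schwarz_Rintegral (u v : T -> R) :
  measurable_fun setT u -> measurable_fun setT v ->
  m.-integrable setT (EFin \o (fun x => u x ^+ 2)) ->
  m.-integrable setT (EFin \o (fun x => v x ^+ 2)) ->
  (\int[m]_x (u x * v x)) ^+ 2 <= \int[m]_x (u x ^+ 2) * \int[m]_x (v x ^+ 2).
Proof.
move=> mu mv iu iv; have iuv := integrable_mul_sqr mu mv iu iv.
apply: quadratic_discriminant_le.
  by apply: Rintegral_ge0 => x _; exact: sqr_ge0.
move=> t.
have i1 : m.-integrable setT (EFin \o (fun x => 2 * t * (u x * v x))).
  exact: integrableZ_EFin.
have i2 : m.-integrable setT (EFin \o (fun x => t ^+ 2 * v x ^+ 2)).
  exact: integrableZ_EFin.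
rewrite -!RintegralZl// -RintegralD// -RintegralD//; last exact: integrableD_EFin.
apply: Rintegral_ge0 => x _.
by rewrite (_ : _ + _ = (u x + t * v x) ^+ 2) ?sqr_ge0//; ring.
Qed.

End cauchy_schwarz.

Section parametric_integral.
Context {R : realType} {d1 d2 : measure_display}
  {L : measurableType d1} {T : measurableType d2}
  (m : {sigma_finite_measure set T -> \bar R}).

Lemma measurable_parametric_Rintegral (F : L * T -> R) : measurable_fun setT F ->
  measurable_fun setT (fun l => \int[m]_x F (l, x)).
Proof.
move=> mF; have mEF : measurable_fun setT (EFin \o F) by exact/measurable_EFinP.
have mp : measurable_fun setT (fun l => \int[m]_x (EFin \o F)^\+ (l, x))%E.
  by apply: measurable_fun_fubini_tonelli_F => //; exact: measurable_funepos.
have mn : measurable_fun setT (fun l => \int[m]_x (EFin \o F)^\- (l, x))%E.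
  by apply: measurable_fun_fubini_tonelli_F => //; exact: measurable_funeneg.
rewrite (_ : (fun l => _) = fine \o (fun l => \int[m]_x (EFin \o F)^\+ (l, x) -
   \int[m]_x (EFin \o F)^\- (l, x))%E).
  apply: measurableT_comp => //; exact: emeasurable_funB.
apply/funext => l; rewrite /Rintegral/= integralE; congr (fine (_ - _)).
  by apply: eq_integral => x _; rewrite !funeposE.
by apply: eq_integral => x _; rewrite !funenegE.
Qed.

End parametric_integral.

Section paley_wiener_line.
Context {R : realType} {dT : measure_display} {T : measurableType dT}
  (m : {sigma_finite_measure set T -> \bar R}).
Notation mu := (@lebesgue_measure R).
Variable L : R.
Hypothesis L0 : 0 < L.

Local Notation k := (trapezoid_kernel L).
Local Notation kappa := (L * \int[mu]_x vers 1 x).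

(** Band-limitation to [[-L, L]] in the form to be exploited: convolution with the kernel, whose
    transform is constant on that interval, is multiplication by [kappa]. Boundedness makes the
    convolution integrals converge. *)
Definition reproduced (f : R -> R) :=
  [/\ measurable_fun setT f, (exists B, forall x, `|f x| <= B) &
    forall l, \int[mu]_x (f (l - x) * k x) = kappa * f l].

Lemma reproduced_sum (I : Type) (s : seq I) (f : I -> R -> R) :
  (forall i, reproduced (f i)) -> reproduced (fun l => \sum_(i <- s) f i l).
Proof.
move=> rf; split.
- by apply: measurable_sum => i; case: (rf i).
- elim: s => [|i s [B HB]]; first by exists 0 => x; rewrite big_nil normr0.
  have [_ [B' HB'] _] := rf i; exists (B' + B) => x.
  by rewrite big_cons (le_trans (ler_normD _ _))// lerD.
move=> l; under eq_Rintegral do rewrite mulr_suml.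
rewrite Rintegral_sum => [|i].
  by rewrite mulr_sumr; apply: eq_bigr => i _; have [_ _ ->] := rf i.
have [mf [B HB] _] := rf i.
apply: (@integrable_bounded_trapezoid_kernel _ L (fun x => f i (l - x)) B) => //.
by apply: (measurableT_comp mf); exact: measurable_funB.
Qed.

(** Fubini, justified by the bound [|a x| * |k y|], reduces the convolution to that of a single
    cosine, whose frequency [t x] is at most [L] in modulus wherever the amplitude is nonzero. *)
Lemma reproduced_integral (a t phi : T -> R) : m.-integrable setT (EFin \o a) ->
  measurable_fun setT t -> measurable_fun setT phi ->
  (forall x, a x != 0 -> `|t x| <= L) ->
  reproduced (fun l => \int[m]_x (a x * cos (t x * l + phi x))).
Proof.
move=> ia mt mphi tL; have ma := integrable_measurable ia.
have mc := @measurable_cos R.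
have mF : measurable_fun setT (fun z : R * T => a z.2 * cos (t z.2 * z.1 + phi z.2)).
  apply: measurable_funM; first exact: (measurableT_comp ma).
  apply: (measurableT_comp mc); apply: measurable_funD; last exact: (measurableT_comp mphi).
  by apply: measurable_funM => //; exact: (measurableT_comp mt).
have iac l : m.-integrable setT (EFin \o (fun x => a x * cos (t x * l + phi x))).
  apply: (@le_integrable_EFin _ _ _ m _ (fun x => `|a x|)).
  - apply: measurable_funM => //; apply: (measurableT_comp mc).
    by apply: measurable_funD => //; exact: measurable_funM.
  - by move=> x; rewrite normrM ler_piMr// cos_max.
  - exact: integrable_norm.
split.
- exact: (measurable_parametric_Rintegral m mF).
- exists (\int[m]_x `|a x|) => l.
  rewrite (le_trans (le_normr_Rintegral _ _))//.
  apply: le_Rintegral => //; [exact: (integrable_norm (iac l))|exact: integrable_norm|].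
  by move=> x _; rewrite normrM ler_piMr// cos_max.
move=> l.
pose G (z : R * T) := a z.2 * cos (t z.2 * (l - z.1) + phi z.2) * k z.1.
have mG : measurable_fun setT G.
  apply: measurable_funM; last exact: (measurableT_comp (measurable_trapezoid_kernel L)).
  apply: measurable_funM; first exact: (measurableT_comp ma).
  apply: (measurableT_comp mc); apply: measurable_funD; last exact: (measurableT_comp mphi).
  apply: measurable_funM => //; first exact: (measurableT_comp mt).
  exact: measurable_funB.
have iGx y : m.-integrable setT (fun x => (G (y, x))%:E).
  rewrite (_ : (fun x => _) = EFin \o (fun x => k y * (a x * cos (t x * (l - y) + phi x)))).
    exact: integrableZ_EFin.
  by apply/funext => x; rewrite /G/= mulrC.
have iG : (mu \x m)%E.-integrable setT (EFin \o G).
  apply/integrable12ltyP; first exact/measurable_EFinP.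
  pose A := (\int[m]_x `|a x|%:E)%E.
  have Aoo : (A < +oo)%E by case/integrableP : ia.
  have A0 : (0 <= A)%E by exact: integral_ge0.
  apply: (@le_lt_trans _ _ (\int[mu]_y (A * `|k y|%:E)))%E.
    apply: ge0_le_integral => //.
    - by move=> y _; exact: integral_ge0.
    - have mabs : measurable_fun setT (fun z => `|(EFin \o G) z|%E).
        by apply: measurableT_comp => //; exact/measurable_EFinP.
      by apply: (measurable_fun_fubini_tonelli_F (m2 := m) _ mabs) => z; exact: abse_ge0.
    - apply: emeasurable_funM => //; apply/measurable_EFinP.
      by apply: measurableT_comp => //; exact: measurable_trapezoid_kernel.
    move=> y _; rewrite /A -ge0_integralZr//; last first.
      by apply/measurable_EFinP; exact: measurableT_comp.
    apply: ge0_le_integral => //.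
    - by apply: measurableT_comp => //; exact: measurable_int (iGx y).
    - apply: emeasurable_funM => //; apply/measurable_EFinP; exact: measurableT_comp.
    by move=> x _; rewrite /G/= lee_fin !normrM ler_wpM2r// ler_piMr// cos_max.
  rewrite ge0_integralZl//; last first.
    apply/measurable_EFinP; apply: measurableT_comp => //.
    exact: measurable_trapezoid_kernel.
  rewrite lte_mul_pinfty// ?ge0_fin_numE//.
  by have /integrableP[] := integrable_trapezoid_kernel L.
transitivity (\int[mu]_y \int[m]_x G (y, x)).
  apply: eq_Rintegral => y _; rewrite -RintegralZr//.
have iGy x : mu.-integrable setT (fun y => (G (y, x))%:E).
  apply: (@integrable_bounded_trapezoid_kernel _ L
    (fun y => a x * cos (t x * (l - y) + phi x)) `|a x|).
    apply: measurable_funM => //; apply: (measurableT_comp mc).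
    by apply: measurable_funD => //; apply: measurable_funM => //; exact: measurable_funB.
  by move=> y; rewrite normrM ler_piMr// cos_max.
have -> : \int[mu]_y (\int[m]_x G (y, x)) = \int[m]_x (\int[mu]_y G (y, x)).
  rewrite /Rintegral.
  under eq_integral => y _ do rewrite fineK ?integrable_fin_num//.
  under [in RHS]eq_integral => x _ do rewrite fineK ?integrable_fin_num//.
  by congr fine; exact: (Fubini iG).
rewrite -RintegralZl//; apply: eq_Rintegral => x _.
rewrite /G/=; under eq_Rintegral do rewrite -mulrA.
have [->|ax0] := eqVneq (a x) 0.
  rewrite mul0r mulr0 -[RHS](mul0r (fine (mu setT))) -Rintegral_cst//.
  by apply: eq_Rintegral => y _; rewrite mul0r.
have cE y : t x * (l - y) + phi x = (- t x) * y + (t x * l + phi x) by ring.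
under eq_Rintegral do rewrite cE.
rewrite RintegralZl//.
  rewrite Rintegral_cos_affine_trapezoid_kernel ?normrN ?tL//; ring.
apply: (@integrable_bounded_trapezoid_kernel _ L _ 1).
  apply: (measurableT_comp mc); apply: measurable_funD => //; exact: measurable_funM.
by move=> y; exact: cos_max.
Qed.

(** The Cauchy-Schwarz constant of the convolution identity; the [+ 1] makes positivity
    immediate. *)
Definition pw_constant : R := (\int[mu]_x (k x ^+ 2) + 1) / kappa ^+ 2.

Lemma pw_constant_gt0 : 0 < pw_constant.
Proof.
rewrite divr_gt0//; last by rewrite exprn_gt0// mulr_gt0// Rintegral_vers_gt0.
by rewrite ltr_wpDl// Rintegral_ge0// => x _; exact: sqr_ge0.
Qed.

(** Cauchy-Schwarz applied to [kappa * f l], written as a convolution with the kernel. Extended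
    reals allow an infinite right-hand side, which is convenient for the slices met in higher
    dimension. *)
Lemma paley_wiener_line (f : R -> R) (l : R) : reproduced f ->
  ((f l ^+ 2)%:E <= pw_constant%:E * \int[mu]_x (f x ^+ 2)%:E)%E.
Proof.
move=> [mf _ rf].
have mf2 : measurable_fun setT (fun x => (f x ^+ 2)%:E).
  by apply/measurable_EFinP; exact: measurable_funX.
have f20 x : (0 <= (f x ^+ 2)%:E)%E by rewrite lee_fin sqr_ge0.
have := leey (\int[mu]_x (f x ^+ 2)%:E)%E.
rewrite le_eqVlt => /predU1P[->|foo].
  by rewrite gt0_muley ?leey// lte_fin pw_constant_gt0.
have N1 : -1 != 0 :> R by rewrite oppr_eq0 oner_neq0.
have := ge0_integral_affine l N1 mf2 f20.
rewrite normrN1 mul1e => E.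
pose g x := f (l - x).
have mg : measurable_fun setT g by apply: (measurableT_comp mf); exact: measurable_funB.
have Eg : (\int[mu]_x (g x ^+ 2)%:E = \int[mu]_x (f x ^+ 2)%:E)%E.
  by rewrite -E; apply: eq_integral => x _; rewrite /g mulN1r addrC.
have ig : mu.-integrable setT (EFin \o (fun x => g x ^+ 2)).
  apply/integrableP; split; first by apply/measurable_EFinP; exact: measurable_funX.
  under eq_integral do rewrite /= ger0_norm ?sqr_ge0//.
  by rewrite Eg.
have := @cauchy_schwarz_Rintegral _ _ (measurableTypeR R) mu _ _ mg (measurable_trapezoid_kernel L) ig
  (integrable_sqr_trapezoid_kernel L).
have -> : \int[mu]_x (g x ^+ 2) = fine (\int[mu]_x (f x ^+ 2)%:E)%E.
  by rewrite /Rintegral Eg.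
rewrite rf => CS.
have kap : 0 < kappa by rewrite mulr_gt0// Rintegral_vers_gt0.
have ff : (\int[mu]_x (f x ^+ 2)%:E)%E \is a fin_num.
  by rewrite ge0_fin_numE//; exact: integral_ge0.
rewrite -(fineK ff) -EFinM lee_fin /pw_constant mulrAC ler_pdivlMr ?exprn_gt0//.
rewrite -exprMn (mulrC (f l)) (le_trans CS)// mulrC ler_wpM2r//.
  by rewrite fine_ge0// integral_ge0.
by rewrite lerDl.
Qed.

End paley_wiener_line.

Section paley_wiener.
Context {R : realType} {dT : measure_display} {T : measurableType dT}
  (m : {sigma_finite_measure set T -> \bar R}).
Notation mu := (@lebesgue_measure R).
Variable L : R.
Hypothesis L0 : 0 < L.

(** The phase [phi] is arbitrary so that freezing one coordinate of [l] gives a function of the same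
    shape with another phase: this is what allows induction on the dimension. *)
Definition cosine_transform n (I : Type) (s : seq I) (a phi : I -> T -> R)
    (tau : I -> T -> 'rV[R]_n) (l : 'rV[R]_n) : R :=
  \sum_(i <- s) \int[m]_x (a i x * cos (dotv l (tau i x) + phi i x)).

Lemma dotvE n (h l : 'rV[R]_n) : dotv h l = \sum_j h ord0 j * l ord0 j.
Proof. by rewrite /dotv mxE; apply: eq_bigr => j _; rewrite mxE. Qed.

Lemma dotv_consr n (l : R) (v : 'rV[R]_n) (t : 'rV[R]_n.+1) :
  dotv (consr (l, v)) t = t ord0 ord0 * l + dotv v (\row_j t ord0 (lift ord0 j)).
Proof.
rewrite !dotvE big_ord_recl /consr mxE unlift_none/= mulrC; congr (_ + _).
by apply: eq_bigr => j _; rewrite !mxE liftK.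
Qed.

Lemma measurable_dotv n dL (U : measurableType dL) (f g : U -> 'rV[R]_n) :
  (forall j, measurable_fun setT (fun x => f x ord0 j)) ->
  (forall j, measurable_fun setT (fun x => g x ord0 j)) ->
  measurable_fun setT (fun x => dotv (f x) (g x)).
Proof.
move=> mf mg; under eq_fun do rewrite dotvE.
by apply: measurable_sum => j; exact: measurable_funM.
Qed.

Lemma measurable_cosine_transform n (I : Type) (s : seq I) (a phi : I -> T -> R)
    (tau : I -> T -> 'rV[R]_n) :
  (forall i, measurable_fun setT (a i)) -> (forall i, measurable_fun setT (phi i)) ->
  (forall i j, measurable_fun setT (fun x => tau i x ord0 j)) ->
  measurable_fun setT (cosine_transform s a phi tau).
Proof.
move=> ma mphi mtau; apply: measurable_sum => i.
apply: (measurable_parametric_Rintegral m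
  (F := fun z => a i z.2 * cos (dotv z.1 (tau i z.2) + phi i z.2))).
apply: measurable_funM; first exact: (measurableT_comp (ma i)).
apply: (measurableT_comp (@measurable_cos R)); apply: measurable_funD.
  apply: measurable_dotv => j; last exact: (measurableT_comp (mtau i j)).
  by apply: (measurableT_comp (measurable_coord j)); exact: measurable_fst.
exact: (measurableT_comp (mphi i)).
Qed.

Lemma ge0_integral_lebesgue_rVS n (g : 'rV[R]_n.+1 -> \bar R) :
  measurable_fun setT g -> (forall v, 0 <= g v)%E ->
  (\int[lebesgue_rV n.+1]_v g v =
   \int[mu]_l \int[lebesgue_rV n]_v g (consr (l, v)))%E.
Proof.
move=> mg g0.
have mphi : measurable_fun [set: (measurableTypeR R * 'rV[R]_n)%type] (@consr R n).
  exact: measurable_consr.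
transitivity (\int[mu \x lebesgue_rV n]_z (g \o @consr R n) z)%E.
  have := @ge0_integral_pushforward _ _ (measurableTypeR R * 'rV[R]_n)%type _ _ _ mphi
    (product_measure1 mu (lebesgue_rV n)) setT g measurableT mg (fun x _ => g0 x).
  by rewrite preimage_setT => <-.
have mgc : measurable_fun [set: (measurableTypeR R * 'rV[R]_n)%type] (g \o @consr R n).
  exact: measurableT_comp mg mphi.
by rewrite (fubini_tonelli1 _ mgc)// => z; exact: g0.
Qed.

(** One coordinate at a time: the estimate on the line in the first coordinate with the others
    fixed, then the induction hypothesis on each slice, where the first coordinate has become part
    of the phase. Each coordinate costs one factor [pw_constant L]. *)
Lemma paley_wiener n (I : Type) (s : seq I) (a phi : I -> T -> R)
    (tau : I -> T -> 'rV[R]_n) (l : 'rV[R]_n) :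
  (forall i, m.-integrable setT (EFin \o a i)) ->
  (forall i, measurable_fun setT (phi i)) ->
  (forall i j, measurable_fun setT (fun x => tau i x ord0 j)) ->
  (forall i x j, a i x != 0 -> `|tau i x ord0 j| <= L) ->
  ((cosine_transform s a phi tau l ^+ 2)%:E <= (pw_constant L ^+ n)%:E *
    \int[lebesgue_rV n]_v (cosine_transform s a phi tau v ^+ 2)%:E)%E.
Proof.
move=> ia; have ma i := integrable_measurable (ia i).
elim: n phi tau l => [|n IH] phi tau l mphi mtau tauL.
  rewrite expr0 mul1e/= integral_dirac//.
  - by rewrite diracT mul1e (_ : l = 0)//; apply/rowP => -[].
  - apply/measurable_EFinP; apply: measurable_funX; exact: measurable_cosine_transform.
pose f := cosine_transform s a phi tau.
have mf2 : measurable_fun setT (fun v => (f v ^+ 2)%:E).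
  by apply/measurable_EFinP; apply: measurable_funX; exact: measurable_cosine_transform.
have f20 v : (0 <= (f v ^+ 2)%:E)%E by rewrite lee_fin sqr_ge0.
rewrite -/f ge0_integral_lebesgue_rVS//.
pose tau' i x : 'rV[R]_n := \row_j tau i x ord0 (lift ord0 j).
have mtau' i j : measurable_fun setT (fun x => tau' i x ord0 j).
  by under eq_fun do rewrite mxE; exact: mtau.
have fE t v : f (consr (t, v)) = cosine_transform s a
    (fun i x => tau i x ord0 ord0 * t + phi i x) tau' v.
  apply: eq_bigr => i _; apply: eq_Rintegral => x _.
  by rewrite dotv_consr addrCA addrA addrC.
have fE2 t v : f (consr (t, v)) = \sum_(i <- s) \int[m]_x
    (a i x * cos (tau i x ord0 ord0 * t + (dotv v (tau' i x) + phi i x))).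
  by apply: eq_bigr => i _; apply: eq_Rintegral => x _; rewrite dotv_consr addrA.
rewrite -(unconsrK l); set t0 := (unconsr l).1; set v0 := (unconsr l).2.
rewrite [unconsr l](surjective_pairing) -/t0 -/v0.
have C0 : 0 <= pw_constant L := ltW (pw_constant_gt0 L0).
have step1 : ((f (consr (t0, v0)) ^+ 2)%:E <=
    (pw_constant L)%:E * \int[mu]_t (f (consr (t, v0)) ^+ 2)%:E)%E.
  have rf : reproduced L (fun t => f (consr (t, v0))).
    rewrite (funext (fun t => fE2 t v0)); apply: reproduced_sum => i.
    apply: reproduced_integral => //.
    - apply: measurable_funD => //; apply: measurable_dotv => j //.
    - by move=> x; exact: tauL.
  exact: paley_wiener_line.
apply: (le_trans step1).
rewrite exprS (EFinM (pw_constant L)) -muleA lee_wpmul2l// ?lee_fin//.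
rewrite -ge0_integralZl//; last 3 first.
- have mc : measurable_fun setT (fun z : R * 'rV[R]_n => (f (consr z) ^+ 2)%:E).
    by apply: (measurableT_comp mf2); exact: measurable_consr.
  exact: (measurable_fun_fubini_tonelli_F (m2 := lebesgue_rV n) _ mc).
- by move=> t _; exact: integral_ge0.
- by rewrite lee_fin exprn_ge0.
apply: ge0_le_integral => //.
- have mc : measurable_fun setT (fun t : R => consr (t, v0)).
    by apply: (measurableT_comp (@measurable_consr R n)); exact: measurable_fun_pair.
  exact: (measurableT_comp mf2).
- apply: emeasurable_funM => //.
  have mc : measurable_fun setT (fun z : R * 'rV[R]_n => (f (consr z) ^+ 2)%:E).
    by apply: (measurableT_comp mf2); exact: measurable_consr.
  exact: (measurable_fun_fubini_tonelli_F (m2 := lebesgue_rV n) _ mc).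
move=> t _; rewrite fE; under eq_integral do rewrite fE.
apply: IH => //.
- by move=> i; apply: measurable_funD => //; exact: measurable_funM.
- by move=> i x j aix; rewrite mxE; exact: tauL.
Qed.

End paley_wiener.

(** * Gaussian means of trigonometric polynomials *)

Section trigonometric_polynomials.
Context {R : realType} {I : Type}.
Notation mu := (@lebesgue_measure R).

(** A formal combination of coordinates in which indices may repeat, so that adding frequencies is
    concatenation. *)
Definition linear_form (xi : seq (R * I)) (x : I -> R) : R :=
  \sum_(t <- xi) t.1 * x t.2.

(* The term ((a, xi), phi) stands for a * cos (xi . x + phi). *)
Definition trig_poly := seq (R * seq (R * I) * R).
Implicit Types ts us : trig_poly.

Definition teval ts (x : I -> R) : R :=
  \sum_(t <- ts) t.1.1 * cos (linear_form t.1.2 x + t.2).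

Lemma linear_form_cat xi zeta x :
  linear_form (xi ++ zeta) x = linear_form xi x + linear_form zeta x.
Proof. exact: big_cat. Qed.

Definition freq_opp (xi : seq (R * I)) := [seq (- t.1, t.2) | t <- xi].

Lemma linear_form_opp xi x : linear_form (freq_opp xi) x = - linear_form xi x.
Proof.
rewrite /linear_form big_map -sumrN; apply: eq_bigr => t _.
by rewrite mulNr.
Qed.

Lemma linear_form_affine xi x b (u : R) :
  linear_form xi (fun i => x i + u * b i) = linear_form xi b * u + linear_form xi x.
Proof.
rewrite /linear_form mulr_suml -big_split/=; apply: eq_bigr => t _.
by rewrite mulrDr addrC; congr (_ + _); ring.
Qed.

Definition tone : trig_poly := [:: (1, [::], 0)].

Lemma teval_one x : teval tone x = 1.
Proof. by rewrite /teval big_seq1/= /linear_form big_nil addr0 cos0 mulr1. Qed.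

Lemma teval_cat ts us x : teval (ts ++ us) x = teval ts x + teval us x.
Proof. exact: big_cat. Qed.

Definition tscale c ts : trig_poly := [seq (c * t.1.1, t.1.2, t.2) | t <- ts].

Lemma teval_scale c ts x : teval (tscale c ts) x = c * teval ts x.
Proof.
rewrite /teval big_map mulr_sumr; apply: eq_bigr => t _.
by rewrite mulrA.
Qed.

(** Product-to-sum formula for cosines; thanks to the phases no sines are required for closure under
    products. *)
Definition tmul ts us : trig_poly :=
  flatten [seq flatten [seq [:: (t.1.1 * u.1.1 / 2, t.1.2 ++ u.1.2, t.2 + u.2);
    (t.1.1 * u.1.1 / 2, t.1.2 ++ freq_opp u.1.2, t.2 - u.2)] | u <- us] | t <- ts].

Lemma teval_mul ts us x : teval (tmul ts us) x = teval ts x * teval us x.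
Proof.
rewrite /teval /tmul big_flatten big_map mulr_suml; apply: eq_bigr => t _.
rewrite big_flatten big_map mulr_sumr; apply: eq_bigr => u _.
rewrite !big_cons big_nil/= !linear_form_cat linear_form_opp addr0.
rewrite (addrACA _ (linear_form u.1.2 x)) (addrACA _ (- linear_form u.1.2 x)).
rewrite -opprD; set A := _ + t.2; set B := _ + u.2.
by rewrite cosD cosB; field.
Qed.

Definition tpow n ts : trig_poly := iter n (tmul ts) tone.

Lemma teval_pow n ts x : teval (tpow n ts) x = teval ts x ^+ n.
Proof.
by elim: n => [|n IH]; [exact: teval_one|rewrite /= teval_mul IH exprS].
Qed.

Lemma teval_bounded ts : exists B, forall x, `|teval ts x| <= B.
Proof.
exists (\sum_(t <- ts) `|t.1.1|) => x.
apply: (le_trans (ler_norm_sum _ _ _)); apply: ler_sum => t _.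
by rewrite normrM ler_piMr// cos_max.
Qed.

Lemma measurable_teval dO (Omega : measurableType dO) (X : I -> Omega -> R) ts :
  (forall i, measurable_fun setT (X i)) ->
  measurable_fun setT (fun w => teval ts (X ^~ w)).
Proof.
move=> mX; apply: measurable_sum => t; apply: measurable_funM => //.
apply: (measurableT_comp (@measurable_cos R)); apply: measurable_funD => //.
by apply: measurable_sum => u; exact: measurable_funM.
Qed.

(** Integrating out a Gaussian variable of standard deviation [s] in direction [b] damps each cosine
    by a value of the characteristic function and leaves its frequency unchanged. *)
Definition slice (b : I -> R) (s : R) ts : trig_poly :=
  [seq (t.1.1 * expR (- ((linear_form t.1.2 b * s) ^+ 2 / 2)), t.1.2, t.2) | t <- ts].

Lemma measurable_teval_line ts (x b : I -> R) :
  measurable_fun setT (fun u : R => teval ts (fun i => x i + u * b i)).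
Proof.
apply: (@measurable_teval _ R (fun i (u : R) => x i + u * b i)) => i.
by apply: measurable_funD => //; exact: measurable_funM.
Qed.

Lemma teval_slice b s ts x : s != 0 ->
  teval (slice b s ts) x =
  \int[mu]_u (teval ts (fun i => x i + u * b i) * normal_pdf 0 s u).
Proof.
move=> s0; under eq_Rintegral do rewrite /teval mulr_suml.
rewrite Rintegral_sum => [|t].
  rewrite /teval big_map; apply: eq_bigr => t _ /=.
  under eq_Rintegral do rewrite linear_form_affine -addrA -mulrA.
  rewrite RintegralZl//.
    by rewrite normal_characteristic// mulrA mulrAC.
  apply: (@integrable_normal_bounded _ _ _ 1) => //; last by move=> u; exact: cos_max.
  by apply: continuous_measurable_fun; exact: continuous_cos_affine.
have [B tB] := teval_bounded [:: t].
apply: (@integrable_normal_bounded _ _ _ B) => //.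
  have := measurable_teval_line [:: t] x b.
  by under eq_fun do rewrite /teval big_seq1.
by move=> u; have := tB (fun i => x i + u * b i); rewrite /teval big_seq1.
Qed.

(* The mean of a trigonometric polynomial at sum_k s_k g_k b_k, where (s_k, b_k) runs
   over l and the g_k are independent standard normal variables. *)
Fixpoint gval (l : seq (R * (I -> R))) ts : R :=
  if l is (s, b) :: l' then gval l' (slice b s ts) else teval ts (fun=> 0).

Lemma gvalE l ts : gval l ts = \sum_(t <- ts) t.1.1 * cos t.2 *
  expR (- ((\sum_(sb <- l) (linear_form t.1.2 sb.2 * sb.1) ^+ 2) / 2)).
Proof.
elim: l ts => [|[s b] l IH] ts /=.
  apply: eq_bigr => t _; rewrite big_nil mul0r oppr0 expR0 mulr1.
  by rewrite /linear_form big1 ?add0r// => u _; rewrite mulr0.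
rewrite IH big_map; apply: eq_bigr => t _ /=.
by rewrite big_cons/= mulrDl opprD expRD; ring.
Qed.

Definition nondeg (l : seq (R * (I -> R))) := all (fun sb => sb.1 != 0) l.

(** Invisible in the closed formula [gvalE], but clear from the recursion, where each slice is an
    integral against a density. *)
Lemma gval_ge0 l ts : nondeg l -> (forall x, 0 <= teval ts x) -> 0 <= gval l ts.
Proof.
elim: l ts => [|[s b] l IH] ts /=; first by move=> _; exact.
move=> /andP[s0 l0] t0; apply: IH => // x; rewrite teval_slice//.
by apply: Rintegral_ge0 => u _; rewrite mulr_ge0// normal_pdf_ge0.
Qed.

Lemma gval_scale l c ts : gval l (tscale c ts) = c * gval l ts.
Proof.
rewrite !gvalE big_map mulr_sumr; apply: eq_bigr => t _ /=.
by rewrite -!mulrA.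
Qed.

Lemma gval_le l ts us : nondeg l -> (forall x, teval ts x <= teval us x) ->
  gval l ts <= gval l us.
Proof.
move=> l0 tu; have : 0 <= gval l (us ++ tscale (-1) ts).
  by apply: gval_ge0 => // x; rewrite teval_cat teval_scale mulN1r subr_ge0.
by rewrite gvalE big_cat/= -!gvalE gval_scale mulN1r subr_ge0.
Qed.

Definition standardize (l : seq (R * (I -> R))) := [seq (1, sb.2) | sb <- l] : seq (R * (I -> R)).

(** Tensorization. The induction hypothesis applies to the slice in the first direction; the
    one-dimensional inequality then bounds, at each point, the power of the slice by a multiple of
    the slice of the power, and monotonicity of [gval] integrates this over the other directions.
    The exponents of the constants add up. *)
Lemma gval_hoelder n l ts : (0 < n)%N ->
  (forall sb, List.In sb l -> 0 < sb.1 /\ sb.1 ^+ 2 <= n.+1%:R / 2) ->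
  (forall x, 0 <= teval ts x) ->
  gval l ts ^+ n.+1 <=
  expR (n.+1%:R ^+ 2 * (\sum_(sb <- l) ((sb.1 ^+ 2)^-1 - 1) ^+ 2) / 2) *
  gval (standardize l) (tpow n.+1 ts).
Proof.
move=> n0; elim: l ts => [|[s b] l IH] ts.
  by move=> _ t0; rewrite big_nil mulr0 mul0r expR0 mul1r /= -[leRHS]/(teval (tpow n.+1 ts) _) teval_pow.
move=> Hl t0; have [s0 sn] := Hl (s, b) (or_introl erefl).
have sn0 : s != 0 by rewrite gt_eqF.
have {}Hl sb : List.In sb l -> 0 < sb.1 /\ sb.1 ^+ 2 <= n.+1%:R / 2.
  by move=> sbl; apply: Hl; right.
have t0' x : 0 <= teval (slice b s ts) x.
  by rewrite teval_slice//; apply: Rintegral_ge0 => u _; rewrite mulr_ge0// normal_pdf_ge0.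
have nd : nondeg (standardize l).
  by rewrite /nondeg /standardize all_map; elim: (l) => //= sb l' ->; rewrite oner_neq0.
pose C := expR (n.+1%:R ^+ 2 * ((s ^+ 2)^-1 - 1) ^+ 2 / 2).
have step : gval (standardize l) (tpow n.+1 (slice b s ts)) <=
    gval (standardize l) (tscale C (slice b 1 (tpow n.+1 ts))).
  apply: gval_le => // x; rewrite teval_pow teval_scale !teval_slice ?oner_neq0//.
  have [B tB] := teval_bounded ts.
  under [X in _ <= _ * X]eq_Rintegral do rewrite teval_pow.
  apply: (@normal_hoelder R n s B (fun u => teval ts (fun i => x i + u * b i))) => //.
    exact: measurable_teval_line.
  by move=> u; rewrite t0/=; exact: (le_trans (ler_norm _) (tB _)).
apply: (le_trans (IH _ Hl t0')); rewrite big_cons/=.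
apply: (@le_trans _ _ (expR (n.+1%:R ^+ 2 * (\sum_(sb <- l) ((sb.1 ^+ 2)^-1 - 1) ^+ 2) / 2) *
   gval (standardize l) (tscale C (slice b 1 (tpow n.+1 ts))))).
  by rewrite ler_wpM2l ?expR_ge0.
rewrite gval_scale [_ * (_ + _)]mulrDr mulrDl expRD -/C le_eqVlt; apply/orP; left.
by apply/eqP; rewrite mulrCA mulrA.
Qed.

End trigonometric_polynomials.

(** * Approximation of events by trigonometric polynomials *)

Section approximation.
Context {R : realType} {I : Type} {dO : measure_display} {Omega : measurableType dO}
  (m : {finite_measure set Omega -> \bar R}) (Z : I -> {mfun Omega >-> R}).
Implicit Types f g : Omega -> R.

Definition unit_valued (T : Type) (f : T -> R) := forall x, 0 <= f x <= 1.

(** The approximants take values in [[0, 1]] everywhere, since only for those can means be compared.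
    Everything below is therefore assembled from products and complements [1 - f], which respect
    this constraint. *)
Definition approximable f :=
  [/\ measurable_fun setT f, unit_valued f &
  forall e : R, 0 < e -> exists ts : trig_poly, unit_valued (@teval R I ts) /\
    \int[m]_w `|f w - teval ts (Z ^~ w)| <= e].

Lemma integrable_bounded f (B : R) : measurable_fun setT f ->
  (forall w, `|f w| <= B) -> m.-integrable setT (EFin \o f).
Proof.
move=> mf fB; apply: (@le_integrable_EFin _ _ _ m _ (cst B)) => //.
exact: finite_measure_integrable_cst.
Qed.

Lemma measurable_teval_Z ts : measurable_fun setT (fun w => @teval R I ts (Z ^~ w)).
Proof. by apply: measurable_teval => i. Qed.

Lemma unit_valued_dist_le1 (x y : R) : 0 <= x <= 1 -> 0 <= y <= 1 -> `|x - y| <= 1.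
Proof. by move=> /andP[x0 x1] /andP[y0 y1]; rewrite ler_norml; lra. Qed.

Lemma integrable_unit_dist f g : measurable_fun setT f -> measurable_fun setT g ->
  unit_valued f -> unit_valued g -> m.-integrable setT (EFin \o (fun w => `|f w - g w|)).
Proof.
move=> mf mg uf ug; apply: (@integrable_bounded _ 1).
  by apply: measurableT_comp => //; exact: measurable_funB.
by move=> w; rewrite normr_id unit_valued_dist_le1.
Qed.

Lemma approximable_trig ts : unit_valued (@teval R I ts) ->
  approximable (fun w => teval ts (Z ^~ w)).
Proof.
move=> uts; split; [exact: measurable_teval_Z|by move=> w; exact: uts|].
move=> e e0; exists ts; split => //.
under eq_Rintegral do rewrite subrr normr0.
by rewrite Rintegral_cst// mul0r ltW.
Qed.

Lemma approximable_compl f : approximable f -> approximable (fun w => 1 - f w).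
Proof.
move=> [mf uf af]; split; first exact: measurable_funB.
  by move=> w; have := uf w; lra.
move=> e /af [ts [uts tse]]; exists (tone ++ tscale (-1) ts); split.
  by move=> x; rewrite teval_cat teval_one teval_scale; have := uts x; lra.
rewrite (_ : Rintegral _ _ _ = \int[m]_w `|f w - teval ts (Z ^~ w)|)//.
apply: eq_Rintegral => w _; rewrite teval_cat teval_one teval_scale -normrN.
by congr `|_|; ring.
Qed.

Lemma approximable_mul f g : approximable f -> approximable g ->
  approximable (fun w => f w * g w).
Proof.
move=> [mf uf af] [mg ug ag].
have ufg : unit_valued (fun w => f w * g w).
  by move=> w; have := uf w; have := ug w; nra.
split => //; first exact: measurable_funM.
move=> e e0; have e20 : 0 < e / 2 by rewrite divr_gt0.
have [ts [uts tse]] := af _ e20; have [us [uus use]] := ag _ e20.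
exists (tmul ts us); split.
  by move=> x; rewrite teval_mul; have := uts x; have := uus x; nra.
have i1 := integrable_unit_dist mf (measurable_teval_Z ts) uf (fun w => uts _).
have i2 := integrable_unit_dist mg (measurable_teval_Z us) ug (fun w => uus _).
apply: (@le_trans _ _ (\int[m]_w (`|f w - teval ts (Z ^~ w)| + `|g w - teval us (Z ^~ w)|))).
  apply: le_Rintegral => //; last 2 first.
  - exact: integrableD_EFin.
  - move=> w _; rewrite teval_mul.
    set t := teval ts _; set u := teval us _.
    have -> : f w * g w - t * u = (f w - t) * g w + t * (g w - u) by ring.
    rewrite (le_trans (ler_normD _ _))// !normrM lerD//.
      by rewrite ler_piMr// ger0_norm; have := ug w; lra.
    by rewrite ler_piMl// ger0_norm; have := uts (Z ^~ w); rewrite -/t; lra.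
  apply: integrable_unit_dist => //; [exact: measurable_funM|exact: measurable_teval_Z|].
  by move=> w; rewrite teval_mul; have := uts (Z ^~ w); have := uus (Z ^~ w); nra.
by rewrite RintegralD//; lra.
Qed.

Lemma approximable_exp f n : approximable f -> approximable (fun w => f w ^+ n).
Proof.
move=> af; elim: n => [|n IH].
  rewrite (_ : (fun _ => _) = (fun w => @teval R I tone (Z ^~ w))).
    by apply: approximable_trig => x; rewrite teval_one ler01 lexx.
  by apply/funext => w; rewrite teval_one expr0.
by under eq_fun do rewrite exprS; exact: approximable_mul.
Qed.

Lemma approximable_lim (h : nat -> Omega -> R) f :
  (forall n, approximable (h n)) -> (forall w, h ^~ w @ \oo --> f w) ->
  approximable f.
Proof.
move=> ah hf.
have mf : measurable_fun setT f.
  by apply: (@measurable_fun_cvg _ _ _ _ h) => [n|w _]; [case: (ah n)|exact: hf].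
have uf : unit_valued f.
  move=> w; have cvw := hf w; apply/andP; split.
    apply: (cvgr_to_ge cvw); apply: nearW => n.
    by have [_ /(_ w)/andP[]] := ah n.
  apply: (cvgr_to_le cvw); apply: nearW => n.
  by have [_ /(_ w)/andP[]] := ah n.
split => // e e0; have e20 : 0 < e / 2 by rewrite divr_gt0.
have ihf n : m.-integrable setT (EFin \o (fun w => `|h n w - f w|)).
  by have [mh uh _] := ah n; exact: integrable_unit_dist.
have cvgI : (\int[m]_w `|h n w - f w| @[n --> \oo] --> (0 : R)).
  have := @dominated_convergence _ _ _ m setT measurableT (fun n w => (h n w)%:E)
    (fun w => (f w)%:E) (cst 1%E).
  move=> /(_ _ _ _ _ _)[].
  - by move=> n; have [mh _ _] := ah n; exact/measurable_EFinP.
  - exact/measurable_EFinP.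
  - by apply: aeW => w _; apply: cvg_EFin; [exact: nearW|exact: hf].
  - exact: finite_measure_integrable_cst.
  - apply: aeW => w n _ /=; rewrite lee_fin; have [_ uh _] := ah n.
    by rewrite ger0_norm; have /andP[] := uh w.
  by move=> _ /fine_cvg + _.
have /cvgrPdist_le/(_ _ e20)[N _ /(_ N (leqnn _))] := cvgI.
rewrite sub0r normrN => hN.
have [mh uh /(_ _ e20)[ts [uts tse]]] := ah N.
exists ts; split => //.
have i2 := integrable_unit_dist mh (measurable_teval_Z ts) uh (fun w => uts _).
apply: (@le_trans _ _ (\int[m]_w (`|h N w - f w| + `|h N w - teval ts (Z ^~ w)|))).
  apply: le_Rintegral => //; [|exact: integrableD_EFin|].
    apply: integrable_unit_dist => //; exact: measurable_teval_Z.
  by move=> w _; rewrite (distrC (h N w) (f w)); exact: ler_distD.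
rewrite RintegralD//.
have := le_trans (ler_norm _) hN; lra.
Qed.

Lemma bernoulli_le (v : R) N : 0 <= v <= 1 -> 1 - N%:R * v <= (1 - v) ^+ N.
Proof.
move=> /andP[v0 v1]; elim: N => [|N IH]; first by rewrite mul0r subr0 expr0.
rewrite exprS; apply: (@le_trans _ _ ((1 - v) * (1 - N%:R * v))).
  by rewrite -natr1; have := mulr_ge0 (ler0n R N) (sqr_ge0 v); nra.
by rewrite ler_wpM2l// subr_ge0.
Qed.

Lemma bernoulli_ge (v : R) N : 0 <= v -> 1 + N%:R * v <= (1 + v) ^+ N.
Proof.
move=> v0; elim: N => [|N IH]; first by rewrite mul0r addr0 expr0.
rewrite exprS; apply: (@le_trans _ _ ((1 + v) * (1 + N%:R * v))).
  by rewrite -natr1; have := mulr_ge0 (ler0n R N) (sqr_ge0 v); nra.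
by rewrite ler_wpM2l// addr_ge0.
Qed.

(** With [q] the square root of [r], Bernoulli's inequality bounds [n * q ^+ n], and the other
    factor [q ^+ n] tends to 0. *)
Lemma cvg_natmul_expr (r : R) : 0 <= r < 1 -> (fun n => n%:R * r ^+ n) @ \oo --> (0 : R).
Proof.
move=> /andP[r0 r1]; pose q := Num.sqrt r.
have q0 : 0 <= q by exact: sqrtr_ge0.
have qr : q ^+ 2 = r by rewrite sqr_sqrtr.
have q1 : q < 1 by rewrite -(@ltr_pXn2r _ 2)// ?nnegrE// qr expr1n.
have [qz|qn0] := eqVneq q 0.
  apply: cvg_near_cst; near=> n.
  have n0 : (0 < n)%N by near: n; exists 1%N.
  by rewrite -qr qz expr0n/= expr0n eqn0Ngt n0 mulr0.
have qp : 0 < q by rewrite lt_neqAle eq_sym qn0.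
pose h := q^-1 - 1.
have h0 : 0 < h by rewrite subr_gt0 invf_gt1.
have nq n : n%:R * q ^+ n <= h^-1.
  have := bernoulli_ge n (ltW h0).
  rewrite (_ : 1 + h = q^-1) ?exprVn => [B|]; last by rewrite /h addrC subrK.
  rewrite -ler_pdivlMr ?exprn_gt0// -ler_pdivrMl ?invr_gt0// invrK.
  by apply: le_trans B; rewrite mulrC lerDr.
apply: (@squeeze_cvgr _ _ _ _ (cst 0) (fun n => h^-1 * q ^+ n)).
- near=> n; rewrite mulr_ge0 ?exprn_ge0//=.
  by rewrite -qr -exprM mulnC exprM expr2 mulrA ler_wpM2r// ?exprn_ge0 ?nq//.
- exact: cvg_cst.
- rewrite -[X in _ --> X](mulr0 h^-1); apply: cvgMr.
  by apply: cvg_expr; rewrite ger0_norm.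
Unshelve. all: end_near. Qed.

(* The polynomials of Brosowski and Deutsch. *)
Lemma cvg_threshold (u : R) : 0 <= u <= 1 ->
  (fun n => (1 - u ^+ n) ^+ (n * 2 ^ n)%N) @ \oo --> ((u < 2^-1)%R%:R : R).
Proof.
move=> /andP[u0 u1].
have un n : 0 <= u ^+ n <= 1 by rewrite exprn_ge0// exprn_ile1.
(* This quantity tends to 0 when [u < 1/2] and is at least [n] when [u >= 1/2]. Bernoulli's
   inequality is used from below in the first case; in the second it is applied to [1 + u ^+ n],
   together with [(1 - u ^+ n) * (1 + u ^+ n) <= 1]. *)
have NE n : (n * 2 ^ n)%:R * u ^+ n = n%:R * (2 * u) ^+ n.
  by rewrite natrM natrX exprMn mulrA.
case: ltP => u2.
  apply: (@squeeze_cvgr _ _ _ _ (fun n => 1 - n%:R * (2 * u) ^+ n) (cst 1)).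
  - near=> n; rewrite -NE bernoulli_le//=.
    by have := un n => /andP[a0 a1]; apply: exprn_ile1; lra.
  - rewrite -[X in _ --> X](subr0 1); apply: cvgB; first exact: cvg_cst.
    by apply: cvg_natmul_expr; lra.
  - exact: cvg_cst.
apply: (@squeeze_cvgr _ _ _ _ (cst 0) harmonic).
- near=> n; have /andP[a0 a1] := un n.
  rewrite exprn_ge0 ?subr_ge0//=.
  have B := bernoulli_ge (n * 2 ^ n)%N a0.
  have n1 : n.+1%:R <= (1 + u ^+ n) ^+ (n * 2 ^ n)%N.
    apply: le_trans B; rewrite -natr1 addrC lerD2l NE ler_peMr// exprn_ege1//.
    lra.
  rewrite -[leRHS]mul1r ler_pdivlMr//.
  apply: (@le_trans _ _ ((1 - u ^+ n) ^+ (n * 2 ^ n)%N * (1 + u ^+ n) ^+ (n * 2 ^ n)%N)).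
    by rewrite ler_wpM2l// exprn_ge0// subr_ge0.
  by rewrite -exprMn exprn_ile1//; nra.
- exact: cvg_cst.
- exact: cvg_harmonic.
Unshelve. all: end_near. Qed.

Lemma approximable_threshold f : approximable f ->
  approximable (\1_[set w | f w < 2^-1] : Omega -> R).
Proof.
move=> af; apply: (@approximable_lim (fun n w => (1 - f w ^+ n) ^+ (n * 2 ^ n)%N)).
  by move=> n; apply: approximable_exp; apply: approximable_compl; exact: approximable_exp.
move=> w; rewrite indicE; have [_ uf _] := af.
have -> : (w \in [set w | f w < 2^-1]) = (f w < 2^-1).
  by apply/idP/idP; rewrite inE.
exact: cvg_threshold.
Qed.

Lemma approximable_setC A : approximable (\1_A : Omega -> R) ->
  approximable (\1_(~` A) : Omega -> R).
Proof.
move=> /approximable_compl; congr approximable; apply/funext => w.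
by rewrite indicC indicE; case: (w \in A); rewrite ?subr0 ?subrr.
Qed.

Lemma approximable_setI A B : approximable (\1_A : Omega -> R) ->
  approximable (\1_B : Omega -> R) -> approximable (\1_(A `&` B) : Omega -> R).
Proof. by move=> aA aB; rewrite indicI; exact: approximable_mul. Qed.

Lemma approximable_set0 : approximable (\1_set0 : Omega -> R).
Proof.
rewrite indic0 (_ : cst 0 = (fun w => @teval R I [::] (Z ^~ w))).
  by apply: approximable_trig => x; rewrite /teval big_nil lexx ler01.
by apply/funext => w; rewrite /teval big_nil.
Qed.

Lemma approximable_bigcup (A : (set Omega)^nat) :
  (forall n, approximable (\1_(A n) : Omega -> R)) ->
  approximable (\1_(\bigcup_n A n) : Omega -> R).
Proof.
move=> aA; pose B n := \big[setU/set0]_(i < n) A i.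
have aB n : approximable (\1_(B n) : Omega -> R).
  elim: n => [|n IH]; first by rewrite /B big_ord0; exact: approximable_set0.
  rewrite /B big_ord_recr/= -/(B n) -(setCK (_ `|` _)) setCU.
  by apply: approximable_setC; apply: approximable_setI; apply: approximable_setC.
apply: (approximable_lim aB) => w; rewrite !indicE.
case: (boolP (w \in \bigcup_n A n)) => [|].
  rewrite inE => -[k _ Akw]; apply: cvg_near_cst; near=> n; rewrite indicE mem_set//.
  rewrite /B -bigcup_mkord; exists k => //=.
  by near: n; exists k.+1.
move=> wA; apply: cvg_near_cst; apply: nearW => n; rewrite indicE memNset//.
rewrite /B -bigcup_mkord => -[k _ Akw]; move/negP: wA; apply.
by rewrite inE; exists k.
Unshelve. all: end_near. Qed.

Lemma sigma_algebra_approximable :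
  sigma_algebra [set: Omega] [set A | approximable (\1_A : Omega -> R)].
Proof.
split; first exact: approximable_set0.
  by move=> A aA; rewrite /= setTD; exact: approximable_setC.
exact: approximable_bigcup.
Qed.

(** For fixed [w] the argument [t j w] ends up in []-pi, pi[], where the sine has the sign of
    [Z i w - a]. Thresholding [(1 + sin) / 2] at one half thus detects the half-line in the limit of
    low frequencies. *)
Lemma approximable_ray i a : approximable (\1_[set w | Z i w < a] : Omega -> R).
Proof.
pose t j (w : Omega) := (Z i w - a) / j.+1%:R.
have au j : approximable (fun w => (1 + sin (t j w)) / 2).
  pose ts : trig_poly := [:: (2^-1, [::], 0);
    (2^-1, [:: (j.+1%:R^-1, i)], - (a / j.+1%:R) - pi / 2)].
  have E x : teval ts x = (1 + sin ((x i - a) / j.+1%:R)) / 2.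
    rewrite /teval !big_cons big_nil/= /linear_form big_nil big_seq1/=.
    have -> : j.+1%:R^-1 * x i + (- (a / j.+1%:R) - pi / 2) =
        (x i - a) / j.+1%:R - pi / 2 by ring.
    by rewrite cosBpihalf !addr0 cos0; ring.
  rewrite (_ : (fun w => _) = (fun w => teval ts (Z ^~ w))).
    apply: approximable_trig => x; rewrite E.
    by have := sin_le1 ((x i - a) / j.+1%:R); have := sin_geN1 ((x i - a) / j.+1%:R); lra.
  by apply/funext => w; rewrite E.
apply: (@approximable_lim (fun j => \1_[set w | (1 + sin (t j w)) / 2 < 2^-1])).
  by move=> j; exact: approximable_threshold.
move=> w; rewrite indicE; apply: cvg_near_cst; near=> j.
have pi0 : 0 < pi :> R := pi_gt0 R.
have tj : `|t j w| < pi.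
  rewrite normrM normfV normr_nat ltr_pdivrMr//.
  rewrite -ltr_pdivrMl//.
  near: j; exists (Num.truncn (pi^-1 * `|Z i w - a|)) => // j /= jn.
  by apply: (lt_le_trans (truncnS_gt _)); rewrite ler_nat.
rewrite indicE; congr (_%:R); congr nat_of_bool; apply/idP/idP; rewrite !inE/= => H.
  rewrite ltNge; apply/negP => Za.
  have : 0 <= sin (t j w).
    apply: sin_ge0_pi; apply/andP; split; first by rewrite divr_ge0// subr_ge0.
    by rewrite ltW// (le_lt_trans (ler_norm _) tj).
  by lra.
have : 0 < sin (- t j w).
  apply: sin_gt0_pi; apply/andP; split.
    by rewrite oppr_gt0 pmulr_llt0 ?invr_gt0// subr_lt0.
  by rewrite (le_lt_trans (ler_norm _))// normrN.
by rewrite sinN; lra.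
Unshelve. all: end_near. Qed.

Lemma approximable_preimage i (B : set R) : measurable B ->
  approximable (\1_(Z i @^-1` B) : Omega -> R).
Proof.
move=> mB; have : (@ocitv R).-sigma.-measurable B by exact: mB.
rewrite RGenInftyO.measurableE; move: B {mB}.
have [s0 sC sU] := sigma_algebra_approximable.
apply: smallest_sub.
  split; first by rewrite /= preimage_set0.
    by move=> A /= /sC; rewrite /= !setTD preimage_setC.
  by move=> F FA; rewrite /= preimage_bigcup; exact: sU.
move=> _ [a ->] /=.
rewrite (_ : Z i @^-1` _ = [set w | Z i w < a]); first exact: approximable_ray.
by apply/seteqP; split=> w; rewrite /= in_itv.
Qed.

End approximation.

(** * From the comparison of means to null sets *)

Section null_sets.
Context {R : realType} {I : Type} {dO : measure_display} {Omega : measurableType dO}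
  (Z : I -> {mfun Omega >-> R}) (P0 P1 : probability Omega R).

(** A single approximant has to be close to the event under both measures at once. *)
Definition probability_sum : set Omega -> \bar R := measure_add P0 P1.

HB.instance Definition _ := Measure.on probability_sum.

Let probability_sum_finite : fin_num_fun probability_sum.
Proof. by move=> A mA; rewrite /probability_sum measure_addE fin_numD !fin_num_measure. Qed.

HB.instance Definition _ := Measure_isFinite.Build _ _ _ probability_sum probability_sum_finite.

Let m : {finite_measure set Omega -> \bar R} := probability_sum.

Lemma null_set_transfer (q : nat) (M : R) :
  (forall ts : trig_poly, unit_valued (@teval R I ts) ->
    (\int[P1]_w teval ts (Z ^~ w)) ^+ q.+1 <= M * \int[P0]_w teval ts (Z ^~ w)) ->
  forall A, <<s [set A | exists i (B : set R), measurable B /\ A = Z i @^-1` B] >> A ->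
    P0 A = 0%E -> P1 A = 0%E.
Proof.
move=> H A sA P0A.
have aA : approximable m Z (\1_A : Omega -> R).
  move: A sA {P0A}; apply: smallest_sub; first exact: sigma_algebra_approximable.
  by move=> _ [i [B [mB ->]]]; exact: approximable_preimage.
have [mfA uA HA] := aA.
have mA : measurable A.
  rewrite (_ : A = (\1_A : Omega -> R) @^-1` [set 1]).
    by rewrite -[X in measurable X]setTI; exact: mfA.
  apply/seteqP; split => w /=; rewrite indicE; first by move=> /mem_set ->.
  by case: (boolP (w \in A)) => [/set_mem//|_ /eqP]; rewrite eq_sym oner_eq0.
have PA (P : probability Omega R) : \int[P]_w \1_A w = fine (P A).
  by rewrite /Rintegral integral_indic// setIT.
set c := fine (P1 A).
have c0 : 0 <= c by rewrite fine_ge0.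
have P1A : P1 A = c%:E by rewrite fineK// fin_num_measure.
rewrite P1A; congr EFin; apply/eqP; rewrite eq_le c0 andbT leNgt; apply/negP => cp.
(* The first bound keeps the [P1]-mean of the approximant at least [c / 2]. The second makes [M]
   times its [P0]-mean at most half of [(c / 2) ^+ q.+1], a contradiction; [|M| + 1] is positive
   whatever [M] is. *)
pose e := Num.min (c / 2) ((c / 2) ^+ q.+1 / (2 * (`|M| + 1))).
have M1 : 0 < `|M| + 1 by rewrite ltr_pwDr.
have e0 : 0 < e.
  by rewrite lt_min !divr_gt0 ?exprn_gt0 ?divr_gt0// mulr_gt0.
have [ts [uts tse]] := HA _ e0.
have mt := @measurable_teval_Z R I _ _ Z ts.
have iZ (P : probability Omega R) : P.-integrable setT (EFin \o (fun w => teval ts (Z ^~ w))).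
  by apply: (@integrable_bounded _ _ _ P _ 1) => // w; rewrite ger0_norm; have := uts (Z ^~ w); lra.
have i1 (P : probability Omega R) : P.-integrable setT (EFin \o (\1_A : Omega -> R)).
  by apply: (@integrable_bounded _ _ _ P _ 1) => // w; rewrite ger0_norm; have := uA w; lra.
have id (P : probability Omega R) : P.-integrable setT
    (EFin \o (fun w => `|\1_A w - teval ts (Z ^~ w)|)).
  by apply: integrable_unit_dist => // w; exact: uts.
have Em : \int[m]_w `|\1_A w - teval ts (Z ^~ w)| =
    \int[P0]_w `|\1_A w - teval ts (Z ^~ w)| + \int[P1]_w `|\1_A w - teval ts (Z ^~ w)|.
  rewrite /Rintegral /m ge0_integral_measure_add//; last first.
    by apply/measurable_EFinP; apply: measurableT_comp => //; exact: measurable_funB.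
  by rewrite fineD//; apply: integrable_fin_num => //; exact: id.
have dist (P : probability Omega R) :
    `|fine (P A) - \int[P]_w teval ts (Z ^~ w)| <= \int[P]_w `|\1_A w - teval ts (Z ^~ w)|.
  rewrite -PA -RintegralB; [|exact: measurableT|exact: i1|exact: iZ].
  apply: (@le_normr_Rintegral _ _ _ P setT (fun w => \1_A w - teval ts (Z ^~ w))).
    exact: measurableT.
  exact: (@integrableB_EFin _ _ _ P _ _ (i1 P) (iZ P)).
have d0 (P : probability Omega R) : 0 <= \int[P]_w `|\1_A w - teval ts (Z ^~ w)|.
  by apply: Rintegral_ge0 => w _.
have dist0 := dist P0; have dist1 := dist P1.
rewrite P0A/= sub0r normrN in dist0; rewrite -/c in dist1.
rewrite Em in tse.
have E1 : c / 2 <= \int[P1]_w teval ts (Z ^~ w).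
  have : e <= c / 2 by rewrite ge_min lexx.
  have := le_trans (ler_norm _) dist1; have := d0 P0; lra.
have E0 : 0 <= \int[P0]_w teval ts (Z ^~ w) <= (c / 2) ^+ q.+1 / (2 * (`|M| + 1)).
  apply/andP; split; first by apply: Rintegral_ge0 => w _; have /andP[] := uts (Z ^~ w).
  have : e <= (c / 2) ^+ q.+1 / (2 * (`|M| + 1)) by rewrite ge_min lexx orbT.
  have := le_trans (ler_norm _) dist0; have := d0 P1; lra.
have /andP[E00 E01] := E0.
have c2 : 0 < (c / 2) ^+ q.+1 by rewrite exprn_gt0// divr_gt0.
have : (c / 2) ^+ q.+1 <= (c / 2) ^+ q.+1 / 2.
  apply: (@le_trans _ _ ((\int[P1]_w teval ts (Z ^~ w)) ^+ q.+1)).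
    by rewrite lerXn2r// nnegrE ?divr_ge0//; apply: le_trans E1; rewrite divr_ge0.
  apply: (le_trans (H ts uts)).
  apply: (@le_trans _ _ ((`|M| + 1) * ((c / 2) ^+ q.+1 / (2 * (`|M| + 1))))).
    apply: (@le_trans _ _ ((`|M| + 1) * \int[P0]_w teval ts (Z ^~ w))).
      by rewrite ler_wpM2r// (le_trans (ler_norm _))// lerDl.
    by rewrite ler_wpM2l// ltW.
  by rewrite le_eqVlt; apply/orP; left; apply/eqP; field; rewrite gt_eqF.
by lra.
Qed.

End null_sets.

(** * Comparison of two Gaussian families *)

Section kernels.
Context {R : realType} {I : eqType}.
Implicit Types (K : I -> I -> R) (xi : seq (R * I)).

Definition kernel_form K xi : R :=
  \sum_(s <- xi) \sum_(t <- xi) s.1 * t.1 * K s.2 t.2.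

(** Independent noise of variance [e] on every coordinate, which makes the Gram matrix of distinct
    points positive definite. *)
Definition ridge K (e : R) : I -> I -> R := fun i j => K i j + e * (i == j)%:R.

Lemma kernel_form_ridge K e xi : kernel_form (ridge K e) xi =
  kernel_form K xi + e * kernel_form (fun i j => (i == j)%:R) xi.
Proof.
rewrite /kernel_form mulr_sumr -big_split; apply: eq_bigr => s _.
rewrite mulr_sumr -big_split; apply: eq_bigr => t _ /=.
by rewrite /ridge; ring.
Qed.

Lemma linear_form_sqr xi (x : I -> R) :
  linear_form xi x ^+ 2 = kernel_form (fun i j => x i * x j) xi.
Proof.
rewrite /linear_form /kernel_form expr2 mulr_suml; apply: eq_bigr => s _.
by rewrite mulr_sumr; apply: eq_bigr => t _; ring.
Qed.

Lemma eq_kernel_form K K' xi : 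
  (forall i j, i \in unzip2 xi -> j \in unzip2 xi -> K i j = K' i j) ->
  kernel_form K xi = kernel_form K' xi.
Proof.
move=> KK'; apply: eq_big_seq => s sx; apply: eq_big_seq => t tx.
by rewrite KK'// (map_f snd).
Qed.

Section combination.
Variables (n : nat) (x : 'I_n -> I).
Implicit Types v : 'rV[R]_n.

Definition combination v := [seq (v 0 k, x k) | k <- enum 'I_n].

Lemma linear_form_combination v y : linear_form (combination v) y = \sum_k v 0 k * y (x k).
Proof. by rewrite /linear_form big_map big_enum. Qed.

Definition gram K := \matrix_(k, l < n) K (x k) (x l).

Lemma kernel_form_combination K v :
  kernel_form K (combination v) = (v *m gram K *m v^T) 0 0.
Proof.
rewrite /kernel_form big_map big_enum/= mxE.
transitivity (\sum_k \sum_l v 0 k * v 0 l * K (x k) (x l)).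
  by apply: eq_bigr => k _; rewrite big_map big_enum.
rewrite exchange_big; apply: eq_bigr => l _; rewrite !mxE mulr_suml.
by apply: eq_bigr => k _; rewrite !mxE; ring.
Qed.

End combination.

(** Let [E] diagonalize both Gram matrices simultaneously. The [c k] are the rows of [E]: linear
    forms that are orthonormal for the first kernel and orthogonal for the second. The [b k] are the
    columns of the inverse of [E], the dual directions. The last conclusion is a Bessel inequality:
    an evaluation at [y] that is bounded for the first norm has square-summable coefficients on the
    [c k], with the same bound [C]. *)
Lemma joint_factorization K0 K1 (e : R) (pts : seq I) :
  uniq pts -> 0 < e -> (forall i j, K0 i j = K0 j i) -> (forall i j, K1 i j = K1 j i) ->
  (forall xi, 0 <= kernel_form K0 xi) ->
  exists (b : 'I_(size pts) -> I -> R) (c : 'I_(size pts) -> seq (R * I))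
    (s : 'I_(size pts) -> R),
  [/\ forall xi, {subset unzip2 xi <= pts} ->
        kernel_form (ridge K0 e) xi = \sum_k linear_form xi (b k) ^+ 2 /\
        kernel_form (ridge K1 e) xi = \sum_k s k * linear_form xi (b k) ^+ 2,
      forall k, kernel_form (ridge K0 e) (c k) = 1 /\ kernel_form (ridge K1 e) (c k) = s k &
      forall (C : R) (y : I -> R), 0 <= C ->
        (forall xi, linear_form xi y ^+ 2 <= C * kernel_form (ridge K0 e) xi) ->
        \sum_k linear_form (c k) y ^+ 2 <= C].
Proof.
move=> upts e0 K0s K1s K0p.
pose n := size pts; pose x (k : 'I_n) := tnth (in_tuple pts) k.
have xE (k l : 'I_n) : (x k == x l) = (k == l).
  by apply/eqP/eqP => [|->//]; apply/tuple_uniqP.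
have [S0 S0E] : exists S, S = gram x (ridge K0 e) by exists (gram x (ridge K0 e)).
have [S1 S1E] : exists S, S = gram x (ridge K1 e) by exists (gram x (ridge K1 e)).
have sym K : (forall i j, K i j = K j i) -> (gram x (ridge K e))^T = gram x (ridge K e).
  by move=> Ks; apply/matrixP => k l; rewrite !mxE /ridge Ks eq_sym.
have S0s : posdefmx S0.
  split; first by rewrite S0E sym.
  move=> v v0; rewrite S0E -kernel_form_combination kernel_form_ridge.
  rewrite ltr_wpDl//  mulr_gt0// kernel_form_combination.
  rewrite (_ : gram _ _ = 1%:M); last by apply/matrixP => k l; rewrite !mxE xE.
  by rewrite mulmx1 lt_neqAle mulmx_tr_ge0 andbT eq_sym mulmx_tr_eq0.
have S1s : S1^T = S1 by rewrite S1E sym.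
have [E [s [uE ES0 ES1]]] := simultaneous_diagonalization S0s S1s.
have [G GE] : exists G, G = invmx E by exists (invmx E).
have GE1 : G *m E = 1%:M by rewrite GE mulVmx.
have EG1 : E^T *m G^T = 1%:M by rewrite -trmx_mul GE1 trmx1.
have congrE (S M : 'M[R]_n) : E *m S *m E^T = M -> S = G *m M *m G^T.
  by move=> <-; rewrite !mulmxA GE1 mul1mx -mulmxA EG1 mulmx1.
have S0G : S0 = G *m G^T.
  by rewrite [LHS](congrE _ _ ES0) mulmx1.
have S1G : S1 = G *m diag_mx s *m G^T.
  exact: (congrE _ _ ES1).
(* Moves a column of [G] from positions to points; as the points are distinct, at most one term
   survives. *)
pose b (k : 'I_n) (i : I) := \sum_(l < n | x l == i) G l k.
have bx k l : b k (x l) = G l k.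
  by rewrite /b (big_pred1 l)// => m; rewrite xE.
have ptsP i : i \in pts -> exists l, i = x l.
  by move=> /seq_tnthP[l ->]; exists l.
exists b, (fun k => combination x (row k E)), (fun k => s 0 k).
split.
- move=> xi xipts; split.
  + under eq_bigr do rewrite linear_form_sqr.
    rewrite /kernel_form [RHS]exchange_big/=; apply: eq_big_seq => u ux.
    rewrite [RHS]exchange_big/=; apply: eq_big_seq => w wx.
    have [l ul] := ptsP _ (xipts _ (map_f snd ux)).
    have [m wm] := ptsP _ (xipts _ (map_f snd wx)).
    rewrite -mulr_sumr ul wm; congr (_ * _).
    have := congr1 (fun M : 'M[R]_n => M l m) S0G; rewrite S0E !mxE => ->.
    by apply: eq_bigr => k _; rewrite !mxE !bx.
  + under eq_bigr do rewrite linear_form_sqr.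
    rewrite /kernel_form.
    under [RHS]eq_bigr do rewrite mulr_sumr.
    rewrite [RHS]exchange_big/=; apply: eq_big_seq => u ux.
    under [RHS]eq_bigr do rewrite mulr_sumr.
    rewrite [RHS]exchange_big/=; apply: eq_big_seq => w wx.
    have [l ul] := ptsP _ (xipts _ (map_f snd ux)).
    have [m wm] := ptsP _ (xipts _ (map_f snd wx)).
    under [RHS]eq_bigr do rewrite mulrCA.
    rewrite -mulr_sumr ul wm; congr (_ * _).
    have := congr1 (fun M : 'M[R]_n => M l m) S1G; rewrite S1E mxE => ->.
    rewrite mul_mx_diag mxE; apply: eq_bigr => k _.
    by rewrite !mxE !bx; ring.
- move=> k; have rE S : (row k E *m S *m (row k E)^T) 0 0 = (E *m S *m E^T) k k.
    by rewrite -row_mul !mxE; apply: eq_bigr => l _; rewrite !mxE.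
  by rewrite !kernel_form_combination -S0E -S1E !rE ES0 ES1 !mxE eqxx !mulr1n.
- move=> C y C0 yC.
  have [r rE] : exists r : 'rV[R]_n, forall k, r 0 k = linear_form (combination x (row k E)) y.
    by exists (\row_k linear_form (combination x (row k E)) y) => k; rewrite mxE.
  have SE : \sum_k linear_form (combination x (row k E)) y ^+ 2 = (r *m r^T) 0 0.
    by rewrite mxE; apply: eq_bigr => k _; rewrite mxE rE.
  (* The form with coefficients [r = (c_k (y))_k] has both value at [y] and squared norm equal to
     [S = sum_k r_k^2]; the bound on [y] then reads [S^2 <= C S]. *)
  have yr : linear_form (combination x (r *m E)) y = (r *m r^T) 0 0.
    rewrite linear_form_combination [RHS]mxE.
    under eq_bigr do rewrite mxE mulr_suml.
    rewrite exchange_big; apply: eq_bigr => k _ /=; rewrite [r^T k 0]mxE {3}(rE k).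
    rewrite linear_form_combination mulr_sumr; apply: eq_bigr => l _.
    by rewrite mxE mulrA.
  have := yC (combination x (r *m E)).
  rewrite yr kernel_form_combination -S0E.
  rewrite (_ : r *m E *m S0 *m _ = r *m r^T); last first.
    by rewrite trmx_mul -!mulmxA (mulmxA E) (mulmxA (E *m S0)) ES0 mul1mx.
  rewrite SE expr2; have := mulmx_tr_ge0 r.
  by set S := (r *m r^T) 0 0; rewrite le_eqVlt => /orP[/eqP <-//|S_gt0]; rewrite ler_pM2r.
Qed.



(** As indices may repeat in [xi], the form is the sum over distinct indices of the squared total
    coefficients. *)
Lemma kernel_form_diag_ge0 xi : 0 <= kernel_form (fun i j => (i == j)%:R) xi.
Proof.
pose pts := undup (unzip2 xi).
rewrite (@eq_kernel_form _ (fun i j => \sum_(x <- pts) (x == i)%:R * (x == j)%:R)).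
  rewrite (_ : kernel_form _ xi = \sum_(x <- pts) linear_form xi (fun i => (x == i)%:R) ^+ 2).
    by apply: sumr_ge0 => x _; rewrite sqr_ge0.
  under [RHS]eq_bigr do rewrite linear_form_sqr.
  rewrite /kernel_form [RHS]exchange_big; apply: eq_bigr => s _ /=.
  by rewrite [RHS]exchange_big; apply: eq_bigr => t _; rewrite mulr_sumr.
move=> i j ix jx; rewrite (bigD1_seq i) ?undup_uniq ?mem_undup//= eqxx mul1r.
by rewrite big1 ?addr0// => x /negbTE ->; rewrite mul0r.
Qed.

Lemma kernel_form_ridge_ge K e xi : 0 <= e -> kernel_form K xi <= kernel_form (ridge K e) xi.
Proof. by move=> e0; rewrite kernel_form_ridge lerDl mulr_ge0// kernel_form_diag_ge0. Qed.

Lemma kernel_form_ridge_le K K' (B e : R) xi : 1 <= B -> 0 <= e ->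
  kernel_form K xi <= B * kernel_form K' xi ->
  kernel_form (ridge K e) xi <= B * kernel_form (ridge K' e) xi.
Proof.
move=> B1 e0 KK'; rewrite !kernel_form_ridge mulrDr lerD//.
by rewrite ler_peMl// mulr_ge0// kernel_form_diag_ge0.
Qed.

(** The mean of a trigonometric polynomial under the centered Gaussian law of kernel [K], as given
    by the characteristic function. *)
Definition gaussian_value K (ts : trig_poly) : R :=
  \sum_(t <- ts) t.1.1 * cos t.2 * expR (- (kernel_form K t.1.2 / 2)).

End kernels.

(** * The sum of the squared variance defects *)

Section defect.
Context {R : realType} {I : eqType} {dL : measure_display} {L : measurableType dL}
  (m : {measure set L -> \bar R}) (K0 K1 : I -> I -> R)
  (J : finType) (A : J -> L -> I -> R) (W g : L -> R) (c1 C : R).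
Hypotheses (mA : forall j i, measurable_fun setT (A j ^~ i))
  (mW : measurable_fun setT W) (W_gt0 : forall l, 0 < W l)
  (mg : measurable_fun setT g) (g_ge0 : forall l, 0 <= g l)
  (c1_gt0 : 0 < c1) (C_ge0 : 0 <= C).

(** In the application the [A j] are real and imaginary parts of exponentials, so this is the
    squared norm of the vector of exponential sums; [W] is [gamma ^+ 2] and [g] dominates the
    difference of the spectral densities. *)
Definition energy (xi : seq (R * I)) (l : L) : R := \sum_j linear_form xi (A j l) ^+ 2.

Hypothesis int_energy : forall xi, m.-integrable setT (EFin \o (fun l => W l * energy xi l)).
Hypothesis energy_le : forall xi, c1 * (\int[m]_l (W l * energy xi l)) <= kernel_form K0 xi.
Hypothesis diff_le : forall xi,
  `|kernel_form K1 xi - kernel_form K0 xi| <= \int[m]_l (g l * energy xi l).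
Hypothesis pointwise_le : forall xi j l, W l * linear_form xi (A j l) ^+ 2 <= C * kernel_form K0 xi.
Hypothesis int_g : m.-integrable setT (EFin \o (fun l => (g l / W l) ^+ 2)).

Lemma energy_ge0 xi l : 0 <= energy xi l.
Proof. by apply: sumr_ge0 => j _; rewrite sqr_ge0. Qed.

Lemma measurable_energy xi : measurable_fun setT (energy xi).
Proof.
apply: measurable_sum => j; apply: measurable_funX.
by apply: measurable_sum => t; exact: measurable_funM.
Qed.

Lemma kernel_form0_ge0 xi : 0 <= kernel_form K0 xi.
Proof.
apply: le_trans (energy_le xi); rewrite mulr_ge0// ?(ltW c1_gt0)//.
by apply: Rintegral_ge0 => l _; rewrite mulr_ge0// ?energy_ge0// (ltW (W_gt0 l)).
Qed.

Let bounded_energy xi l : W l * energy xi l <= #|J|%:R * (C * kernel_form K0 xi).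
Proof.
rewrite /energy mulr_sumr (le_trans (ler_sum _ (fun j _ => pointwise_le xi j l)))//.
by rewrite sumr_const mulr_natl.
Qed.

Lemma int_weighted_energy xi :
  m.-integrable setT (EFin \o (fun l => (g l / W l) ^+ 2 * (W l * energy xi l))).
Proof.
apply: (@le_integrable_EFin _ _ _ m _ (fun l => #|J|%:R * (C * kernel_form K0 xi) * (g l / W l) ^+ 2)).
- apply: measurable_funM; last by apply: measurable_funM => //; exact: measurable_energy.
  apply: measurable_funX; apply: measurable_funM => //.
  by apply: (measurableT_comp (@measurable_inv R)).
- move=> l; have W0 := ltW (W_gt0 l).
  rewrite ger0_norm; last by rewrite mulr_ge0 ?sqr_ge0// mulr_ge0// energy_ge0.
  by rewrite mulrC ler_wpM2r// sqr_ge0.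
- exact: integrableZ_EFin.
Qed.

(** Cauchy-Schwarz for the product of [g / W * sqrt (W * energy)] and [sqrt (W * energy)]. The
    second factor contributes at most the variance over [c1]; the first keeps a weighted energy that
    can still be summed over [xi] under the integral. *)
Lemma diff_sqr_le xi : (kernel_form K1 xi - kernel_form K0 xi) ^+ 2 <=
  (\int[m]_l ((g l / W l) ^+ 2 * (W l * energy xi l))) * (c1^-1 * kernel_form K0 xi).
Proof.
pose v l := Num.sqrt (W l * energy xi l); pose u l := g l / W l * v l.
have WE0 l : 0 <= W l * energy xi l by rewrite mulr_ge0 ?energy_ge0// (ltW (W_gt0 l)).
have v2 l : v l ^+ 2 = W l * energy xi l by rewrite sqr_sqrtr.
have u2 l : u l ^+ 2 = (g l / W l) ^+ 2 * (W l * energy xi l) by rewrite exprMn v2.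
have uv l : u l * v l = g l * energy xi l.
  by rewrite /u -mulrA -expr2 v2 mulrA divfK// gt_eqF.
have mv : measurable_fun setT v.
  apply: (measurableT_comp (continuous_measurable_fun (@sqrt_continuous R))).
  by apply: measurable_funM => //; exact: measurable_energy.
have mu : measurable_fun setT u.
  apply: measurable_funM => //; apply: measurable_funM => //.
  by apply: (measurableT_comp (@measurable_inv R)).
have cs := cauchy_schwarz_Rintegral mu mv.
rewrite -real_normK ?num_real//.
apply: (@le_trans _ _ ((\int[m]_l (g l * energy xi l)) ^+ 2)).
  by rewrite lerXn2r// nnegrE ?(le_trans _ (diff_le xi)).
under [in leLHS]eq_Rintegral do rewrite -uv.
apply: (le_trans (cs m _ _)).
- by under eq_fun do rewrite u2; exact: int_weighted_energy.
- by under eq_fun do rewrite v2; exact: int_energy.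
under eq_Rintegral do rewrite u2.
under [X in _ * X]eq_Rintegral do rewrite v2.
rewrite ler_wpM2l//.
  by apply: Rintegral_ge0 => l _; rewrite mulr_ge0 ?sqr_ge0.
by rewrite ler_pdivlMl.
Qed.

(** After exchanging sum and integral, the Bessel property is applied at each [l] to the evaluation
    [sqrt (W l) * A j l], bounded by [pointwise_le]. The result is at most [C] however many forms
    there are; [#|J|] counts the features. *)
Lemma sum_diff_sqr_le (n : nat) (c : 'I_n -> seq (R * I)) (e : R) : 0 <= e ->
  (forall k, kernel_form (ridge K0 e) (c k) = 1) ->
  (forall (C : R) (y : I -> R), 0 <= C ->
    (forall xi, linear_form xi y ^+ 2 <= C * kernel_form (ridge K0 e) xi) ->
    \sum_k linear_form (c k) y ^+ 2 <= C) ->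
  \sum_k (kernel_form K1 (c k) - kernel_form K0 (c k)) ^+ 2 <=
    (#|J|%:R * C / c1) * \int[m]_l (g l / W l) ^+ 2.
Proof.
move=> e0 c_unit c_bessel.
have i0 l : 0 <= (g l / W l) ^+ 2 by rewrite sqr_ge0.
have i1 xi : 0 <= \int[m]_l ((g l / W l) ^+ 2 * (W l * energy xi l)).
  apply: Rintegral_ge0 => l _; rewrite mulr_ge0// mulr_ge0 ?energy_ge0//.
  exact: ltW.
apply: (@le_trans _ _ (\sum_k c1^-1 * \int[m]_l ((g l / W l) ^+ 2 * (W l * energy (c k) l)))).
  apply: ler_sum => k _; apply: (le_trans (diff_sqr_le _)).
  rewrite mulrC ler_wpM2r// -[leRHS]mulr1 ler_pM2l ?invr_gt0//.
  by rewrite -(c_unit k) kernel_form_ridge_ge.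
rewrite -mulr_sumr [leRHS]mulrAC [leRHS]mulrC ler_pM2l ?invr_gt0//.
rewrite -Rintegral_sum; last by move=> k; exact: int_weighted_energy.
rewrite -RintegralZl//; apply: le_Rintegral => //.
- by apply: integrable_sum_EFin => k; exact: int_weighted_energy.
- exact: integrableZ_EFin.
move=> l _; rewrite -mulr_sumr mulrC ler_wpM2r//.
rewrite /energy; under eq_bigr do rewrite mulr_sumr.
rewrite exchange_big/= mulr_natl -sumr_const.
apply: ler_sum => j _.
pose y i := Num.sqrt (W l) * A j l i.
have yE xi : linear_form xi y ^+ 2 = W l * linear_form xi (A j l) ^+ 2.
  rewrite -[in RHS](sqr_sqrtr (ltW (W_gt0 l))) -exprMn; congr (_ ^+ 2).
  by rewrite /linear_form mulr_sumr; apply: eq_bigr => t _; rewrite mulrCA.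
under eq_bigr do rewrite -yE.
apply: c_bessel => // xi; rewrite yE (le_trans (pointwise_le _ _ _))//.
by rewrite ler_wpM2l// kernel_form_ridge_ge.
Qed.

Hypotheses (K0_sym : forall i j, K0 i j = K0 j i) (K1_sym : forall i j, K1 i j = K1 j i).
Variables (B : R) (n : nat).
Hypotheses (B_ge1 : 1 <= B) (n_gt0 : (0 < n)%N) (B_le : B <= n.+1%:R / 2).
Hypothesis form1_le : forall xi, kernel_form K1 xi <= B * kernel_form K0 xi.
Hypothesis form0_le : forall xi, kernel_form K0 xi <= B * kernel_form K1 xi.

Let bound := expR (n.+1%:R ^+ 2 *
  (B ^+ 2 * ((#|J|%:R * C / c1) * \int[m]_l (g l / W l) ^+ 2)) / 2).

(** In the coordinates of [joint_factorization] the two means become [gval] with standard deviations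
    [sqrt (s k)] and 1. The comparison of the kernels gives [1 / B <= s k <= B], within reach of
    [gval_hoelder]. *)
Lemma power_comparison_ridge (e : R) ts : 0 < e -> unit_valued (@teval R I ts) ->
  gaussian_value (ridge K1 e) ts ^+ n.+1 <= bound * gaussian_value (ridge K0 e) ts.
Proof.
move=> e0 uts; pose pts := undup (flatten [seq unzip2 t.1.2 | t <- ts]).
have [b [c [s [bE cE cB]]]] :=
  joint_factorization (undup_uniq _ : uniq pts) e0 K0_sym K1_sym kernel_form0_ge0.
pose l := [seq (Num.sqrt (s k), b k) | k <- enum 'I_(size pts)].
have sB k : 1 <= B * s k /\ s k <= B.
  have [c1k <-] := cE k; split.
    by rewrite -c1k kernel_form_ridge_le// ltW.
  by rewrite -[leRHS]mulr1 -c1k kernel_form_ridge_le// ltW.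
have B0 : 0 < B by rewrite (lt_le_trans ltr01).
have s0 k : 0 < s k by have [h _] := sB k; rewrite -(pmulr_rgt0 _ B0) (lt_le_trans ltr01).
have sup t : t \in ts -> {subset unzip2 t.1.2 <= pts}.
  move=> tts i it; rewrite mem_undup; apply/flattenP; exists (unzip2 t.1.2) => //.
  exact: map_f.
have g1 : gaussian_value (ridge K1 e) ts = gval l ts.
  rewrite gvalE; apply: eq_big_seq => t tts; congr (_ * expR (- (_ / 2))).
  rewrite big_map big_enum/= (bE _ (sup t tts)).2; apply: eq_bigr => k _.
  by rewrite exprMn sqr_sqrtr ?(ltW (s0 k))// mulrC.
have g0 : gaussian_value (ridge K0 e) ts = gval (standardize l) ts.
  rewrite gvalE; apply: eq_big_seq => t tts; congr (_ * expR (- (_ / 2))).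
  rewrite /standardize -map_comp big_map big_enum/= (bE _ (sup t tts)).1.
  by apply: eq_bigr => k _; rewrite mulr1.
rewrite g0 g1; apply: (le_trans (gval_hoelder n_gt0 _ _)).
- move=> sb lsb; have [k ->] : exists k, sb = (Num.sqrt (s k), b k).
    by move: lsb; rewrite /l; elim: (enum _) => //= k r IH [<-|/IH//]; exists k.
  rewrite /=.
  rewrite sqrtr_gt0 sqr_sqrtr ?(ltW (s0 k))//; split => //.
  by rewrite (le_trans (sB k).2).
- by move=> x; have /andP[] := uts x.
have nl : nondeg (standardize l).
  by rewrite /nondeg /standardize all_map; apply/allP => sb _ /=; rewrite oner_eq0.
have gl0 : 0 <= gval (standardize l) ts.
  by apply: gval_ge0 => // x; have /andP[] := uts x.
apply: (@le_trans _ _ (bound * gval (standardize l) (tpow n.+1 ts))).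
  rewrite ler_wpM2r//.
    by apply: gval_ge0 => // x; rewrite teval_pow exprn_ge0//; have /andP[] := uts x.
  rewrite /bound ler_expR ler_wpM2r// ler_wpM2l//.
  have := sum_diff_sqr_le (ltW e0) (fun k => (cE k).1) cB.
  move=> h; rewrite (le_trans _ (ler_wpM2l _ h)) ?sqr_ge0//.
  rewrite big_map big_enum/= mulr_sumr; apply: ler_sum => k _.
  (* The regularization contributes equally to both forms and cancels. *)
  have -> : kernel_form K1 (c k) - kernel_form K0 (c k) = s k - 1.
    by have [<- <-] := cE k; rewrite !kernel_form_ridge; ring.
  rewrite sqr_sqrtr ?(ltW (s0 k))//.
  (* Passing from [1 / s - 1] to [s - 1] costs a factor [1 / s <= B], whence [B ^+ 2] in [bound]. *)
  have -> : (s k)^-1 - 1 = - ((s k)^-1 * (s k - 1)) by field; rewrite gt_eqF.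
  rewrite sqrrN exprMn ler_wpM2r ?sqr_ge0// lerXn2r ?nnegrE ?invr_ge0 ?(ltW (s0 k)) ?(ltW B0)//.
  by rewrite -[leLHS]mul1r ler_pdivrMr//; exact: (sB k).1.
(* On values in [[0, 1]] a power with positive exponent is at most its base. *)
rewrite ler_wpM2l ?expR_ge0//; apply: gval_le => // x.
rewrite teval_pow; have /andP[u0 u1] := uts x.
by rewrite exprS ler_piMr// exprn_ile1.
Qed.

Lemma power_comparison ts : unit_valued (@teval R I ts) ->
  gaussian_value K1 ts ^+ n.+1 <= bound * gaussian_value K0 ts.
Proof.
move=> uts.
have cont K : gaussian_value (ridge K e) ts @[e --> 0^'+] --> gaussian_value K ts.
  rewrite /gaussian_value; apply: cvg_big => [|t _]; first exact: add_continuous.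
  apply: cvgM; first exact: cvg_cst.
  apply: (cvg_comp _ expR); last exact: continuous_expR.
  apply: cvgN; apply: cvgM; last exact: cvg_cst.
  rewrite (_ : (fun e => _) = (fun e => kernel_form K t.1.2 +
      e * kernel_form (fun i j => (i == j)%:R) t.1.2)); last first.
    by apply/funext => e; rewrite kernel_form_ridge.
  rewrite -[X in _ --> X]addr0; apply: cvgD; first exact: cvg_cst.
  rewrite -[X in _ --> X](mul0r (kernel_form (fun i j => (i == j)%:R) t.1.2)).
  by apply: cvgM; [exact: cvg_within|exact: cvg_cst].
have c1' : gaussian_value (ridge K1 e) ts ^+ n.+1 @[e --> 0^'+] --> gaussian_value K1 ts ^+ n.+1.
  apply: (cvg_comp _ (fun x : R => x ^+ n.+1)); last exact: exprn_continuous.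
  exact: cont.
have c0' : bound * gaussian_value (ridge K0 e) ts @[e --> 0^'+] --> bound * gaussian_value K0 ts.
  by apply: cvgM; [exact: cvg_cst|exact: cont].
apply: (ler_cvg_to c1' c0').
by near=> e; apply: power_comparison_ridge.
Unshelve. all: by end_near. Qed.

End defect.

(** * Gaussian fields *)

Section moments.
Context {R : realType} {I : eqType} {dO : measure_display} {Omega : measurableType dO}
  (P : probability Omega R) (Z : I -> {mfun Omega >-> R}) (K : I -> I -> R).
Hypotheses (Z_mean : forall i, ('E_P[Z i] = 0)%E)
  (Z_cov : forall i j, covariance P (Z i) (Z j) = (K i j)%:E).

Lemma covariance_kernel_sym i j : K i j = K j i.
Proof. by apply: EFin_inj; rewrite -!Z_cov covarianceC. Qed.

Lemma integral_mul_field i j : (\int[P]_w (Z i w * Z j w)%:E = (K i j)%:E)%E.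
Proof.
rewrite -Z_cov [in RHS]unlock !Z_mean/= unlock; apply: eq_integral => w _ /=.
by rewrite [RHS](_ : _ = ((Z i w - 0) * (Z j w - 0))%:E)// !subr0.
Qed.

(** Read off the covariance hypothesis: the integral of a nonnegative function equals the real
    number [K i i]. *)
Lemma integrable_field_sqr i : P.-integrable setT (EFin \o (fun w => Z i w ^+ 2)).
Proof.
apply/integrableP; split.
  by apply/measurable_EFinP; exact: measurable_funX.
rewrite (eq_integral (fun w => (Z i w * Z i w)%:E)).
  by rewrite integral_mul_field ltry.
by move=> w _; rewrite -expr2 gee0_abs// lee_fin sqr_ge0.
Qed.

Lemma integrable_field i : P.-integrable setT (EFin \o Z i).
Proof.
apply: (@le_integrable_EFin _ _ _ P _ (fun w => 1 + Z i w ^+ 2)) => //.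
  by move=> w; have := real_normK (num_real (Z i w)); have := normr_ge0 (Z i w); nra.
apply: integrableD_EFin; last exact: integrable_field_sqr.
exact: finite_measure_integrable_cst.
Qed.

Lemma integrable_field_mul i j : P.-integrable setT (EFin \o (fun w => Z i w * Z j w)).
Proof. by apply: integrable_mul_sqr => //; exact: integrable_field_sqr. Qed.

Lemma Rintegral_linear_form xi : \int[P]_w linear_form xi (Z ^~ w) = 0.
Proof.
rewrite /linear_form Rintegral_sum => [|t]; last first.
  by apply: integrableZ_EFin; exact: integrable_field.
rewrite big1// => t _; rewrite RintegralZl//; last exact: integrable_field.
by have := Z_mean t.2; rewrite unlock /Rintegral => -> /=; rewrite mulr0.
Qed.

Lemma linear_form_sqr_field xi w : linear_form xi (Z ^~ w) ^+ 2 =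
  \sum_(s <- xi) \sum_(t <- xi) s.1 * t.1 * (Z s.2 w * Z t.2 w).
Proof. exact: linear_form_sqr. Qed.

Lemma integrable_linear_form_sqr xi :
  P.-integrable setT (EFin \o (fun w => linear_form xi (Z ^~ w) ^+ 2)).
Proof.
under eq_fun do rewrite linear_form_sqr_field.
apply: integrable_sum_EFin => s; apply: integrable_sum_EFin => t.
by apply: integrableZ_EFin; exact: integrable_field_mul.
Qed.

Lemma Rintegral_linear_form_sqr xi :
  \int[P]_w (linear_form xi (Z ^~ w) ^+ 2) = kernel_form K xi.
Proof.
under eq_Rintegral do rewrite linear_form_sqr_field.
rewrite Rintegral_sum => [|s]; last first.
  by apply: integrable_sum_EFin => t; apply: integrableZ_EFin; exact: integrable_field_mul.
apply: eq_bigr => s _; rewrite Rintegral_sum => [|t]; last first.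
  by apply: integrableZ_EFin; exact: integrable_field_mul.
apply: eq_bigr => t _; rewrite RintegralZl//; last exact: integrable_field_mul.
by rewrite {1}/Rintegral integral_mul_field.
Qed.

Lemma measurable_linear_form_field xi : measurable_fun setT (fun w => linear_form xi (Z ^~ w)).
Proof. by apply: measurable_sum => t; exact: measurable_funM. Qed.

Hypothesis Z_gaussian : forall xi, gaussian_rv P (fun w => linear_form xi (Z ^~ w)).

Lemma Rintegral_cos_linear_form xi (phi : R) :
  \int[P]_w cos (linear_form xi (Z ^~ w) + phi) =
  cos phi * expR (- (kernel_form K xi / 2)).
Proof.
have [mm [s ms]] := Z_gaussian xi.
pose Y : Omega -> measurableTypeR R := fun w => linear_form xi (Z ^~ w).
have mY : measurable_fun setT Y := measurable_linear_form_field xi.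
pose Y' : {mfun Omega >-> measurableTypeR R} := HB.pack Y (isMeasurableFun.Build _ _ _ _ Y mY).
apply: (@gaussian_centered_characteristic _ _ _ P Y' mm s) => //.
- exact: integrable_linear_form_sqr.
- exact: Rintegral_linear_form.
- exact: Rintegral_linear_form_sqr.
Qed.

Lemma Rintegral_teval ts : \int[P]_w teval ts (Z ^~ w) = gaussian_value K ts.
Proof.
rewrite /teval Rintegral_sum => [|t].
  apply: eq_bigr => t _; rewrite RintegralZl//.
    by rewrite Rintegral_cos_linear_form mulrA.
  apply: (@integrable_bounded _ _ _ P _ 1).
    apply: (measurableT_comp (@measurable_cos R)); apply: measurable_funD => //.
    exact: measurable_linear_form_field.
  by move=> w; exact: cos_max.
apply: integrableZ_EFin; apply: (@integrable_bounded _ _ _ P _ 1).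
  apply: (measurableT_comp (@measurable_cos R)); apply: measurable_funD => //.
  exact: measurable_linear_form_field.
by move=> w; exact: cos_max.
Qed.

End moments.

(** * Spectral representation *)

Section hermitian_form.
Local Open Scope sesquilinear_scope.
Context {R : realType} {p : nat}.
Implicit Types (N : 'M[R[i]]_p) (u : 'cV[R[i]]_p).

Definition hermitian_form N u : R[i] := (u ^t* *m N *m u) 0 0.

Definition cnorm2 u : R := \sum_i cmod (u i 0) ^+ 2.

Lemma hermitian_formE N u :
  hermitian_form N u = \sum_i \sum_j (u i 0)^* * N i j * u j 0.
Proof.
rewrite /hermitian_form mxE exchange_big; apply: eq_bigr => j _ /=.
by rewrite !mxE mulr_suml; apply: eq_bigr => i _; rewrite !mxE.
Qed.

Lemma cmod_ge0 (z : R[i]) : 0 <= cmod z.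
Proof. by rewrite cmodE sqrtr_ge0. Qed.

Lemma cmodM (z w : R[i]) : cmod (z * w) = cmod z * cmod w.
Proof. by apply/complexI; rewrite rmorphM/= !cmodC normrM. Qed.

Lemma norm_Re_le_cmod (z : R[i]) : `|complex.Re z| <= cmod z.
Proof. by rewrite cmodE -sqrtr_sqr ler_sqrt ?addr_ge0 ?sqr_ge0// lerDl sqr_ge0. Qed.

Lemma hermitian_form_scalar (c : R) u :
  hermitian_form c%:C%:M u = (c * cnorm2 u)%:C.
Proof.
rewrite /hermitian_form -scalemx1 -scalemxAr mulmx1 -scalemxAl mxE rmorphM/=; congr (_ * _).
rewrite mxE rmorph_sum/=; apply: eq_bigr => i _.
by rewrite !mxE mulrC -normCK rmorphXn/= cmodC.
Qed.

Lemma hermitian_formB N N' u :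
  hermitian_form (N - N') u = hermitian_form N u - hermitian_form N' u.
Proof. by rewrite /hermitian_form mulmxBr mulmxBl mxE; congr (_ + _); rewrite mxE. Qed.

Lemma loewner_le_hermitian_form N N' u : loewner_le N N' ->
  complex.Re (hermitian_form N u) <= complex.Re (hermitian_form N' u).
Proof. by move=> /(_ u); rewrite lecE => /andP[]. Qed.

Lemma norm_hermitian_form_le N u :
  `|complex.Re (hermitian_form N u)| <= (\sum_i \sum_j cmod (N i j)) * cnorm2 u.
Proof.
apply: (le_trans (norm_Re_le_cmod _)); rewrite -lecR cmodC hermitian_formE.
apply: (le_trans (ler_norm_sum _ _ _)); rewrite mulr_suml rmorph_sum/=.
apply: ler_sum => i _; apply: (le_trans (ler_norm_sum _ _ _)).
rewrite mulr_suml rmorph_sum/=; apply: ler_sum => j _.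
rewrite !normrM norm_conjC -!cmodC -!rmorphM/= lecR mulrAC mulrC.
rewrite ler_wpM2l ?cmod_ge0//.
have le i' : cmod (u i' 0) ^+ 2 <= cnorm2 u.
  by rewrite /cnorm2 (bigD1 i')//= lerDl sumr_ge0// => k _; rewrite sqr_ge0.
by have := le i; have := le j; have := sqr_ge0 (cmod (u i 0) - cmod (u j 0)); nra.
Qed.

End hermitian_form.

Section features.
Context {R : realType} {d p : nat} {D : set 'rV[R]_d}.
Notation I := (D * 'I_p)%type.
Implicit Types (xi : seq (R * I)) (l : 'rV[R]_d).

Definition covariance_kernel (C : 'rV[R]_d -> 'M[R]_p) (i j : I) : R :=
  C (set_val i.1 - set_val j.1) i.2 j.2.

Definition phase (b : bool) : R := if b then pi / 2 else 0.

(** Since [cos (x + pi / 2) = - sin x], the two values of the boolean give the real and imaginary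
    parts of the exponential of [- dotv (set_val i.1) l], in component [bj.2]. *)
Definition feature (bj : bool * 'I_p) l (i : I) : R :=
  (i.2 == bj.2)%:R * cos (dotv (set_val i.1) l + phase bj.1).

Definition feature_vector xi l : 'cV[R[i]]_p :=
  \col_j (linear_form xi (feature (false, j) l) +i* linear_form xi (feature (true, j) l)).

Lemma energy_featureE xi l : energy feature xi l = cnorm2 (feature_vector xi l).
Proof.
rewrite /energy /cnorm2.
rewrite -(pair_bigA _ (fun b j => linear_form xi (feature (b, j) l) ^+ 2))/=.
rewrite big_bool/= -big_split; apply: eq_bigr => j _ /=.
by rewrite mxE cmodE/= sqr_sqrtr 1?addrC// addr_ge0 ?sqr_ge0.
Qed.

Lemma dotvBl (x y l : 'rV[R]_d) : dotv (x - y) l = dotv x l - dotv y l.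
Proof. by rewrite !dotvE -sumrB; apply: eq_bigr => j _; rewrite !mxE mulrBl. Qed.

Lemma feature_vectorE xi l j : feature_vector xi l j 0 =
  \sum_(s <- xi) (s.1 * (s.2.2 == j)%:R)%:C * cexpi (- dotv (set_val s.2.1) l).
Proof.
rewrite mxE /linear_form; elim: xi => [|s xi IH]; first by rewrite !big_nil.
rewrite !big_cons -IH; apply/eqP; rewrite eq_complex/= /feature/= addr0 cosN sinN.
rewrite cosDpihalf !mul0r subr0 addr0 !mulrN !mulrA.
by rewrite !eqxx.
Qed.

Lemma cexpiD (x y : R) : cexpi (x + y) = cexpi x * cexpi y :> R[i].
Proof. by rewrite /cexpi cosD sinD; apply/eqP; rewrite eq_complex/= eqxx addrC eqxx. Qed.

(** Conjugating one of the two exponential sums merges the exponentials into one at the difference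
    of the points, as in the spectral formula for the covariance. *)
Lemma hermitian_form_feature (N : 'M[R[i]]_p) xi l :
  hermitian_form N (feature_vector xi l) = \sum_(s <- xi) \sum_(t <- xi)
    (s.1 * t.1)%:C * (N s.2.2 t.2.2 * cexpi (dotv (set_val s.2.1 - set_val t.2.1) l)).
Proof.
rewrite hermitian_formE.
under eq_bigr => i _ do under eq_bigr => j _ do
  rewrite !feature_vectorE rmorph_sum/= mulr_suml mulr_suml.
under eq_bigr => i _ do rewrite exchange_big/=.
rewrite exchange_big/=; apply: eq_bigr => s _.
under eq_bigr => i _ do under eq_bigr => j _ do rewrite mulr_sumr.
under eq_bigr => i _ do rewrite exchange_big/=.
rewrite exchange_big/=; apply: eq_bigr => t _.
rewrite (bigD1 s.2.2)//= (bigD1 t.2.2)//= !eqxx !mulr1.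
rewrite big1 => [|j jt]; last first.
  by rewrite [t.2.2 == j]eq_sym (negbTE jt) mulr0 mul0r mulr0.
rewrite addr0 big1 => [|i is_]; last first.
  by rewrite big1// => j _; rewrite [s.2.2 == i]eq_sym (negbTE is_) mulr0 mul0r rmorph0 !mul0r.
rewrite addr0 [X in X * N _ _](_ : _ = s.1%:C * cexpi (dotv (set_val s.2.1) l)).
  by rewrite rmorphM/= dotvBl cexpiD; ring.
by rewrite /cexpi cosN sinN; apply/eqP; rewrite eq_complex/=; apply/andP; split; apply/eqP; ring.
Qed.

End features.

Section cexpi.
Context {R : realType} {d : nat}.
Implicit Types (g : 'rV[R]_d -> R[i]) (f : 'rV[R]_d -> R).

Lemma measurable_dotvr (h : 'rV[R]_d) : measurable_fun setT (dotv h).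
Proof.
rewrite (_ : dotv h = (fun l => \sum_j h ord0 j * l ord0 j)).
  by apply: measurable_sum => j; apply: measurable_funM => //; exact: measurable_coord.
by apply/funext => l; rewrite dotvE.
Qed.

Lemma measurable_Re_mul_cexpi g f : cmeasurable g -> measurable_fun setT f ->
  measurable_fun setT (fun l => complex.Re (g l * cexpi (f l))).
Proof.
move=> [mRe mIm] mf.
rewrite (_ : (fun l => _) = (fun l => complex.Re (g l) * cos (f l) -
    complex.Im (g l) * sin (f l))).
  apply: measurable_funB; apply: measurable_funM => //.
    exact: (measurableT_comp (@measurable_cos R)).
  exact: (measurableT_comp (@measurable_sin R)).
by apply/funext => l; case: (g l).
Qed.

Lemma norm_Re_mul_cexpi_le (z : R[i]) (t : R) : `|complex.Re (z * cexpi t)| <= cmod z.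
Proof.
rewrite (le_trans (norm_Re_le_cmod _))// cmodM [X in _ * X]cmodE.
by rewrite cos2Dsin2 sqrtr1 mulr1.
Qed.

End cexpi.

Section spectral_representation.
Context {R : realType} {d p : nat} {D : set 'rV[R]_d}
  {C : 'rV[R]_d -> 'M[R]_p} {F : 'rV[R]_d -> 'M[R[i]]_p}.
Hypothesis sd : matrix_spectral_density C F.
Notation mu := (lebesgue_rV d : {measure set 'rV[R]_d -> \bar R}).
Notation I := (D * 'I_p)%type.
Implicit Types (xi : seq (R * I)) (l : 'rV[R]_d).

Let mF i j : cmeasurable (fun l => F l i j).
Proof. by case: sd => _ /(_ i j)[]. Qed.

Lemma integrable_spectral h i j :
  mu.-integrable setT (EFin \o (fun l => complex.Re (F l i j * cexpi (dotv h l)))).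
Proof.
have [mRe mIm] := mF i j; have [_ /(_ i j)[_ iF] _ _ _] := sd.
apply: (@le_integrable_EFin _ _ _ mu _ (fun l => cmod (F l i j))) => //.
  by apply: measurable_Re_mul_cexpi => //; exact: measurable_dotvr.
by move=> l; rewrite norm_Re_mul_cexpi_le.
Qed.

Lemma Re_sum (T : Type) (r : seq T) (f : T -> R[i]) :
  complex.Re (\sum_(t <- r) f t) = \sum_(t <- r) complex.Re (f t).
Proof.
elim: r => [|t r IH]; first by rewrite !big_nil.
by rewrite !big_cons -IH; case: (f t); case: (\sum_(_ <- _) _).
Qed.

Lemma Re_hermitian_form_feature (N : 'M[R[i]]_p) xi l :
  complex.Re (hermitian_form N (feature_vector xi l)) = \sum_(s <- xi) \sum_(t <- xi)
    s.1 * t.1 * complex.Re (N s.2.2 t.2.2 * cexpi (dotv (set_val s.2.1 - set_val t.2.1) l)).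
Proof.
rewrite hermitian_form_feature Re_sum; apply: eq_bigr => s _.
rewrite Re_sum; apply: eq_bigr => t _.
by case: (_ * cexpi _) => a b /=; rewrite mul0r subr0.
Qed.

Lemma integrable_hermitian_form_feature xi : mu.-integrable setT
  (EFin \o (fun l => complex.Re (hermitian_form (F l) (feature_vector xi l)))).
Proof.
under eq_fun do rewrite Re_hermitian_form_feature.
apply: integrable_sum_EFin => s; apply: integrable_sum_EFin => t.
by apply: integrableZ_EFin; exact: integrable_spectral.
Qed.

Lemma kernel_form_spectral xi : kernel_form (covariance_kernel C) xi =
  \int[mu]_l complex.Re (hermitian_form (F l) (feature_vector xi l)).
Proof.
under eq_Rintegral do rewrite Re_hermitian_form_feature.
rewrite Rintegral_sum => [|s]; last first.
  by apply: integrable_sum_EFin => t; apply: integrableZ_EFin; exact: integrable_spectral.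
apply: eq_bigr => s _; rewrite Rintegral_sum => [|t]; last first.
  by apply: integrableZ_EFin; exact: integrable_spectral.
apply: eq_bigr => t _; rewrite RintegralZl//; last exact: integrable_spectral.
congr (_ * _); have [_ _ _ _ CF] := sd.
by rewrite /covariance_kernel; have := congr1 (@complex.Re R) (CF (set_val s.2.1 - set_val t.2.1) s.2.2 t.2.2).
Qed.

End spectral_representation.

(** * The function [gamma] and its products with exponential sums *)

Section band_limited.
Context {R : realType} {d : nat}.
Notation mu := (lebesgue_rV d : {measure set 'rV[R]_d -> \bar R}).

Lemma measurable_cube (b : R) : measurable (cube b : set 'rV[R]_d).
Proof.
rewrite (_ : cube b = \bigcap_(i in [set: 'I_d])
    ((fun v : 'rV[R]_d => v ord0 i) @^-1` `[- b, b]%classic)).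
  apply: fin_bigcap_measurable => // i _.
  by rewrite -[X in measurable X]setTI; exact: measurable_coord.
apply/seteqP; split => v /= H i; first by move=> _; rewrite /preimage/= in_itv/=; exact: H.
by have := H i I; rewrite /preimage/= in_itv.
Qed.

Lemma integrable_indic_cube (b : R) : 0 <= b ->
  mu.-integrable setT (EFin \o (\1_(cube b) : 'rV[R]_d -> R)).
Proof.
move=> b0.
have finite_cube : (lebesgue_rV d (cube b : set 'rV[R]_d) < +oo)%E.
  rewrite (_ : cube b = [set v | forall i, (const_mx (- b) : 'rV[R]_d) ord0 i <= v ord0 i
      <= (const_mx b : 'rV[R]_d) ord0 i]).
    by rewrite lebesgue_rV_box ?ltry// => i; rewrite !mxE; lra.
  by apply/seteqP; split => v /= H i; have := H i; rewrite !mxE.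
apply/integrableP; split.
  by apply/measurable_EFinP; apply: measurable_indic; exact: measurable_cube.
rewrite (eq_integral (fun v => (\1_(cube b) v)%:E)).
  by rewrite integral_indic ?setIT//; exact: measurable_cube.
by move=> v _; rewrite [RHS]/= gee0_abs// lee_fin.
Qed.

(** On the cube, which has finite measure, [|g| <= 1 + |g|^2]. *)
Lemma integrable_square_summable (b : R) (f : 'rV[R]_d -> R) (g : 'rV[R]_d -> R[i]) :
  0 <= b -> csquare_summable g -> (forall x, ~ cube b x -> g x = 0) ->
  measurable_fun setT f -> (forall x, `|f x| <= cmod (g x)) ->
  mu.-integrable setT (EFin \o f).
Proof.
move=> b0 [_ g2] g0 mf fg.
apply: (@le_integrable_EFin _ _ _ mu _ (fun x => \1_(cube b) x + cmod (g x) ^+ 2)) => //.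
  move=> x; apply: (le_trans (fg x)); rewrite indicE.
  case: (boolP (x \in cube b)) => [_|/negP xb]; last first.
    rewrite g0; last by move=> xb'; apply: xb; rewrite inE.
    by rewrite cmodE/= expr0n addr0 sqrtr0 expr0n addr0.
  by rewrite /= mulr1n; have := sqr_ge0 (cmod (g x) - 1); have := cmod_ge0 (g x); nra.
by apply: integrableD_EFin => //; exact: integrable_indic_cube.
Qed.

Definition quadrature (e : bool) : R := if e then - (pi / 2) else 0.

(** As [gamma] is real, it equals the real part of the Fourier integral: [Re g] against a cosine
    plus [Im g] against a sine, the latter being a cosine with phase [- pi / 2]. *)
Lemma band_limited_cosine (b : R) (g : 'rV[R]_d -> R[i]) (gamma : 'rV[R]_d -> R) :
  0 <= b -> csquare_summable g -> (forall x, ~ cube b x -> g x = 0) ->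
  (forall l, (gamma l)%:C = fourier g l) ->
  exists a : bool -> 'rV[R]_d -> R,
  [/\ forall e, mu.-integrable setT (EFin \o a e),
      forall e t, ~ cube b t -> a e t = 0 &
      forall l, gamma l = \sum_(e : bool) \int[mu]_t (a e t * cos (dotv l t + quadrature e))].
Proof.
move=> b0 sg g0 gE; have [[mRe mIm] _] := sg.
pose k : R := (2 * pi) ^- d.
pose a (e : bool) t := k * if e then complex.Im (g t) else complex.Re (g t).
have ia e : mu.-integrable setT (EFin \o a e).
  apply: integrableZ_EFin; apply: (integrable_square_summable b0 sg g0).
    by case: e.
  move=> x; case: e; last exact: norm_Re_le_cmod.
  by rewrite cmodE -sqrtr_sqr ler_sqrt ?addr_ge0 ?sqr_ge0// lerDr sqr_ge0.
have mdot l : measurable_fun setT (fun t : 'rV[R]_d => dotv l t) by exact: measurable_dotvr.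
have iac e l : mu.-integrable setT (EFin \o (fun t => a e t * cos (dotv l t + quadrature e))).
  apply: (@le_integrable_EFin _ _ _ mu _ (fun t => `|a e t|)).
  - apply: measurable_funM; first exact: integrable_measurable (ia e).
    by apply: (measurableT_comp (@measurable_cos R)); exact: measurable_funD.
  - by move=> t; rewrite normrM ler_piMr// cos_max.
  - exact: integrable_norm (ia e).
exists a; split => // [e t tb|l]; first by rewrite /a (g0 _ tb)/= if_same mulr0.
rewrite big_bool/= -RintegralD//.
have := congr1 (@complex.Re R) (gE l) => /= ->.
rewrite mul0r subr0 -RintegralZl//; last first.
  apply: (integrable_square_summable b0 sg g0) => [|x]; last exact: norm_Re_mul_cexpi_le.
  apply: measurable_Re_mul_cexpi; first by split.
  apply: measurable_funN; exact: measurable_dotvr.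
apply: eq_Rintegral => t _; rewrite /a /quadrature addr0 /cexpi cosN sinN.
rewrite cosB cos_pihalf sin_pihalf mulr0 mulr1 add0r.
by case: (g t) => x y /=; rewrite /k; ring.
Qed.

End band_limited.

Section pointwise_bound.
Context {R : realType} {d p : nat} {D : set 'rV[R]_d}.
Notation mu := (lebesgue_rV d : {measure set 'rV[R]_d -> \bar R}).
Notation I := (D * 'I_p)%type.
Variables (b B : R) (a : bool -> 'rV[R]_d -> R) (gamma : 'rV[R]_d -> R).
Hypotheses (b_gt0 : 0 < b) (B_ge0 : 0 <= B)
  (int_a : forall e, mu.-integrable setT (EFin \o a e))
  (a_cube : forall e t, ~ cube b t -> a e t = 0)
  (gammaE : forall l, gamma l =
    \sum_(e : bool) \int[mu]_t (a e t * cos (dotv l t + quadrature e)))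
  (DB : forall (x : D) j, `|set_val x ord0 j| <= B).

(** Labels the terms of [gamma] times an exponential sum: the term of the sum, the quadrature
    component of [gamma], and the sign in [cos P cos Q = (cos (P - Q) + cos (P + Q)) / 2]. *)
Let index := (R * I * bool * bool)%type.
Let amplitude (j : 'I_p) (i : index) t : R :=
  a i.1.2 t * (i.1.1.1 * (i.1.1.2.2 == j)%:R / 2).
Let sgn (e : bool) : R := if e then 1 else -1.
Let shift (i : index) t : 'rV[R]_d := t + sgn i.2 *: set_val i.1.1.2.1.
Let offset (e : bool) (i : index) (t : 'rV[R]_d) : R := quadrature i.1.2 + sgn i.2 * phase e.
Let expand (xi : seq (R * I)) : seq index :=
  flatten [seq [:: (t, false, false); (t, false, true); (t, true, false); (t, true, true)] | t <- xi].

Lemma measurable_gamma : measurable_fun setT gamma.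
Proof.
rewrite (_ : gamma = cosine_transform (lebesgue_rV d) (index_enum bool) a
   (fun e _ => quadrature e) (fun _ t => t)).
  apply: measurable_cosine_transform => [e|e|e j].
  - exact: integrable_measurable (int_a e).
  - exact: measurable_cst.
  - exact: measurable_coord.
exact/funext.
Qed.

(** Multiplying by a cosine whose frequency is a point of [D] shifts the amplitude by plus or minus
    that point. The product is thus again a cosine transform, with frequencies in the cube of
    half-side [b + B]. *)
Lemma gamma_featureE e j (xi : seq (R * I)) l : gamma l * linear_form xi (feature (e, j) l) =
  cosine_transform (lebesgue_rV d) (expand xi) (amplitude j) (offset e) shift l.
Proof.
rewrite /cosine_transform /expand big_flatten big_map /linear_form mulr_sumr.
apply: eq_bigr => t _; rewrite !big_cons big_nil [RHS]/= addr0 gammaE big_bool.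
rewrite -[LHS]/((_ + _) * _).
have ic e' (h : 'rV[R]_d) (c : R) :
    mu.-integrable setT (EFin \o (fun x => a e' x * cos (dotv l (x + h) + c))).
  apply: (@le_integrable_EFin _ _ _ mu _ (fun x => `|a e' x|)).
  - apply: measurable_funM; first exact: integrable_measurable (int_a e').
    apply: (measurableT_comp (@measurable_cos R)); apply: measurable_funD => //.
    apply: measurable_dotv => // j'.
    under eq_fun do rewrite mxE.
    by apply: measurable_funD => //; exact: measurable_coord.
  - by move=> x; rewrite normrM ler_piMr// cos_max.
  - exact: integrable_norm (int_a e').
have key e' : \int[mu]_x (a e' x * cos (dotv l x + quadrature e')) *
    (t.1 * feature (e, j) l t.2) =
    \int[mu]_x (amplitude j (t, e', false) x * cos (dotv l (shift (t, e', false) x) +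
      offset e (t, e', false) x)) +
    \int[mu]_x (amplitude j (t, e', true) x * cos (dotv l (shift (t, e', true) x) +
      offset e (t, e', true) x)).
  pose k := t.1 * (t.2.2 == j)%:R / 2.
  have aE s x : amplitude j (t, e', s) x * cos (dotv l (shift (t, e', s) x) +
      offset e (t, e', s) x) = k * (a e' x * cos (dotv l (x + sgn s *: set_val t.2.1) +
      (quadrature e' + sgn s * phase e))).
    by rewrite /amplitude /k /shift /offset/=; ring.
  under [X in _ = X + _]eq_Rintegral do rewrite aE.
  under [X in _ = _ + X]eq_Rintegral do rewrite aE.
  rewrite -RintegralD//; try by apply: integrableZ_EFin; exact: ic.
  have i0 := ic e' 0 (quadrature e').
  rewrite -RintegralZr//; last first.
    by move: i0; under eq_fun do rewrite addr0.
  apply: eq_Rintegral => x _.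
  have dotvD s : dotv l (x + sgn s *: set_val t.2.1) = dotv l x + sgn s * dotv (set_val t.2.1) l.
    rewrite !dotvE mulr_sumr -big_split; apply: eq_bigr => i _ /=.
    by rewrite !mxE; ring.
  rewrite !dotvD /feature /k /sgn/= !mulN1r !mul1r.
  set X := dotv l x; set Y := dotv _ l; set u := quadrature e'; set v := phase e.
  have -> : X - Y + (u - v) = (X + u) - (Y + v) by ring.
  have -> : X + Y + (u + v) = (X + u) + (Y + v) by ring.
  by move: (X + u) (Y + v) => P Q; rewrite cosB cosD; field.
rewrite mulrDl key key; ring.
Qed.

Lemma gamma_feature_le e j (xi : seq (R * I)) l (E : R) :
  mu.-integrable setT (EFin \o (fun l => (gamma l * linear_form xi (feature (e, j) l)) ^+ 2)) ->
  \int[mu]_l ((gamma l * linear_form xi (feature (e, j) l)) ^+ 2) <= E ->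
  (gamma l * linear_form xi (feature (e, j) l)) ^+ 2 <= pw_constant (b + B) ^+ d * E.
Proof.
move=> ifo fE; have b_B : 0 < b + B by rewrite ltr_pwDl.
have c0 : 0 <= pw_constant (b + B) ^+ d by rewrite exprn_ge0// ltW// pw_constant_gt0.
have fineI : (\int[mu]_l ((gamma l * linear_form xi (feature (e, j) l)) ^+ 2)%:E =
    (\int[mu]_l ((gamma l * linear_form xi (feature (e, j) l)) ^+ 2))%:E)%E.
  by rewrite /Rintegral fineK//; exact: integrable_fin_num.
rewrite -lee_fin; apply: (@le_trans _ _ ((pw_constant (b + B) ^+ d)%:E *
    \int[mu]_l ((gamma l * linear_form xi (feature (e, j) l)) ^+ 2)%:E)%E); last first.
  by rewrite fineI -EFinM lee_fin ler_wpM2l.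
under eq_integral do rewrite gamma_featureE.
rewrite gamma_featureE; apply: paley_wiener => //.
- move=> i; rewrite (_ : amplitude j i = fun t => (i.1.1.1 * (i.1.1.2.2 == j)%:R / 2) * a i.1.2 t).
  2: by apply/funext => t; rewrite /amplitude mulrC.
  by apply: integrableZ_EFin; exact: int_a.
- move=> i; exact: measurable_cst.
- move=> i j'; rewrite /shift; under eq_fun do rewrite !mxE.
  by apply: measurable_funD => //; exact: measurable_coord.
- move=> i x j' ax; rewrite /shift !mxE (le_trans (ler_normD _ _))// lerD//.
    have xb : cube b x.
      apply: contrapT => /a_cube xb; move: ax; rewrite /amplitude xb.
      by rewrite mul0r eqxx.
    by rewrite ler_norml.
  rewrite normrM /sgn; case: ifP => _; rewrite ?normrN1 ?normr1 mul1r; exact: DB.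
Qed.

End pointwise_bound.

(** * Absolute continuity *)

(** Meant for the integrand with [opnorm], whose measurability is not established here: as a
    supremum over simple functions below the integrand, the integral is monotone anyway. *)
Lemma ge0_le_integral_nonmeasurable d (T : measurableType d) (R : realType)
    (m : {measure set T -> \bar R}) (f g : T -> \bar R) :
  (forall x, 0 <= f x)%E -> (forall x, f x <= g x)%E ->
  (\int[m]_x f x <= \int[m]_x g x)%E.
Proof.
move=> f0 fg; have g0 x : (0 <= g x)%E by exact: le_trans (f0 x) (fg x).
rewrite (ge0_integralTE _ f0) (ge0_integralTE _ g0).
apply: ereal_sup_le => _ [h hf <-]; exists h => // x; exact: le_trans (hf x) (fg x).
Qed.

Lemma norm_entry_le (R : realType) n (x : 'rV[R]_n) j : `|x ord0 j| <= `|x|.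
Proof.
rewrite [leRHS](mx_normrE x : _ = _).
exact: (le_bigmax _ (fun i : 'I_1 * 'I_n => `|x i.1 i.2|) (ord0, j)).
Qed.

Section absolute_continuity.
Context {R : realType} {d p : nat} {D : set 'rV[R]_d}
  {dO : measure_display} {Omega : measurableType dO}
  {Z : D -> 'I_p -> {mfun Omega >-> R}}
  {C0 C1 : 'rV[R]_d -> 'M[R]_p} {F0 F1 : 'rV[R]_d -> 'M[R[i]]_p}
  {P0 P1 : probability Omega R} {c1 c2 b : R} {gamma : 'rV[R]_d -> R}.
Hypotheses (p_gt0 : (0 < p)%N) (D_bounded : bounded_set D)
  (sd0 : matrix_spectral_density C0 F0) (sd1 : matrix_spectral_density C1 F1)
  (gauss0 : centered_gaussian Z P0 C0) (gauss1 : centered_gaussian Z P1 C1)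
  (c1_gt0 : 0 < c1) (c1_le_c2 : c1 <= c2) (b_gt0 : 0 < b)
  (gammaW : Wspace (cube b) (fun l => const_mx (gamma l)%:C : 'cV[R[i]]_p))
  (bounds0 : forall l, loewner_le (c1 * gamma l ^+ 2)%:C%:M (F0 l) /\
                       loewner_le (F0 l) (c2 * gamma l ^+ 2)%:C%:M)
  (bounds1 : forall l, loewner_le (c1 * gamma l ^+ 2)%:C%:M (F1 l) /\
                       loewner_le (F1 l) (c2 * gamma l ^+ 2)%:C%:M)
  (int_finite :
    (\int[lebesgue_rV d]_l ((gamma l ^+ 4)^-1 * opnorm (F0 l - F1 l) ^+ 2)%:E < +oo)%E).
Notation mu := (lebesgue_rV d : {measure set 'rV[R]_d -> \bar R}).
Notation I := (D * 'I_p)%type.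
Notation K0 := (@covariance_kernel R d p D C0).
Notation K1 := (@covariance_kernel R d p D C1).
Implicit Types xi : seq (R * I).

Let field (i : I) := Z i.1 i.2.

Let W l := gamma l ^+ 2.
(** The entrywise sum is visibly measurable, and [hermitian_entry_le_opnorm] bounds it by a multiple
    of the operator norm. *)
Let g l := \sum_i \sum_j cmod ((F0 l - F1 l) i j).

Let energy_bounds F xi l : (loewner_le (c1 * gamma l ^+ 2)%:C%:M (F l) /\
    loewner_le (F l) (c2 * gamma l ^+ 2)%:C%:M) ->
  c1 * (W l * energy feature xi l) <=
    complex.Re (hermitian_form (F l) (feature_vector xi l)) <=
  c2 * (W l * energy feature xi l).
Proof.
move=> [lo hi]; rewrite energy_featureE; apply/andP; split.
  by rewrite mulrA; have := loewner_le_hermitian_form (feature_vector xi l) lo; rewrite hermitian_form_scalar.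
by rewrite mulrA; have := loewner_le_hermitian_form (feature_vector xi l) hi; rewrite hermitian_form_scalar.
Qed.

(** [F0 l] has positive diagonal entries and is dominated by [c2 * gamma l ^+ 2] times the identity;
    a basis vector tests this. *)
Let W_gt0 l : 0 < W l.
Proof.
pose j : 'I_p := Ordinal p_gt0.
have [_ hi] := bounds0 l; have [/(_ l j) Fjj _ _ _ _] := sd0.
have eF : hermitian_form (F0 l) (delta_mx j 0) = F0 l j j.
  rewrite hermitian_formE (bigD1 j)//= (bigD1 j)//= !mxE !eqxx.
  rewrite big1 => [|k kj]; last by rewrite !mxE (negbTE kj) mulr0.
  rewrite big1 => [|k kj]; last first.
    by rewrite big1// => k' _; rewrite !mxE (negbTE kj) rmorph0 !mul0r.
  by rewrite rmorph1 mul1r mulr1 !addr0.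
have := loewner_le_hermitian_form (delta_mx j 0) hi.
rewrite hermitian_form_scalar eF /= => h.
have : 0 < complex.Re (F0 l j j) by move: Fjj; rewrite ltcE => /andP[].
move=> /lt_le_trans/(_ h).
have -> : cnorm2 (delta_mx j 0 : 'cV[R[i]]_p) = 1.
  rewrite /cnorm2 (bigD1 j)//= big1 => [|k kj]; last first.
    by rewrite !mxE (negbTE kj) cmodE/= expr0n addr0 sqrtr0 expr0n.
  by rewrite !mxE !eqxx (_ : cmod _ = 1) ?expr1n ?addr0//; apply: complexI; rewrite cmodC normr1.
by rewrite mulr1 pmulr_rgt0// (lt_le_trans c1_gt0).
Qed.

Let gamma_cosine : exists a : bool -> 'rV[R]_d -> R,
  [/\ forall e, mu.-integrable setT (EFin \o a e),
      forall e t, ~ cube b t -> a e t = 0 &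
      forall l, gamma l = \sum_(e : bool) \int[mu]_t (a e t * cos (dotv l t + quadrature e))].
Proof.
have [h /(_ (Ordinal p_gt0))[h2 h0 hE]] := gammaW.
apply: (band_limited_cosine (ltW b_gt0) h2 h0) => l.
by rewrite -hE mxE.
Qed.

Let mgamma : measurable_fun setT gamma.
Proof. by have [a [ia _ aE]] := gamma_cosine; exact: measurable_gamma ia aE. Qed.

Let mW : measurable_fun setT W.
Proof. exact: measurable_funX. Qed.

Let m_feature e i : measurable_fun setT (fun l => @feature R d p D e l i).
Proof.
apply: measurable_funM => //; apply: (measurableT_comp (@measurable_cos R)).
by apply: measurable_funD => //; exact: measurable_dotvr.
Qed.

Let m_energy xi : measurable_fun setT (energy feature xi).
Proof. exact: measurable_energy. Qed.

Let int_energy xi : mu.-integrable setT (EFin \o (fun l => W l * energy feature xi l)).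
Proof.
apply: (@le_integrable_EFin _ _ _ mu _ (fun l => c1^-1 *
  complex.Re (hermitian_form (F0 l) (feature_vector xi l)))).
- exact: measurable_funM.
- move=> l; rewrite ger0_norm; last exact: mulr_ge0 (ltW (W_gt0 l)) (energy_ge0 _ _ _).
  by rewrite ler_pdivlMl//; have /andP[] := energy_bounds xi (bounds0 l).
- by apply: integrableZ_EFin; exact: (integrable_hermitian_form_feature sd0).
Qed.

Let kernel_bounds C F xi : matrix_spectral_density C F ->
  (forall l, loewner_le (c1 * gamma l ^+ 2)%:C%:M (F l) /\
    loewner_le (F l) (c2 * gamma l ^+ 2)%:C%:M) ->
  c1 * (\int[mu]_l (W l * energy feature xi l)) <= kernel_form (covariance_kernel C) xi <=
  c2 * (\int[mu]_l (W l * energy feature xi l)).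
Proof.
move=> sd bounds; rewrite (kernel_form_spectral sd) -!RintegralZl//.
have iF := @integrable_hermitian_form_feature _ _ _ D _ _ sd xi.
apply/andP; split; apply: le_Rintegral => //; try (by apply: integrableZ_EFin).
  by move=> l _; have /andP[] := energy_bounds xi (bounds l).
by move=> l _; have /andP[] := energy_bounds xi (bounds l).
Qed.

Let B := c2 / c1.

Let B_ge1 : 1 <= B.
Proof. by rewrite ler_pdivlMr// mul1r. Qed.

Let form_le C F C' F' xi : matrix_spectral_density C F -> matrix_spectral_density C' F' ->
  (forall l, loewner_le (c1 * gamma l ^+ 2)%:C%:M (F l) /\
    loewner_le (F l) (c2 * gamma l ^+ 2)%:C%:M) ->
  (forall l, loewner_le (c1 * gamma l ^+ 2)%:C%:M (F' l) /\
    loewner_le (F' l) (c2 * gamma l ^+ 2)%:C%:M) ->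
  kernel_form (covariance_kernel C) xi <= B * kernel_form (covariance_kernel C') xi.
Proof.
move=> sd sd' bd bd'; have /andP[_ h] := kernel_bounds xi sd bd.
have /andP[h' _] := kernel_bounds xi sd' bd'; apply: (le_trans h).
rewrite /B -mulrA ler_wpM2l//; first exact: le_trans (ltW c1_gt0) _.
by rewrite ler_pdivlMl.
Qed.

Let m_cmod (N : 'rV[R]_d -> R[i]) : cmeasurable N -> measurable_fun setT (fun l => cmod (N l)).
Proof.
move=> [mRe mIm]; under eq_fun do rewrite cmodE.
apply: (measurableT_comp (continuous_measurable_fun (@sqrt_continuous R))).
by apply: measurable_funD; exact: measurable_funX.
Qed.

Let cmeasurable_diff i j : cmeasurable (fun l => (F0 l - F1 l) i j).
Proof.
have [_ /(_ i j)[[r0 i0] _] _ _ _] := sd0; have [_ /(_ i j)[[r1 i1] _] _ _ _] := sd1.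
split.
  rewrite (_ : (fun _ => _) = (fun l => complex.Re (F0 l i j) - complex.Re (F1 l i j))).
    exact: measurable_funB.
  by apply/funext => l; rewrite !mxE; case: (F0 l i j); case: (F1 l i j).
rewrite (_ : (fun _ => _) = (fun l => complex.Im (F0 l i j) - complex.Im (F1 l i j))).
  exact: measurable_funB.
by apply/funext => l; rewrite !mxE; case: (F0 l i j); case: (F1 l i j).
Qed.

Let mg : measurable_fun setT g.
Proof. by apply: measurable_sum => i; apply: measurable_sum => j; exact: m_cmod. Qed.

Let g_ge0 l : 0 <= g l.
Proof. by apply: sumr_ge0 => i _; apply: sumr_ge0 => j _; exact: cmod_ge0. Qed.

Let int_g : mu.-integrable setT (EFin \o g).
Proof.
apply: integrable_sum_EFin => i; apply: integrable_sum_EFin => j.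
have [_ /(_ i j)[_ i0] _ _ _] := sd0; have [_ /(_ i j)[_ i1] _ _ _] := sd1.
apply: (@le_integrable_EFin _ _ _ mu _ (fun l => cmod (F0 l i j) + cmod (F1 l i j))).
- exact: m_cmod.
- move=> l; rewrite ger0_norm ?cmod_ge0// -lecR rmorphD/= !cmodC !mxE.
  exact: ler_normB.
- exact: integrableD_EFin.
Qed.

Let int_g_energy xi : mu.-integrable setT (EFin \o (fun l => g l * energy feature xi l)).
Proof.
pose S := \sum_(t <- xi) `|t.1|.
have fS e l : linear_form xi (@feature R d p D e l) ^+ 2 <= S ^+ 2.
  rewrite -real_normK ?num_real// lerXn2r ?nnegrE//.
    by apply: sumr_ge0 => t _.
  rewrite (le_trans (ler_norm_sum _ _ _))//; apply: ler_sum => t _.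
  rewrite normrM ler_piMr// /feature normrM mulr_ile1// ?cos_max//.
  by rewrite normr_nat lern1 leq_b1.
apply: (@le_integrable_EFin _ _ _ mu _ (fun l => #|{: bool * 'I_p}|%:R * S ^+ 2 * g l)).
- exact: measurable_funM.
- move=> l; rewrite ger0_norm ?mulr_ge0 ?energy_ge0// mulrC ler_wpM2r//.
  rewrite /energy (le_trans (ler_sum _ (fun e _ => fS e l)))//.
  by rewrite sumr_const mulr_natl.
- exact: integrableZ_EFin.
Qed.

Let diff_le xi : `|kernel_form K1 xi - kernel_form K0 xi| <=
  \int[mu]_l (g l * energy feature xi l).
Proof.
rewrite distrC !(kernel_form_spectral sd0) (kernel_form_spectral sd1).
have i0 := @integrable_hermitian_form_feature _ _ _ D _ _ sd0 xi.
have i1 := @integrable_hermitian_form_feature _ _ _ D _ _ sd1 xi.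
rewrite -RintegralB//.
have i01 := integrableB_EFin i0 i1.
apply: (le_trans (le_normr_Rintegral measurableT i01)).
apply: le_Rintegral => //; first exact: integrable_norm i01.
move=> l _; rewrite energy_featureE -[X in `|X|](_ : complex.Re
    (hermitian_form (F0 l - F1 l) (feature_vector xi l)) = _).
  exact: norm_hermitian_form_le.
by rewrite hermitian_formB; case: (hermitian_form _ _); case: (hermitian_form _ _).
Qed.

(** Paley-Wiener for [gamma] times an exponential sum: the squared L^2 norm of the product is at
    most the variance over [c1], by the lower spectral bound. *)
Let pointwise_le : exists2 C, 0 <= C & forall xi e l,
  W l * linear_form xi (feature e l) ^+ 2 <= C * kernel_form K0 xi.
Proof.
have [a [ia a0 aE]] := gamma_cosine.
have [M [Mreal DM]] := D_bounded.
(* [bounded_set] gives a bound for every number strictly above [M]; this one is also nonnegative. *)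
pose M1 := `|M| + 1.
have M1_ge0 : 0 <= M1 by rewrite addr_ge0.
have DM1 (x : D) j : `|set_val x ord0 j| <= M1.
  have h : `|set_val x| <= M1.
    apply: DM; last by have := set_valP x.
    by rewrite /M1 (le_lt_trans (ler_norm _))// ltrDl.
  exact: le_trans (norm_entry_le _ _) h.
have b_M : 0 < b + M1 by rewrite ltr_pwDl.
exists (pw_constant (b + M1) ^+ d * c1^-1).
  by rewrite mulr_ge0 ?invr_ge0 ?exprn_ge0// ltW// pw_constant_gt0.
move=> xi [e j] l; rewrite -exprMn -mulrA.
have le_energy l' : (gamma l' * linear_form xi (feature (e, j) l')) ^+ 2 <=
    W l' * energy feature xi l'.
  rewrite exprMn ler_wpM2l ?sqr_ge0// /energy (bigD1 (e, j))//= lerDl.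
  by apply: sumr_ge0 => k _; exact: sqr_ge0.
have ie : mu.-integrable setT
    (EFin \o (fun l => (gamma l * linear_form xi (feature (e, j) l)) ^+ 2)).
  apply: (@le_integrable_EFin _ _ _ mu _ (fun l => W l * energy feature xi l)) => //.
    apply: measurable_funX; apply: measurable_funM => //.
    by apply: measurable_sum => t; exact: measurable_funM.
  by move=> l'; rewrite ger0_norm ?sqr_ge0.
apply: (gamma_feature_le b_gt0 M1_ge0 ia a0 aE DM1) => //.
apply: (@le_trans _ _ (\int[mu]_l (W l * energy feature xi l))).
  by apply: le_Rintegral => //; exact: int_energy.
by rewrite ler_pdivlMl//; have /andP[] := kernel_bounds xi sd0 bounds0.
Qed.

Let int_ratio : mu.-integrable setT (EFin \o (fun l => (g l / W l) ^+ 2)).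
Proof.
(* There are [p * p] entries, each at most [p] times the operator norm. *)
pose k : R := p%:R * (p%:R * p%:R).
have mh : measurable_fun setT (fun l => ((k ^- 2) * (g l / W l) ^+ 2)%:E).
  apply/measurable_EFinP; apply: measurable_funM => //.
  apply: measurable_funX; apply: measurable_funM => //.
  exact: (measurableT_comp (@measurable_inv R)).
have p0 : 0 < p%:R :> R by rewrite ltr0n.
have k0 : 0 < k by rewrite !mulr_gt0.
have herm l : F0 l - F1 l \is hermsymmx.
  have [_ _ h0 _ _] := sd0; have [_ _ h1 _ _] := sd1.
  have F0l := is_hermitianmxP _ _ _ (h0 l); have F1l := is_hermitianmxP _ _ _ (h1 l).
  apply/is_hermitianmxP; rewrite {1}F0l {1}F1l !expr0 !scale1r.
  by apply/matrixP => i j; rewrite !mxE rmorphB.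
have g_le l : g l <= k * opnorm (F0 l - F1 l).
  rewrite /g (le_trans (ler_sum _ (fun i _ => ler_sum _ (fun j _ =>
    hermitian_entry_le_opnorm i j (herm l)))))//.
  by rewrite !sumr_const card_ord -[leLHS]mulr_natl -[X in _ * X <= _]mulr_natl /k !mulrA.
(* The constant is moved to the measurable side, so that the integrand with [opnorm] is compared
   exactly as it stands in [int_finite]. *)
rewrite (_ : EFin \o _ = EFin \o (fun l => k ^+ 2 * (k ^- 2 * (g l / W l) ^+ 2))); last first.
  by apply/funext => l /=; rewrite mulVKf// expf_neq0// gt_eqF.
apply: integrableZ_EFin; apply/integrableP; split => //.
rewrite (eq_integral (fun l => (k ^- 2 * (g l / W l) ^+ 2)%:E)).
  apply: le_lt_trans int_finite; apply: ge0_le_integral_nonmeasurable => l.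
    by rewrite lee_fin mulr_ge0 ?sqr_ge0// invr_ge0 sqr_ge0.
  rewrite lee_fin.
  have -> : k ^- 2 * (g l / W l) ^+ 2 = (gamma l ^+ 4)^-1 * (g l / k) ^+ 2.
    have gam0 : gamma l != 0 by have := W_gt0 l; rewrite /W; apply: contraTneq => ->; rewrite expr0n ltxx.
    by rewrite /W; field; rewrite gam0 gt_eqF.
  rewrite ler_wpM2l//; first by rewrite invr_ge0 (exprM _ 2 2) sqr_ge0.
  rewrite lerXn2r// ?nnegrE ?divr_ge0// ?(ltW k0)//; last by rewrite ler_pdivrMr// mulrC.
  have := le_trans (g_ge0 l) (g_le l); by rewrite pmulr_rge0.
by move=> l _; rewrite gee0_abs// lee_fin mulr_ge0 ?sqr_ge0// invr_ge0 sqr_ge0.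
Qed.

Let linear_gaussian P C xi : centered_gaussian Z P C ->
  gaussian_rv P (fun w => linear_form xi (field ^~ w)).
Proof.
move=> [gauss _ _]; pose x k := tnth (in_tuple xi) k.
have := gauss _ (fun k => (x k).2.1) (fun k => (x k).2.2) (fun k => (x k).1).
by congr (gaussian_rv P _); apply/funext => w; rewrite /linear_form [RHS]big_tnth.
Qed.

Let gaussian_teval P C ts : centered_gaussian Z P C ->
  \int[P]_w teval ts (field ^~ w) = gaussian_value (covariance_kernel C) ts.
Proof.
move=> gauss; have [_ mean cov] := gauss.
apply: Rintegral_teval => [i|i j|xi]; [exact: mean|exact: cov|exact: linear_gaussian gauss].
Qed.

Lemma absolute_continuity A : field_sigma_algebra Z A -> P0 A = 0%E -> P1 A = 0%E.
Proof.
move=> sA; have [C C_ge0 hC] := pointwise_le.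
(* Ensures [2 * B < n], hence [B <= n.+1 / 2], and depends on [c2 / c1] only. *)
pose n := (Num.truncn (2 * B)).+1.
have [_ mean0 cov0] := gauss0; have [_ mean1 cov1] := gauss1.
apply: (@null_set_transfer _ _ _ _ field P0 P1 n (expR (n.+1%:R ^+ 2 *
  (B ^+ 2 * (#|{: bool * 'I_p}|%:R * C / c1 * \int[mu]_l (g l / W l) ^+ 2)) / 2))).
  move=> ts uts; rewrite (gaussian_teval _ gauss0) (gaussian_teval _ gauss1).
  apply: (@power_comparison _ _ _ _ mu K0 K1 _ feature W g c1 C) => //.
  - by move=> xi; have /andP[] := kernel_bounds xi sd0 bounds0.
  - exact: (@covariance_kernel_sym _ _ _ _ P0 field _ (fun i j => cov0 i.1 j.1 i.2 j.2)).
  - exact: (@covariance_kernel_sym _ _ _ _ P1 field _ (fun i j => cov1 i.1 j.1 i.2 j.2)).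
  - rewrite ler_pdivlMr// mulrC; apply: ltW; rewrite (lt_le_trans (truncnS_gt _))//.
    by rewrite ler_nat.
  - by move=> xi; exact: form_le sd1 sd0 bounds1 bounds0.
  - by move=> xi; exact: form_le sd0 sd1 bounds0 bounds1.
move: sA; rewrite /field_sigma_algebra; congr (<<s _ >> A).
apply/seteqP; split => [_ [s [i [S [mS ->]]]]|_ [[s i] [S [mS ->]]]].
  by exists (s, i), S.
by exists s, i, S.
Qed.

End absolute_continuity.

Lemma field_sigma_algebra_measurable (R : realType) d p (dO : measure_display)
    (Omega : measurableType dO) (D : set 'rV[R]_d) (Z : D -> 'I_p -> {mfun Omega >-> R}) A :
  field_sigma_algebra Z A -> measurable A.
Proof.
move: A; apply: smallest_sub; first exact: sigma_algebra_measurable.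
by move=> _ [s [i [B [mB ->]]]]; rewrite -[X in measurable X]setTI; exact: measurable_funPT.
Qed.

Lemma probability_eq1_setC dO (Omega : measurableType dO) (R : realType)
    (P : probability Omega R) A : measurable A -> P A = 1%E <-> P (~` A) = 0%E.
Proof.
move=> mA; rewrite probability_setC// -(fineK (fin_num_measure P _ mA)).
by split => [[->]|[/eqP]]; rewrite ?subee// subr_eq0 => /eqP <-.
Qed.

Theorem theorem2 (R : realType) (d p : nat) (hd : (0 < d)%N) (hp : (0 < p)%N)
  (D : set 'rV[R]_d) (D_bounded : bounded_set D) (D_int : D° !=set0)
  (dO : measure_display) (Omega : measurableType dO)
  (Z : D -> 'I_p -> {mfun Omega >-> R})
  (R0 R1 : 'rV[R]_d -> 'M[R]_p) (F0 F1 : 'rV[R]_d -> 'M[R[i]]_p)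
  (cov0 : matrix_covariance R0) (cov1 : matrix_covariance R1)
  (sd0 : matrix_spectral_density R0 F0) (sd1 : matrix_spectral_density R1 F1)
  (P0 P1 : probability Omega R)
  (gauss0 : centered_gaussian Z P0 R0) (gauss1 : centered_gaussian Z P1 R1)
  (c1 c2 b : R) (gamma : 'rV[R]_d -> R)
  (c1_gt0 : 0 < c1) (c1_lt_c2 : c1 < c2) (b_gt0 : 0 < b)
  (gammaW : Wspace (cube b) (fun l => const_mx (gamma l)%:C : 'cV[R[i]]_p))
  (bounds0 : forall l, loewner_le (c1 * gamma l ^+ 2)%:C%:M (F0 l) /\
                       loewner_le (F0 l) (c2 * gamma l ^+ 2)%:C%:M)
  (bounds1 : forall l, loewner_le (c1 * gamma l ^+ 2)%:C%:M (F1 l) /\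
                       loewner_le (F1 l) (c2 * gamma l ^+ 2)%:C%:M)
  (int_finite :
    (\int[lebesgue_rV d]_l
       ((gamma l ^+ 4)^-1 * opnorm (F0 l - F1 l) ^+ 2)%:E < +oo)%E) :
  equivalent_on_paths Z P0 P1.
Proof.
(* The two implications exchange the roles of the measures, and [opnorm] is even. *)
have int_finite' : (\int[lebesgue_rV d]_l
    ((gamma l ^+ 4)^-1 * opnorm (F1 l - F0 l) ^+ 2)%:E < +oo)%E.
  rewrite (eq_integral (fun l => ((gamma l ^+ 4)^-1 * opnorm (F0 l - F1 l) ^+ 2)%:E)).
    exact: int_finite.
  by move=> l _; rewrite -opnormN opprB.
move=> A sA; have mA := field_sigma_algebra_measurable sA.
have sAc : field_sigma_algebra Z (~` A) by exact: sigma_algebraC sA.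
rewrite !probability_eq1_setC//; split.
  by apply: (absolute_continuity hp D_bounded sd1 sd0 gauss1 gauss0 c1_gt0 (ltW c1_lt_c2)
    b_gt0 gammaW bounds1 bounds0 int_finite').
by apply: (absolute_continuity hp D_bounded sd0 sd1 gauss0 gauss1 c1_gt0 (ltW c1_lt_c2)
  b_gt0 gammaW bounds0 bounds1 int_finite).
Qed.
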